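(* Let $d\ge2$. Suppose that $\mathcal{S}$ is a substitution rule in $\mathbb{R}^d$ with dilation factor $\lambda>1$, that its substitution matrix $M_{\mathcal{S}}$ is primitive, and that $$r(M_{\mathcal{S}}):=\max\{|\eta| : \eta\ne\mu \text{ is an eigenvalue of } M_{\mathcal{S}}\}<\lambda,$$ where $\mu$ is the Perron eigenvalue of $M_{\mathcal{S}}$. Then there exists $\beta>0$ such that for every tiling $\mathcal{T}$ in $\Omega_{\mathcal{S}}$, the Delone set $X_{\mathcal{T}}$ induced by $\mathcal{T}$ is obtained from $\beta\mathbb{Z}^d$ by a bounded displacement.
   Context: Tilings. A tiling of a closed set $\Lambda\subset\mathbb{R}^d$ is an at most countable collection of closed subsets of $\Lambda$ (tiles) that cover $\Lambda$ and have pairwise disjoint interiors; all tiles are assumed homeomorphic to the closed unit ball of $\mathbb{R}^d$. Tiles may carry a color. Let $\mathcal{E}$ be a group of isometries of $\mathbb{R}^d$ containing all translations. A tile $q$ is an $\mathcal{E}$-copy of $p$ if $q$ is the image of $p$ under an isometry in $\mathcal{E}$ (and has the same color, if tiles are colored). Let $\mathcal{P}=\{p_1,\dots,p_k\}$ be a finite collection of tiles (prototiles). A tiling is $\mathcal{E}$-generated by $\mathcal{P}$ if each of its tiles is an $\mathcal{E}$-copy of some prototile. $\Omega_{\mathcal{E},\mathcal{P}}$ is the set of tilings of $\mathbb{R}^d$ that are $\mathcal{E}$-generated by $\mathcal{P}$. Substitutions. A substitution rule with dilation factor $\lambda>1$ is a collection $\mathcal{S}=(\mathcal{S}_{p_i})_{i=1}^k$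 where each $\mathcal{S}_{p_i}$ is a tiling of $\lambda p_i=\{\lambda x: x\in p_i\}$ that is $\mathcal{E}$-generated by $\mathcal{P}$. The map $\mathcal{I}_{\mathcal{S}}:\Omega_{\mathcal{E},\mathcal{P}}\to\Omega_{\mathcal{E},\mathcal{P}}$ dilates each tile of $\mathcal{T}$ by $\lambda$ and subdivides it according to the rule: a tile $t=O(p_i)$, $O\in\mathcal{E}$, yields the tiles of $O_\lambda(\mathcal{S}_{p_i})$, where $O_\lambda(x)=\lambda O(x/\lambda)$ (an element of $\mathcal{E}$, mapping $\lambda p_i$ onto $\lambda t$). The set of admissible tilings is $\Omega_{\mathcal{S}}=\bigcap_{m\ge0}\mathcal{I}_{\mathcal{S}}^m(\Omega_{\mathcal{E},\mathcal{P}})$. Substitution matrix. Prototiles $p_i,p_j$ have the same type ($\mathcal{S}$-equivalent) if there is an isometry $O$ of $\mathbb{R}^d$ with $O(p_i)=p_j$ whose rescaling $O_\lambda$ maps $\mathcal{S}_{p_i}$ onto $\mathcal{S}_{p_j}$. Let $q_1,\dots,q_n$ be the types of prototiles; an $\mathcal{E}$-copy of a prototile has the type of that prototile. $M_{\mathcal{S}}=(m_{i,j})$ is the $n\times n$ matrix where $m_{i,j}$ is the number of tiles of type $q_j$ in $\mathcal{S}_p$, $p$ being any prototile of type $q_i$ (this number does not depend on the choice of $p$). A nonnegative matrix is primitive if some power has all entries positive; its Perron eigenvalue $\mu$ is then its largest positive real eigenvalue (for $M_{\mathcal{S}}$, $\mu=\lambda^d$). If $n=1$, $r(M_{\mathcal{S}})=0$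 by convention. Delone sets. A Delone set in $\mathbb{R}^d$ is a set $X$ for which there are $r_0,R_0>0$ such that each ball of radius $R_0$ contains at least one point of $X$ and each ball of radius $r_0$ at most one. $X_{\mathcal{T}}$ is the set of barycenters of the tiles of $\mathcal{T}$; it is taken to be a Delone set having exactly one point for each tile of $\mathcal{T}$ (distinct tiles have distinct barycenters). A Delone set $X$ is obtained from a Delone set $Y$ by a bounded displacement if there is a homeomorphism (in particular a bijection) $\phi:Y\to X$ with $\sup_{y\in Y}\|\phi(y)-y\|<\infty$. *)

(* Defs.v *)
From HB Require Import structures.
From mathcomp Require Import all_boot all_order all_algebra.
From mathcomp Require Import all_classical all_reals all_analysis.
From mathcomp Require Import complex.

Set Implicit Arguments.
Unset Strict Implicit.
Unset Printing Implicit Defensive.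

Import Order.TTheory GRing.Theory Num.Theory.
Import numFieldTopology.Exports numFieldNormedType.Exports.

Local Open Scope classical_set_scope.
Local Open Scope ring_scope.

Section Euclidean.
Context (R : realType) (d : nat).
Local Notation V := 'rV[R]_d.

(* The norm that the library puts on row vectors is the sup norm; isometries
   and balls refer to the Euclidean norm. *)
Definition enorm (x : V) : R := Num.sqrt (\sum_i x 0 i ^+ 2).

Definition cball (x : V) (r : R) : set V := [set y | enorm (y - x) <= r].

Definition isometry (f : V -> V) : Prop :=
  forall x y, enorm (f x - f y) = enorm (x - y).

(* f restricts to a homeomorphism from A onto B, with inverse g. *)
Definition homeo_on (A B : set V) (f g : V -> V) : Prop :=
  [/\ f @` A `<=` B, g @` B `<=` A,
      (forall x, A x -> g (f x) = x), (forall y, B y -> f (g y) = y) &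
      {within A, continuous f} /\ {within B, continuous g}].

Definition homeomorphic (A B : set V) : Prop := exists f g, homeo_on A B f g.

Definition delone (X : set V) : Prop :=
  exists r0 R0 : R, [/\ 0 < r0, 0 < R0,
    (forall x, (X `&` cball x R0) !=set0) &
    (forall x, is_subset1 (X `&` cball x r0))].

(* X is obtained from Y by a bounded displacement. *)
Definition bounded_displacement (Y X : set V) : Prop :=
  exists phi psi : V -> V, homeo_on Y X phi psi /\
    exists K : R, forall y, Y y -> enorm (phi y - y) <= K.

Definition scaled_lattice (beta : R) : set V :=
  [set beta *: map_mx intr z | z in [set: 'rV[int]_d]].

Definition isometry_group (E : set (V -> V)) : Prop :=
  [/\ (forall f, E f -> isometry f),
      (forall v, E (fun x => x + v)),
      (forall f g, E f -> E g -> E (f \o g)) &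
      (forall f, E f -> exists g, [/\ E g, cancel f g & cancel g f])].

End Euclidean.

(* Lebesgue integral over R^d, as an iterated one-dimensional integral; by
   Fubini this is the usual integral for integrable Borel functions whose
   successive partial integrals are finite, in particular for the bounded,
   compactly supported functions integrated in [barycenter]. *)
Fixpoint integral_Rd (R : realType) (d : nat) : ('rV[R]_d -> R) -> R :=
  match d with
  | 0 => fun f => f 0
  | d'.+1 => fun f =>
      Rintegral lebesgue_measure setT
        (fun x : R => integral_Rd (fun y : 'rV[R]_d' => f (row_mx x%:M y)))
  end.

Definition barycenter (R : realType) (d : nat) (A : set 'rV[R]_d) : 'rV[R]_d :=
  (integral_Rd (\1_A : 'rV[R]_d -> R))^-1
    *: \row_i integral_Rd (fun x : 'rV[R]_d => x 0 i * \1_A x).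

Section Tilings.
(* C is the type of colors; uncolored tiles are obtained with C := unit. *)
Context (R : realType) (d : nat) (C : Type).
Local Notation V := 'rV[R]_d.

Definition ctile : Type := (set V * C)%type.

Definition is_tile (t : ctile) : Prop :=
  closed t.1 /\ homeomorphic t.1 (cball (0 : V) 1).

Definition tiling (L : set V) (T : set ctile) : Prop :=
  [/\ countable T,
      (forall t, T t -> is_tile t /\ t.1 `<=` L),
      L `<=` \bigcup_(t in T) t.1 &
      (forall t u, T t -> T u -> t <> u -> interior t.1 `&` interior u.1 = set0)].

Definition map_tile (f : V -> V) (t : ctile) : ctile := (f @` t.1, t.2).

Definition barycenters (T : set ctile) : set V :=
  [set barycenter t.1 | t in T].

Context (E : set (V -> V)).

Definition ecopy (p q : ctile) : Prop := exists2 O, E O & q = map_tile O p.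

Context (k : nat) (P : 'I_k -> ctile).

Definition generated (T : set ctile) : Prop :=
  forall t, T t -> exists i, ecopy (P i) t.

Definition Omega_EP : set (set ctile) :=
  [set T | tiling setT T /\ generated T].

Context (lambda : R) (S : 'I_k -> set ctile).

(* O_lambda (x) = lambda O (x / lambda). *)
Definition rescale (O : V -> V) : V -> V :=
  fun x => lambda *: O (lambda^-1 *: x).

(* The last clause says that the subdivision of a dilated tile depends only on
   the tile t, and not on the way t is written as O(p_i); it is what makes
   [inflate] subdivide each dilated tile exactly once, and the type of an
   E-copy of a prototile well defined. *)
Definition substitution_rule : Prop :=
  [/\ 1 < lambda,
      (forall i, tiling [set lambda *: x | x in (P i).1] (S i)),
      (forall i, generated (S i)) &
      (forall i j O O', E O -> E O' ->
         map_tile O (P i) = map_tile O' (P j) ->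
         map_tile (rescale O) @` S i = map_tile (rescale O') @` S j)].

Definition inflate (T : set ctile) : set ctile :=
  [set q | exists t i O, [/\ T t, E O, t = map_tile O (P i) &
                             (map_tile (rescale O) @` S i) q]].

Definition Omega_S : set (set ctile) :=
  \bigcap_m (iter m inflate @` Omega_EP).

Definition same_type (i j : 'I_k) : Prop :=
  exists O, [/\ isometry O, map_tile O (P i) = P j &
                map_tile (rescale O) @` S i = S j].

Context (n : nat) (ty : 'I_k -> 'I_n).

(* ty numbers the types: prototile i has type q_(ty i), and there are exactly
   n types. *)
Definition type_numbering : Prop :=
  (forall a, exists i, ty i = a) /\
  (forall i j, ty i = ty j <-> same_type i j).

Definition has_type (q : ctile) (a : 'I_n) : Prop :=
  exists2 i, ty i = a & ecopy (P i) q.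

(* Row (ty i) counts the tiles of each type in S_i, for every prototile i. *)
Definition substitution_matrix (M : 'M[nat]_n) : Prop :=
  forall i b, ([set q | S i q /\ has_type q b] #= `I_(M (ty i) b))%card.

End Tilings.

Section Spectrum.
Context (R : realType) (n : nat).
Local Open Scope complex_scope.

Definition primitive_mx (M : 'M[nat]_n) : Prop :=
  exists2 m, (0 < m)%N & forall i j, (0 < (M ^+ m) i j)%N.

Definition complex_mx (M : 'M[nat]_n) : 'M[R[i]]_n :=
  map_mx (fun m : nat => m%:R) M.

(* The two suprema below are over finite sets, hence maxima when the sets are
   nonempty; sup set0 = 0 gives the convention r(M) = 0 when n = 1. *)
Definition perron_eigenvalue (M : 'M[nat]_n) : R :=
  sup [set x : R | 0 < x /\ eigenvalue (complex_mx M) x%:C].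

Definition r_mx (M : 'M[nat]_n) : R :=
  sup [set complex.Re `|eta| | eta in
         [set eta : R[i] | eigenvalue (complex_mx M) eta /\
                           eta <> (perron_eigenvalue M)%:C]].

End Spectrum.

(* Main.v *)
(* Let v be the vector of volumes of the types: M v = lambda^d v. The spectral
   gap gives theta > 0 with |M^m (1 - theta v)| = O(rho^m) for some rho < lambda,
   so that, weighing each tile by 1 - theta vol, its descendants of generation m
   almost cancel. For a finite union F of unit cells, comparing averages of the
   indicator of F over boxes of sides lambda^j along the hierarchy of ancestors
   and summing the geometric series in rho lambda / lambda^d < 1 bounds
   |#(tiles in F) - theta vol(tiles in F)| by a multiple of the surface of F.
   With theta vol([0, beta]^d) = 1, the tiles near a union of sufficiently
   large cubes then outnumber the points of beta Z^d in it, and conversely.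
   These are Hall's conditions for both bounded-distance bipartite graphs;
   the two injections are combined by Cantor and Bernstein's argument, and
   the bijection obtained is a homeomorphism because both sets are discrete.

   Since the Lebesgue measure of the boundary of a tile is not known to vanish,
   the volume is replaced by a Banach limit of normalized packing numbers of
   lambda^j A. *)

Require Import Defs.
From HB Require Import structures.
From mathcomp Require Import all_boot all_order all_algebra finmap.
From mathcomp Require Import all_classical all_reals all_analysis.
From mathcomp Require Import complex measurable_realfun zify ring lra.

Set Implicit Arguments.
Unset Strict Implicit.
Unset Printing Implicit Defensive.

Import Defs Order.TTheory GRing.Theory Num.Theory.
Import numFieldTopology.Exports numFieldNormedType.Exports.

Local Open Scope classical_set_scope.
Local Open Scope ring_scope.

(** * Perron-Frobenius theory and the spectral gap *)

(** The decay of order rho^m requires an exact eigenvector v, so the substitute for the volume has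
    to be exactly additive over the subdivision of a tile. Two facts ensure this. Shift invariance
    of the Banach limit makes dilation by lambda multiply every limit density by exactly lambda^d.
    Packing all of a dilated set gives a subadditive quantity, and packing only the points whose
    unit ball stays inside gives a superadditive one; they yield opposite inequalities for M and mu
    = lambda^d. A maximum principle then shows that the boundary layers separating the two have
    density 0 for tiles, and both become the same eigenvector.

    The assumptions r(M) < lambda and d >= 2 meet in one ratio: at level j the weights are of order
    rho^j, while displacing an average over a box of side lambda^j by a distance comparable to that
    side costs lambda^j / (lambda^j)^d per cell where the test function jumps. The estimate is
    uniform in the tiling because an admissible tiling has ancestors of every generation, and the
    contribution of the oldest ones tends to 0. *)

Definition real_mx (R : realType) n (M : 'M[nat]_n) : 'M[R]_n :=
  map_mx (fun m : nat => m%:R) M.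

Section Growth.
Variables (K : numFieldType) (n : nat) (A : 'M[K]_n.+1).

Lemma iter_mulmx (p : nat) (m : nat) (x : 'M[K]_(n.+1, p)) :
  iter m (mulmx A) x = A ^+ m *m x.
Proof.
elim: m => [|m IH] /=; first by rewrite expr0 mul1mx.
by rewrite IH exprS mulmxA.
Qed.

(* One linear factor at a time: each factor costs a geometric series of ratio
   at most r / rho. *)
Lemma growth_annihilated (s : seq K) (r rho : K) (e : 'cV[K]_n.+1) :
  0 <= r -> r < rho -> (forall z, z \in s -> `|z| <= r) ->
  horner_mx A (\prod_(z <- s) ('X - z%:P)) *m e = 0 ->
  exists2 C : K, 0 <= C & forall m i, `|(A ^+ m *m e) i 0| <= C * rho ^+ m.
Proof.
move=> r0 rrho; have rho0 : 0 < rho by apply: le_lt_trans rrho.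
elim: s e => [|z s IH] e sr.
  rewrite big_nil rmorph1 mul1mx => ->; exists 0 => // m i.
  by rewrite mulmx0 mxE normr0 mul0r.
rewrite big_cons mulrC rmorphM /= -mulmxE -mulmxA => /IH.
case=> [y ys|C C0 HC]; first by apply: sr; rewrite inE ys orbT.
have zr : `|z| <= r by apply: sr; rewrite inE eqxx.
set e1 := horner_mx A ('X - z%:P) *m e in HC.
have e1E m : A ^+ m.+1 *m e = z *: (A ^+ m *m e) + A ^+ m *m e1.
  rewrite /e1 rmorphB /= horner_mx_X horner_mx_C mulmxBl mulmxBr.
  by rewrite mulmxA mulmxE -exprSr mul_scalar_mx -scalemxAr addrCA subrr addr0.
pose C' := \sum_i `|e i 0| + C / (rho - r).
have rr0 : 0 < rho - r by rewrite subr_gt0.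
have C'0 : 0 <= C'.
  by rewrite addr_ge0 ?sumr_ge0// divr_ge0 // ltW.
exists C' => // m; elim: m => [|m IHm] i.
  rewrite !expr0 mul1mx mulr1 /C' (bigD1 i) //= -addrA lerDl.
  by rewrite addr_ge0 ?sumr_ge0// divr_ge0// ltW.
rewrite e1E mxE [X in `|X + _|]mxE (le_trans (ler_normD _ _))// normrM.
have h1 : `|z| * `|(A ^+ m *m e) i 0| <= r * (C' * rho ^+ m).
  by apply: ler_pM.
apply: (le_trans (lerD h1 (HC m i))).
rewrite exprSr !mulrA -mulrDl [C' * _]mulrC -mulrA [rho ^+ m * _]mulrC.
rewrite mulrAC [_ * rho]mulrC ?mulrA ler_pM2r ?exprn_gt0//.
rewrite -lerBrDl -mulrBl -ler_pdivrMl// mulrC.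
by rewrite /C' lerDr sumr_ge0.
Qed.

End Growth.
Section Perron.
Variables (R : realType) (n : nat) (M : 'M[nat]_n.+1) (mu : R) (v : 'cV[R]_n.+1).
Local Notation Mr := (real_mx R M).
Local Notation Mc := (complex_mx R M).
Local Notation C := (complex R).
Hypotheses (v_gt0 : forall i, 0 < v i 0) (Mv : Mr *m v = mu *: v) (mu_gt0 : 0 < mu).

Lemma real_mxX m : Mr ^+ m = real_mx R (M ^+ m).
Proof.
elim: m => [|m IH]; first by rewrite !expr0; apply/matrixP => i j; rewrite !mxE; case: eqP.
rewrite !exprS IH; apply/matrixP => i j; rewrite !mxE natr_sum.
by apply: eq_bigr => k _; rewrite !mxE natrM.
Qed.

Lemma perron_pow m : Mr ^+ m *m v = mu ^+ m *: v.
Proof.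
elim: m => [|m IH]; first by rewrite !expr0 mul1mx scale1r.
by rewrite exprSr -mulmxE -mulmxA Mv -scalemxAr IH scalerA exprS.
Qed.

(** Since the entries of M are nonnegative and M v = mu v, the largest ratio |x i| / v i grows by a
    factor of at most mu at each step. *)
Lemma real_mulmx_bound m (x : 'cV[R]_n.+1) (c : R) : (forall i, `|x i 0| <= c * v i 0) ->
  forall i, `|(Mr ^+ m *m x) i 0| <= c * mu ^+ m * v i 0.
Proof.
move=> xc i; have -> : c * mu ^+ m * v i 0 = c * (Mr ^+ m *m v) i 0.
  by rewrite perron_pow mxE mulrA.
rewrite !mxE mulr_sumr (le_trans (ler_norm_sum _ _ _))//.
apply: ler_sum => j _; rewrite real_mxX mxE normrM ger0_norm ?ler0n//.
by rewrite mulrCA ler_wpM2l ?ler0n.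
Qed.

(** With s the minimum of w / v, the vector w - s v is nonnegative and vanishes at a minimizing
    index. A positive power of M multiplies it by a power of mu, so at that index a sum of
    nonnegative terms with positive coefficients is 0, and every entry vanishes. *)
Lemma eigenvector_proportional (w : 'cV[R]_n.+1) : primitive_mx M ->
  Mr *m w = mu *: w -> exists s, w = s *: v.
Proof.
move=> [m _ Mpos] Mw.
pose f i := w i 0 / v i 0.
pose i0 := [arg min_(i < ord0) f i]%O.
have fi0 i : f i0 <= f i by rewrite /i0; case: arg_minP => // j _; exact.
pose x : 'cV_n.+1 := w - f i0 *: v.
have x0 i : 0 <= x i 0.
  have := fi0 i; rewrite ler_pdivlMr// => h.
  by rewrite !mxE subr_ge0.
have xi0 : x i0 0 = 0.
  by rewrite !mxE /f divfK ?subrr// gt_eqF.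
have wpow : Mr ^+ m *m w = mu ^+ m *: w.
  elim: (m) => [|k IH]; first by rewrite !expr0 mul1mx scale1r.
  by rewrite exprSr -mulmxE -mulmxA Mw -scalemxAr IH scalerA exprS.
have : (Mr ^+ m *m x) i0 0 = 0.
  rewrite /x mulmxBr wpow -scalemxAr perron_pow scalerA mulrC -scalerA -scalerBr.
  by rewrite mxE xi0 mulr0.
rewrite mxE => /psumr_eq0P H.
exists (f i0); apply/matrixP => i j; rewrite ord1.
have := H (fun k _ => _) i isT.
rewrite real_mxX => /(_ _)/eqP; rewrite mulf_eq0 mxE pnatr_eq0 => h.
have /orP[|/eqP] : (((M ^+ m) i0 i == 0%N) || (x i 0 == 0)).
  by apply: h => k; rewrite mulr_ge0// mxE ler0n.
  by rewrite eqn0Ngt Mpos.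
by rewrite !mxE => /eqP; rewrite subr_eq0 => /eqP.
Qed.

(** A Jordan block of size 2 at mu would make M^m w grow like m mu^m, beyond the bound of
    [real_mulmx_bound]. *)
Lemma perron_semisimple_real (w : 'cV[R]_n.+1) :
  (Mr - mu%:M) *m ((Mr - mu%:M) *m w) = 0 -> (Mr - mu%:M) *m w = 0.
Proof.
set u := (Mr - mu%:M) *m w => /eqP; rewrite mulmxBl mul_scalar_mx subr_eq0 => /eqP Mu.
have Mw : Mr *m w = mu *: w + u.
  by rewrite /u mulmxBl mul_scalar_mx addrC subrK.
have Mpw m : Mr ^+ m.+1 *m w = mu ^+ m.+1 *: w + (m.+1%:R * mu ^+ m) *: u.
  elim: m => [|m IH]; first by rewrite !expr1 expr0 mulr1 scale1r.
  rewrite exprS -mulmxE -mulmxA IH mulmxDr -!scalemxAr Mu Mw scalerDr !scalerA.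
  rewrite -addrA -scalerDl -exprSr; congr (_ + _ *: _).
  by rewrite -[in RHS]addn1 natrD mulrDl mul1r addrC -mulrA -exprSr.
pose c := \sum_i `|w i 0| / v i 0.
have wc i : `|w i 0| <= c * v i 0.
  rewrite -ler_pdivrMr// /c (bigD1 i)//= lerDl sumr_ge0// => j _.
  by rewrite divr_ge0// ltW.
have key m i : m.+1%:R * `|u i 0| <= 2 * c * mu * v i 0.
  have := real_mulmx_bound m.+1 wc i.
  rewrite Mpw mxE [X in `|X + _|]mxE [X in `|_ + X|]mxE => h.
  have h2 : `|m.+1%:R * mu ^+ m * u i 0| <= 2 * (c * mu ^+ m.+1 * v i 0).
    rewrite -[X in `|X|](addKr (mu ^+ m.+1 * w i 0)).
    rewrite (le_trans (ler_normD _ _))// normrN mulrDl !mul1r lerD//.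
    rewrite normrM ger0_norm ?exprn_ge0 ?(ltW mu_gt0)//.
    by rewrite mulrAC mulrC ler_pM2r ?exprn_gt0.
  move: h2; rewrite !normrM normr_nat (ger0_norm (exprn_ge0 _ (ltW mu_gt0))).
  rewrite exprS => h2; rewrite -(@ler_pM2l _ (mu ^+ m)) ?exprn_gt0//.
  by apply: le_trans (le_trans h2 _); rewrite le_eqVlt; apply/orP; left; apply/eqP; ring.
apply/matrixP => i j; rewrite ord1 [RHS]mxE; apply/eqP/negPn/negP => ui.
have ui0 : 0 < `|u i 0| by rewrite normr_gt0.
set b := 2 * c * mu * v i 0 in key.
have := key (Num.truncn (b / `|u i 0|)) i.
rewrite -ler_pdivlMr// leNgt; move/negP; apply.
by rewrite truncnS_gt.
Qed.

Lemma ReD (x y : C) : complex.Re (x + y) = complex.Re x + complex.Re y.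
Proof. by case: x; case: y. Qed.

Lemma ImD (x y : C) : complex.Im (x + y) = complex.Im x + complex.Im y.
Proof. by case: x; case: y. Qed.

Lemma Re_natM k (x : C) : complex.Re (k%:R * x) = k%:R * complex.Re x.
Proof.
elim: k => [|k IH]; first by rewrite !mul0r.
by rewrite -!natr1 !mulrDl !mul1r ReD IH.
Qed.

Lemma Im_natM k (x : C) : complex.Im (k%:R * x) = k%:R * complex.Im x.
Proof.
elim: k => [|k IH]; first by rewrite !mul0r.
by rewrite -!natr1 !mulrDl !mul1r ImD IH.
Qed.

Lemma complex_mx_Re p (w : 'M[C]_(n.+1, p)) :
  map_mx (@complex.Re R) (Mc *m w) = Mr *m map_mx (@complex.Re R) w.
Proof.
apply/matrixP => i j; rewrite !mxE (big_morph (@complex.Re R) ReD (erefl _)).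
by apply: eq_bigr => k _; rewrite !mxE Re_natM.
Qed.

Lemma complex_mx_Im p (w : 'M[C]_(n.+1, p)) :
  map_mx (@complex.Im R) (Mc *m w) = Mr *m map_mx (@complex.Im R) w.
Proof.
apply/matrixP => i j; rewrite !mxE (big_morph (@complex.Im R) ImD (erefl _)).
by apply: eq_bigr => k _; rewrite !mxE Im_natM.
Qed.
Local Notation toC := (fun x : R => x%:C%C).

Local Notation vC := (map_mx (fun x : R => x%:C%C) v).
Local Notation muC := (mu%:C%C).

Lemma complex_mx_real : Mc = map_mx (fun x : R => x%:C%C) Mr.
Proof. by apply/matrixP => i j; rewrite !mxE -(rmorph_nat (real_complex R)). Qed.

Lemma Mc_vC : Mc *m vC = muC *: vC.
Proof.
rewrite complex_mx_real -(map_mxM (real_complex R)) Mv.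
by apply/matrixP => i j; rewrite !mxE rmorphM.
Qed.

Lemma complex_mx_decomp (w : 'cV[C]_n.+1) :
  w = map_mx (fun x : R => x%:C%C) (map_mx (@complex.Re R) w) +
      'i%C *: map_mx (fun x : R => x%:C%C) (map_mx (@complex.Im R) w).
Proof.
by apply/matrixP => i j; rewrite !mxE; case: (w i j) => a b /=; simpc.
Qed.

(** As M and mu are real, kernels of powers of M - mu are studied on real and imaginary parts
    separately. *)
Lemma shift_Re (w : 'cV[C]_n.+1) :
  map_mx (@complex.Re R) ((Mc - muC%:M) *m w) = (Mr - mu%:M) *m map_mx (@complex.Re R) w.
Proof.
rewrite !mulmxBl !mul_scalar_mx -complex_mx_Re; apply/matrixP => i j; rewrite !mxE.
by case: (\sum_j0 _) => a b; case: (w i j) => c e /=; rewrite mul0r subr0.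
Qed.

Lemma shift_Im (w : 'cV[C]_n.+1) :
  map_mx (@complex.Im R) ((Mc - muC%:M) *m w) = (Mr - mu%:M) *m map_mx (@complex.Im R) w.
Proof.
rewrite !mulmxBl !mul_scalar_mx -complex_mx_Im; apply/matrixP => i j; rewrite !mxE.
by case: (\sum_j0 _) => a b; case: (w i j) => c e /=; rewrite mul0r addr0.
Qed.

Lemma Re_Im_eq0 (w : 'cV[C]_n.+1) :
  map_mx (@complex.Re R) w = 0 -> map_mx (@complex.Im R) w = 0 -> w = 0.
Proof.
move=> wr wi; rewrite [w]complex_mx_decomp wr wi.
by apply/matrixP => i j; rewrite !mxE mulr0 addr0.
Qed.

Lemma map_Re0 : map_mx (@complex.Re R) (0 : 'cV[C]_n.+1) = 0.
Proof. by apply/matrixP => i j; rewrite !mxE. Qed.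

Lemma map_Im0 : map_mx (@complex.Im R) (0 : 'cV[C]_n.+1) = 0.
Proof. by apply/matrixP => i j; rewrite !mxE. Qed.

Lemma perron_semisimple (w : 'cV[C]_n.+1) :
  (Mc - muC%:M) *m ((Mc - muC%:M) *m w) = 0 -> (Mc - muC%:M) *m w = 0.
Proof.
move=> h; apply: Re_Im_eq0; rewrite ?shift_Re ?shift_Im; apply: perron_semisimple_real.
  by rewrite -!shift_Re h map_Re0.
by rewrite -!shift_Im h map_Im0.
Qed.

(** Semisimplicity lowers the exponent one unit at a time, down to an eigenvector, whose real and
    imaginary parts are multiples of v. *)
Lemma perron_kernel k (w : 'cV[C]_n.+1) : primitive_mx M ->
  (Mc - muC%:M) ^+ k *m w = 0 -> exists theta : C, w = theta *: vC.
Proof.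
move=> prim.
have base : (Mc - muC%:M) *m w = 0 -> exists theta : C, w = theta *: vC.
  move=> h.
  have [s hs] : exists s, map_mx (@complex.Re R) w = s *: v.
    apply: eigenvector_proportional => //; apply/eqP; rewrite -subr_eq0 -mul_scalar_mx -mulmxBl.
    by rewrite -shift_Re h map_Re0.
  have [t ht] : exists t, map_mx (@complex.Im R) w = t *: v.
    apply: eigenvector_proportional => //; apply/eqP; rewrite -subr_eq0 -mul_scalar_mx -mulmxBl.
    by rewrite -shift_Im h map_Im0.
  exists (s%:C%C + 'i%C * t%:C%C); rewrite [w]complex_mx_decomp hs ht.
  by apply/matrixP => i j; rewrite !mxE !rmorphM mulrDl mulrA.
elim: k => [|k IH] h.
  by exists 0; rewrite expr0 mul1mx in h; rewrite h scale0r.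
case: k IH h => [_|k IH]; first by rewrite expr1.
rewrite !exprS -!mulmxE -!mulmxA => /perron_semisimple h.
by apply: IH; rewrite exprS -mulmxE -mulmxA.
Qed.

(** For a left eigenvector u, pairing |u| with the positive right eigenvector v gives |z| sum |u j|
    v j <= mu sum |u j| v j. *)
Lemma eigenvalue_le (z : C) : eigenvalue Mc z -> `|z| <= muC.
Proof.
case/eigenvalueP => u uM u0.
have vC0 i : 0 < (v i 0)%:C%C :> C by rewrite ltcR.
have [j0 uj0] : exists j, u 0 j != 0.
  apply/existsP; apply: contraNT u0; rewrite negb_exists => /forallP h.
  apply/eqP/matrixP => i j; rewrite ord1 mxE; apply/eqP.
  by have := h j; rewrite negbK.
pose s := \sum_j `|u 0 j| * (v j 0)%:C%C : C.
have s0 : 0 < s.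
  rewrite /s (bigD1 j0)//= ltr_wpDr ?sumr_ge0 ?mulr_gt0 ?normr_gt0// => j _.
  by rewrite mulr_ge0// ltW.
rewrite -(ler_pM2r s0) {1}/s mulr_sumr.
have -> : muC * s = \sum_i `|u 0 i| * (Mc *m vC) i 0.
  rewrite Mc_vC /s mulr_sumr; apply: eq_bigr => i _; rewrite !mxE; ring.
under [X in _ <= X]eq_bigr do rewrite mxE mulr_sumr.
rewrite exchange_big /=; apply: ler_sum => j _.
rewrite mulrA -normrM; have -> : z * u 0 j = (u *m Mc) 0 j by rewrite uM mxE.
under eq_bigr do rewrite mulrA [vC _ _]mxE.
rewrite -mulr_suml ler_pM2r// mxE (le_trans (ler_norm_sum _ _ _))//.
by apply: ler_sum => i _; rewrite normrM !mxE normr_nat.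
Qed.

Lemma perron_eigenvalueE : perron_eigenvalue R M = mu.
Proof.
(* [eigenvalue] refers to left eigenvectors whereas v is a right one; the characteristic polynomial
   links them: if M - mu were invertible it could not kill v. *)
have muE : eigenvalue Mc muC.
  rewrite eigenvalue_root_char; apply: contraT => nroot.
  have : vC = 0.
    have /row_fullP [B HB] : row_full (Mc - muC%:M).
      rewrite row_full_unit unitmxE unitfE.
      have := nroot; rewrite /root /char_poly /char_poly_mx => h.
      apply: contra h => /eqP h; rewrite -horner_evalE -det_map_mx.
      have -> : map_mx (horner_eval muC) ('X%:M - map_mx polyC Mc) = - (Mc - muC%:M).
        by apply/matrixP => i j; rewrite !mxE /horner_eval !hornerE opprB hornerMn hornerX.
      by rewrite -scaleN1r detZ h mulr0.
    by rewrite -[vC]mul1mx -HB -mulmxA mulmxBl Mc_vC mul_scalar_mx subrr mulmx0.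
  move=> /matrixP /(_ 0 0); rewrite !mxE => -[h].
  by have := v_gt0 0; rewrite h ltxx.
apply/eqP; rewrite eq_le; apply/andP; split.
  apply: ge_sup; first by exists mu.
  move=> x [x0 /eigenvalue_le]; rewrite ger0_norm ?lecR//.
  by rewrite ?ler0c ltW.
apply: ub_le_sup; last by [].
exists mu => x [x0 /eigenvalue_le]; rewrite ger0_norm ?lecR//.
by rewrite ?ler0c ltW.
Qed.

Lemma eigenvalue_le_r (z : C) : eigenvalue Mc z -> z <> muC -> `|z| <= (r_mx R M)%:C%C.
Proof.
move=> ez zmu; have : complex.Re `|z| <= r_mx R M.
  apply: ub_le_sup; last by exists z => //; split => //; rewrite perron_eigenvalueE.
  exists mu => _ [y [ey _] <-]; have := eigenvalue_le ey.
  by rewrite lecE => /andP[].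
by rewrite normc_def lecR.
Qed.

(* By the Cayley-Hamilton theorem the factors of the characteristic polynomial
   other than X - mu send const_mx 1 to a generalized mu-eigenvector, hence to
   a multiple of v. *)
Lemma spectral_gap (lambda : R) : primitive_mx M -> r_mx R M < lambda -> 0 < lambda -> lambda <= mu ->
  exists (theta C0 rho : R), [/\ 0 < theta, 0 <= C0, 0 < rho, rho < lambda &
   forall m i, `|(Mr ^+ m *m (const_mx 1 - theta *: v)) i 0| <= C0 * rho ^+ m].
Proof.
move=> prim rl l0 lmu.
(* The gap between r(M) and [rho] absorbs the polynomial factors due to Jordan blocks. *)
pose r := Num.max 0 (r_mx R M); pose rho := (r + lambda) / 2.
have r0 : 0 <= r by rewrite le_max lexx.
have rlam : r < lambda by rewrite gt_max l0 rl.
have rrho : r < rho by rewrite /rho; lra.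
have rho0 : 0 < rho by apply: le_lt_trans rrho.
have rholam : rho < lambda by rewrite /rho; lra.
have [s hs] := closed_field_poly_normal (char_poly Mc).
have {}hs : char_poly Mc = \prod_(z <- s) ('X - z%:P).
  by rewrite [LHS]hs (monicP (char_poly_monic _)) scale1r.
pose q := \prod_(z <- [seq z <- s | z != muC]) ('X - z%:P).
have [a Ha] : exists a, char_poly Mc = ('X - muC%:P) ^+ a * q.
  exists (count (pred1 muC) s); rewrite hs /q.
  elim: (s) => [|z t IH] /=; first by rewrite !big_nil mulr1.
  rewrite big_cons IH; case: (altP (z =P muC)) => [->|zmu] /=.
    by rewrite add1n exprS mulrA.
  by rewrite add0n big_cons mulrCA.
pose one : 'cV[C]_n.+1 := const_mx 1.
have CH : horner_mx Mc ('X - muC%:P) ^+ a *m (horner_mx Mc q *m one) = 0.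
  rewrite mulmxA mulmxE -rmorphXn -rmorphM -Ha [X in X *m _](_ : _ = 0) ?mul0mx //; exact: Cayley_Hamilton.
rewrite rmorphB /= horner_mx_X horner_mx_C in CH.
have [th' hth'] := perron_kernel prim CH.
have qv : horner_mx Mc q *m vC = q.[muC] *: vC.
  rewrite /q; elim: [seq _ <- _ | _] => [|z t IH].
    by rewrite big_nil rmorph1 mul1mx hornerC scale1r.
  rewrite big_cons mulrC rmorphM /= -mulmxE -mulmxA rmorphB /= horner_mx_X horner_mx_C.
  rewrite mulmxBl Mc_vC mul_scalar_mx -scalerBl -scalemxAr IH scalerA hornerM mulrC.
  by rewrite hornerXsubC.
have q0 : q.[muC] != 0.
  rewrite /q; elim: (s) => [|z t IH] /=; first by rewrite big_nil hornerC oner_neq0.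
  case: (altP (z =P muC)) => // zmu.
  by rewrite big_cons hornerM mulf_neq0// hornerXsubC subr_eq0 eq_sym.
(* q(M) multiplies v by q(mu), which is nonzero, so this multiple of v cancels the image under q(M)
   of the constant vector 1. *)
pose th := th' / q.[muC].
have ann : horner_mx Mc q *m (one - th *: vC) = 0.
  by rewrite mulmxBr hth' -scalemxAr qv scalerA /th divfK// subrr.
have rC : 0 <= r%:C%C :> C by rewrite ler0c.
have rrhoC : r%:C%C < rho%:C%C :> C by rewrite ltcR.
case: (growth_annihilated rC rrhoC _ ann) => [z|C1 C10 HC1].
  rewrite mem_filter => /andP[zmu zs].
  apply: le_trans (eigenvalue_le_r _ _) _; last by rewrite lecR le_max lexx orbT.
    by rewrite eigenvalue_root_char hs root_prod_XsubC.
  exact/eqP.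
pose theta := complex.Re th.
have ReM m : map_mx (@complex.Re R) (Mc ^+ m *m (one - th *: vC)) =
   Mr ^+ m *m (const_mx 1 - theta *: v).
  elim: m => [|m IH].
    rewrite !expr0 !mul1mx; apply/matrixP => i j; rewrite !mxE /theta.
    by move: (th) => [x y] /=; rewrite mulr0 subr0.
  by rewrite !exprS -!mulmxE -!mulmxA complex_mx_Re IH.
have C1re : C1 = (complex.Re C1)%:C%C by move: C10; case: (C1) => x y; rewrite lecE /= => /andP[/eqP -> _].
have bound m i : `|(Mr ^+ m *m (const_mx 1 - theta *: v)) i 0| <= complex.Re C1 * rho ^+ m.
  rewrite -ReM mxE; have := HC1 m i; rewrite {1}C1re -(rmorphXn (real_complex R))
    -(rmorphM (real_complex R)) normc_def lecR.
  apply: le_trans; case: ((_ *m _) _ _) => x y /=.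
  rewrite -(sqrtr_sqr x) ler_sqrt; last by rewrite addr_ge0 ?sqr_ge0.
  by rewrite lerDl sqr_ge0.
exists theta, (complex.Re C1), rho; split => //; last by move: C10; rewrite lecE => /andP[].
(* If theta were at most 0, the vector 1 - theta v would dominate 1, hence c v with c the inverse of
   the sum of the entries of v; its images under M^m would then grow like mu^m, against a bound in
   rho^m with rho < mu. *)
rewrite ltNge; apply/negP => th0.
pose c := (\sum_i v i 0)^-1.
have sv0 : 0 < \sum_i v i 0.
  by rewrite (bigD1 ord0)//= ltr_wpDr ?sumr_ge0// => j _; exact: ltW.
have low m : (v 0 0 * c) * mu ^+ m <= complex.Re C1 * rho ^+ m.
  apply: le_trans (bound m 0); apply: le_trans (ler_norm _).
  have e1 : (Mr ^+ m *m (const_mx 1 - theta *: v)) 0 0 =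
    (Mr ^+ m *m (const_mx 1 : 'cV[R]_n.+1)) 0 0 - theta * mu ^+ m * v 0 0.
    rewrite mulmxBr -scalemxAr perron_pow scalerA [LHS]mxE; congr (_ + _).
    by rewrite !mxE.
  rewrite e1 (le_trans (y := (Mr ^+ m *m (const_mx 1 : 'cV[R]_n.+1)) 0 0))//; last first.
    rewrite lerDl oppr_ge0; apply: mulr_le0_ge0; last exact: ltW.
    by apply: mulr_le0_ge0 => //; apply: exprn_ge0; exact: ltW.
  have -> : v 0 0 * c * mu ^+ m = c * (Mr ^+ m *m v) 0 0 by rewrite perron_pow mxE; ring.
  rewrite !mxE mulr_sumr; apply: ler_sum => j _.
  rewrite real_mxX mulrCA ler_wpM2l ?[in X in 0 <= X]mxE ?ler0n// [const_mx 1 _ _]mxE.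
  rewrite /c mulrC ler_pdivrMr// mul1r (bigD1 j)//= lerDl sumr_ge0// => k _; exact: ltW.
have vc0 : 0 < v 0 0 * c by rewrite mulr_gt0// invr_gt0.
have x1 : `|rho / mu| < 1.
  rewrite gtr0_norm; last exact: divr_gt0.
  rewrite ltr_pdivrMr// mul1r.
  exact: lt_le_trans rholam lmu.
have cv : (complex.Re C1 * (rho / mu) ^+ m)%R @[m --> \oo] --> complex.Re C1 * 0.
  by apply: cvgMr; exact: cvg_expr.
rewrite mulr0 in cv.
have [N _ /(_ N (leqnn N)) /=] := cvgr_lt _ cv _ vc0.
rewrite expr_div_n mulrA ltr_pdivrMr ?exprn_gt0// ltNge; apply/negP/negPn.
exact: low.
Qed.
End Perron.

(** * Infinite matchings *)

Section Hall.
Local Open Scope nat_scope.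
Local Open Scope fset_scope.
Variables (V : choiceType) (Y : set V).
Implicit Types (A : V -> {fset V}) (I : {fset V}).

Definition nbhd A I : {fset V} := \bigcup_(y <- I) A y.

Definition hall A := forall I, {in I, forall y, Y y} -> #|` I| <= #|` nbhd A I|.

Definition update A y B : V -> {fset V} := fun z => if z == y then B else A z.

Lemma in_nbhd A I x : reflect (exists2 y, y \in I & x \in A y) (x \in nbhd A I).
Proof.
apply: (iffP (bigfcupP _ _ _ _)) => -[y]; first by rewrite andbT => yI xy; exists y.
by move=> yI xy; exists y => //; rewrite yI.
Qed.

(** A violating set must contain y, for otherwise its neighbourhood is unchanged; removing y from it
    turns the strict inequality into a weak one. *)
Lemma hall_violation A y B : hall A -> ~ hall (update A y B) ->
  exists I, [/\ {in I, forall z, Y z}, y \notin I & #|` nbhd A I `|` B| <= #|` I|].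
Proof.
move=> HA /existsNP [I /not_implyP [IY /negP]]; rewrite -ltnNge => lt.
have [yI|yI] := boolP (y \in I); last first.
  have : nbhd (update A y B) I = nbhd A I.
    apply/fsetP => x; apply/in_nbhd/in_nbhd => -[z zI]; rewrite /update.
      by case: eqP => [zy|_ ?]; [rewrite zy (negbTE yI) in zI | exists z].
    by exists z => //; case: eqP => // zy; rewrite zy (negbTE yI) in zI.
  by move=> E; rewrite E ltnNge HA in lt.
exists (I `\ y); split; first by move=> z /fsetD1P[_ /IY].
  by rewrite !inE eqxx.
rewrite (cardfsD1 y I) yI add1n ltnS in lt; apply: leq_trans lt.
apply: fsubset_leq_card; apply/fsubsetP => x; rewrite inE => /orP[/in_nbhd[z]|xB].
  rewrite !inE => /andP[zy zI] xz; apply/in_nbhd; exists z => //.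
  by rewrite /update (negbTE zy).
by apply/in_nbhd; exists y => //; rewrite /update eqxx.
Qed.

(* Rado: two violations, one for each deleted element, contradict the
   submodularity of the size of a neighbourhood. *)
Lemma hall_shrink A y a b : hall A -> Y y -> a \in A y -> b \in A y -> a != b ->
  hall (update A y (A y `\ a)) \/ hall (update A y (A y `\ b)).
Proof.
move=> HA Yy aA bA ab; apply: contrapT => /not_orP [].
move=> /(hall_violation HA) [I [IY yI cI]] /(hall_violation HA) [J [JY yJ cJ]].
set P := nbhd A I `|` _ in cI; set Q := nbhd A J `|` _ in cJ.
have h1 : #|` I `&` J| <= #|` P `&` Q|.
  apply: leq_trans (HA _ _) _; first by move=> z; rewrite inE => /andP[/IY].
  apply: fsubset_leq_card; apply/fsubsetP => x /in_nbhd[z].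
  rewrite inE => /andP[zI zJ] xz; rewrite !inE; apply/andP; split; apply/orP; left;
  by apply/in_nbhd; exists z.
have h2 : (#|` I `|` J|).+1 <= #|` P `|` Q|.
  have -> : (#|` I `|` J|).+1 = #|` y |` (I `|` J)|.
    by rewrite cardfsU1 !inE (negbTE yI) (negbTE yJ).
  apply: leq_trans (HA _ _) _.
    by move=> z; rewrite !inE => /orP[/eqP->|/orP[/IY|/JY]].
  apply: fsubset_leq_card; apply/fsubsetP => x /in_nbhd[z].
  rewrite !inE => /orP[/eqP->|/orP[zI|zJ]] xz.
  - rewrite xz !andbT; have [xa|_] := eqVneq x a; last by rewrite !orbT.
    by rewrite xa ab !orbT.
  - by rewrite (_ : x \in nbhd A I)//; apply/in_nbhd; exists z.
  - by rewrite (_ : x \in nbhd A J) ?orbT//; apply/in_nbhd; exists z.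
have := cardfsUI I J; have := cardfsUI P Q; lia.
Qed.

Lemma nbhd1 A y : nbhd A [fset y] = A y.
Proof.
apply/fsetP => x; apply/in_nbhd/idP => [[z]|xy]; first by rewrite inE => /eqP ->.
by exists y => //; rewrite inE.
Qed.

(** [hall_shrink] removes one candidate of y at a time; Hall's condition for y alone keeps the set
    nonempty. *)
Lemma hall_singleton A y : hall A -> Y y ->
  exists2 c, c \in A y & hall (update A y [fset c]).
Proof.
move=> + Yy; have [n le_n] := ubnP #|` A y|; elim: n A le_n => // n IH A le_n HA.
have : 0 < #|` A y|.
  rewrite -nbhd1; apply: leq_trans (HA [fset y] _); first by rewrite cardfs1.
  by move=> z; rewrite inE => /eqP ->.
rewrite cardfs_gt0 => /fset0Pn [a aA].
have [Aa|] := eqVneq (A y) [fset a].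
  exists a => //; rewrite (_ : update A y [fset a] = A)//.
  by apply/funext => z; rewrite /update; case: eqP => // ->.
move=> Ana.
have [b bA ab] : exists2 b, b \in A y & a != b.
  apply: contrapT => h; move/eqP: Ana; apply; apply/fsetP => x; rewrite inE.
  apply/idP/eqP => [xA|->//]; apply/eqP; apply: contrapT => /negP xa; apply: h.
  by exists x => //; rewrite eq_sym.
suff red c : c \in A y -> hall (update A y (A y `\ c)) ->
    exists2 c, c \in A y & hall (update A y [fset c]).
  by have [/(red a aA)|/(red b bA)] := hall_shrink HA Yy aA bA ab.
move=> cA Hc; have [] := IH _ _ Hc.
  by rewrite /update eqxx; move: le_n; rewrite (cardfsD1 c) cA add1n ltnS.
move=> z; rewrite {1}/update eqxx !inE => /andP[_ zA] Hz; exists z => //.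
rewrite (_ : update A y _ = update (update A y (A y `\ c)) y [fset z])//.
by apply/funext => t; rewrite /update; case: eqP.
Qed.

(** The hypothesis [hall A] stands inside the existential so that A' can be chosen as a total
    function of A and iterated. *)
Lemma hall_step A n (g : V -> nat) : {in Y &, injective g} -> exists A', hall A ->
  [/\ hall A', (forall y, {subset A' y <= A y}),
      (forall y, Y y -> g y = n -> exists c, A' y = [fset c]) &
      (forall y, Y y -> g y <> n -> A' y = A y)].
Proof.
move=> ginj.
have [HA|] := pselect (hall A); last by exists A.
have [[y [Yy gy]]|no] := pselect (exists y, Y y /\ g y = n); last first.
  exists A => _; split => //; first by move=> y x.
  by move=> y Yy gy; exfalso; apply: no; exists y.
have [c cA Hc] := hall_singleton HA Yy.
exists (update A y [fset c]) => _; split => //.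
- by move=> z x; rewrite /update; case: eqP => // ->; rewrite inE => /eqP ->.
- move=> z Yz gz; exists c; have -> : z = y by apply: ginj; rewrite ?in_setE ?gz.
  by rewrite /update eqxx.
- by move=> z Yz gz; rewrite /update; case: eqP => // zy; rewrite zy in gz.
Qed.

(** The elements of Y are settled in the order of their codes; once a candidate set has become a
    singleton it is never changed again. *)
Lemma hall_injection A : countable Y -> hall A ->
  exists f : V -> V, (forall y, Y y -> f y \in A y) /\ {in Y &, injective f}.
Proof.
move=> /countable_injP[g ginj] HA.
have [step stepP] : {step : nat -> (V -> {fset V}) -> (V -> {fset V}) &
   forall n A, hall A ->
  [/\ hall (step n A), (forall y, {subset step n A y <= A y}),
      (forall y, Y y -> g y = n -> exists c, step n A y = [fset c]) &
      (forall y, Y y -> g y <> n -> step n A y = A y)]}.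
  pose st n B := projT1 (cid (hall_step B n ginj)).
  by exists st => n B; exact: projT2 (cid (hall_step B n ginj)).
pose F n := iteri n step A.
have HF n : hall (F n) by elim: n => [//|n IH]; case: (stepP n _ IH).
have subF n y : {subset F n y <= A y}.
  elim: n => [//|n IH] x /=; case: (stepP n _ (HF n)) => _ h _ _ /h; exact: IH.
have single y : Y y -> exists c, F (g y).+1 y = [fset c].
  by move=> Yy; case: (stepP (g y) _ (HF (g y))) => _ _ h _; apply: h.
have stable y n : Y y -> g y < n -> F n y = F (g y).+1 y.
  move=> Yy; elim: n => // n IH; rewrite ltnS leq_eqVlt => /orP[/eqP <-//|gn].
  case: (stepP n _ (HF n)) => _ _ _ h; rewrite -IH//=; apply: h => //.
  by move=> E; rewrite E ltnn in gn.
pose f y := if pselect (exists c, F (g y).+1 y = [fset c]) is left h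
            then projT1 (cid h) else y.
have fE y : Y y -> F (g y).+1 y = [fset f y].
  move=> /single h; rewrite /f; case: pselect => // h'; exact: (projT2 (cid h')).
exists f; split => [y Yy|y z].
  by apply: (subF (g y).+1); rewrite fE// inE.
rewrite !in_setE => Yy Yz fyz; apply/eqP/negPn/negP => yz.
(* At stage N the candidate sets of y and z are the singletons of f y and f z; if these agreed,
   Hall's condition would fail for the pair {y, z}. *)
pose N := (maxn (g y) (g z)).+1.
have : #|` [fset y; z]| <= #|` nbhd (F N) [fset y; z]|.
  by apply: HF => t; rewrite !inE => /orP[] /eqP ->.
rewrite cardfs2 yz; apply/negP; rewrite -ltnNge ltnS.
  rewrite -[X in _ <= X](cardfs1 (f y)); apply: fsubset_leq_card.
  apply/fsubsetP => x /in_nbhd[t]; rewrite !inE => /orP[] /eqP ->.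
    by rewrite stable// ?ltnS ?leq_maxl// fE// inE.
  by rewrite stable// ?ltnS ?leq_maxr// fE// inE fyz.
Qed.

End Hall.

Section Bernstein.
Local Open Scope nat_scope.
Local Open Scope fset_scope.
Variables (V : choiceType) (Y X : set V) (f g : V -> V).
Hypotheses (fX : forall y, Y y -> X (f y)) (gY : forall x, X x -> Y (g x)).
Hypotheses (finj : {in Y &, injective f}) (ginj : {in X &, injective g}).

(* The last clause keeps track of displacements, which the Cantor-Bernstein
   theorem alone would lose. *)
Lemma bernstein : exists phi psi : V -> V,
  [/\ (forall y, Y y -> X (phi y)), (forall x, X x -> Y (psi x)),
      (forall y, Y y -> psi (phi y) = y), (forall x, X x -> phi (psi x) = x) &
      (forall y, Y y -> phi y = f y \/ g (phi y) = y)].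
Proof.
(* D collects the points whose backward chain under f and g starts in Y outside the range of g; phi
   is f on D and the inverse of g elsewhere. *)
pose D y := exists n z, [/\ Y z, ~ (exists2 x, X x & g x = z) & y = iter n (g \o f) z].
have gD y : Y y -> ~ D y -> exists x, X x /\ g x = y.
  move=> Yy nD; apply: contrapT => h; apply: nD; exists 0, y; split => // -[x Xx gx].
  by apply: h; exists x.
pose ginv y := if pselect (exists x, X x /\ g x = y) is left h then projT1 (cid h) else y.
have ginvP y : Y y -> ~ D y -> X (ginv y) /\ g (ginv y) = y.
  move=> Yy nD; rewrite /ginv; case: pselect => [h|/(_ (gD _ Yy nD))//].
  exact: projT2 (cid h).
pose phi y := if pselect (D y) then f y else ginv y.
have phiX y : Y y -> X (phi y).
  by move=> Yy; rewrite /phi; case: pselect => [?|nD]; [exact: fX | case: (ginvP y Yy nD)].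
have phi_inj y z : Y y -> Y z -> phi y = phi z -> y = z.
  have mixed u w : Y u -> Y w -> D u -> ~ D w -> f u = ginv w -> False.
    move=> Yu Yw [n [t [Yt nt ut]]] nDw fu; apply: (nDw); exists n.+1, t; split => //=.
    by rewrite -ut /= fu; case: (ginvP w Yw nDw).
  move=> Yy Yz; rewrite /phi; case: (pselect (D y)) => Dy; case: (pselect (D z)) => Dz.
  - by move=> h; apply: finj => //; exact: mem_set.
  - by move=> /(mixed _ _ Yy Yz Dy Dz).
  - by move=> /esym /(mixed _ _ Yz Yy Dz Dy).
  - by move=> /= h; rewrite -(ginvP y Yy Dy).2 -(ginvP z Yz Dz).2 h.
have phi_surj x : X x -> exists y, Y y /\ phi y = x.
  move=> Xx; have [Dg|nD] := pselect (D (g x)); last first.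
    exists (g x); split; first exact: gY.
    rewrite /phi; case: pselect => // ?; have [h1 h2] := ginvP _ (gY Xx) nD.
    by apply: ginj; rewrite ?in_setE.
  case: Dg => -[|n] [t [Yt nt /= gx]]; first by exfalso; apply: nt; exists x.
  have Yi m : Y (iter m (g \o f) t) by elim: m => //= m IH; apply/gY/fX.
  exists (iter n (g \o f) t); split; first exact: Yi.
  rewrite /phi; case: pselect => [?|[]]; last by exists n, t.
  by apply: ginj; rewrite ?in_setE//; apply: fX.
pose psi x := if pselect (exists y, Y y /\ phi y = x) is left h then projT1 (cid h) else x.
have psiP x : X x -> Y (psi x) /\ phi (psi x) = x.
  move=> Xx; rewrite /psi; case: pselect => [h|/(_ (phi_surj x Xx))//].
  exact: projT2 (cid h).
exists phi, psi; split => //.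
- by move=> x /psiP[].
- move=> y Yy; have [h1 h2] := psiP _ (phiX y Yy); exact: phi_inj.
- by move=> x /psiP[].
- move=> y Yy; rewrite /phi; case: pselect => [?|nD]; first by left.
  by right; case: (ginvP y Yy nD).
Qed.

End Bernstein.

(** * Euclidean geometry *)

Section EuclideanNorm.
Variables (R : realType) (d : nat).
Local Notation V := 'rV[R]_d.
Implicit Types (x y z : V) (A B : set V) (a c r : R).

Definition dot x y : R := \sum_i x 0 i * y 0 i.

Lemma dotC x y : dot x y = dot y x.
Proof. by apply: eq_bigr => i _; rewrite mulrC. Qed.

Lemma dotDl x y z : dot (x + y) z = dot x z + dot y z.
Proof. by rewrite -big_split; apply: eq_bigr => i _; rewrite mxE mulrDl. Qed.

Lemma dotZl a x y : dot (a *: x) y = a * dot x y.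
Proof. by rewrite mulr_sumr; apply: eq_bigr => i _; rewrite mxE mulrA. Qed.

Lemma dotNl x y : dot (- x) y = - dot x y.
Proof. by rewrite -scaleN1r dotZl mulN1r. Qed.

Lemma dotxx_ge0 x : 0 <= dot x x.
Proof. by apply: sumr_ge0 => i _; rewrite -expr2 sqr_ge0. Qed.

Lemma enormE x : enorm x = Num.sqrt (dot x x).
Proof. by rewrite /enorm; congr Num.sqrt; apply: eq_bigr => i _; rewrite expr2. Qed.

Lemma enorm_ge0 x : 0 <= enorm x. Proof. exact: sqrtr_ge0. Qed.

Lemma enorm_sqr x : enorm x ^+ 2 = dot x x.
Proof. by rewrite enormE sqr_sqrtr// dotxx_ge0. Qed.

Lemma enorm0 : enorm (0 : V) = 0.
Proof.
rewrite enormE (_ : dot 0 0 = 0) ?sqrtr0//.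
by rewrite /dot big1// => i _; rewrite mxE mul0r.
Qed.

Lemma enormZ a x : enorm (a *: x) = `|a| * enorm x.
Proof.
by rewrite !enormE dotZl dotC dotZl mulrA -expr2 sqrtrM ?sqr_ge0// sqrtr_sqr.
Qed.

Lemma enormN x : enorm (- x) = enorm x.
Proof. by rewrite -scaleN1r enormZ normrN1 mul1r. Qed.

Lemma enorm_distC x y : enorm (x - y) = enorm (y - x).
Proof. by rewrite -enormN opprB. Qed.

Lemma coord_le_enorm x i : `|x 0 i| <= enorm x.
Proof.
rewrite -(sqrtr_sqr (x 0 i)) /enorm ler_sqrt; last by apply: sumr_ge0 => j _; exact: sqr_ge0.
by rewrite (bigD1 i)//= lerDl sumr_ge0// => j _; exact: sqr_ge0.
Qed.

Lemma enorm_le_sup x c : 0 <= c -> (forall i, `|x 0 i| <= c) -> enorm x <= d%:R * c.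
Proof.
move=> c0 xc; have dc0 : 0 <= d%:R * c by rewrite mulr_ge0.
rewrite -(ger0_norm dc0) -sqrtr_sqr /enorm ler_sqrt ?sqr_ge0//.
apply: le_trans (_ : \sum_(i < d) c ^+ 2 <= _).
  by apply: ler_sum => i _; rewrite -real_normK ?num_real// lerXn2r ?nnegrE.
rewrite sumr_const card_ord -[X in X <= _]mulr_natl exprMn ler_wpM2r ?sqr_ge0//.
by rewrite -natrX ler_nat; case: (d) => // m; rewrite expnS leq_pmulr// expn1.
Qed.

Lemma enorm_eq0 x : enorm x = 0 -> x = 0.
Proof.
move=> x0; apply/matrixP => i j; rewrite ord1 mxE; apply/eqP; rewrite -normr_le0.
by rewrite -x0 coord_le_enorm.
Qed.

Lemma dot_le x y : dot x y <= enorm x * enorm y.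
Proof.
have [y0|y0] := eqVneq (enorm y) 0.
  by rewrite (enorm_eq0 y0) dotC -(scale0r 0) dotZl enormZ normr0 !mul0r mulr0.
have key : (dot x y) ^+ 2 <= (enorm x * enorm y) ^+ 2.
  have := dotxx_ge0 (dot y y *: x + (- dot x y) *: y).
  rewrite dotDl !dotZl ![dot _ (_ + _)]dotC !dotDl !dotZl (dotC y x) exprMn !enorm_sqr.
  have yy : 0 < dot y y by rewrite -enorm_sqr exprn_gt0// lt_def y0 enorm_ge0.
  have -> : dot y y * (dot y y * dot x x + - dot x y * dot x y) +
     - dot x y * (dot y y * dot x y + - dot x y * dot y y) =
     dot y y * (dot x x * dot y y - dot x y ^+ 2) by ring.
  by rewrite pmulr_rge0// subr_ge0.
rewrite (le_trans (ler_norm _))// -(ler_pXn2r (n := 2))// ?nnegrE ?mulr_ge0 ?enorm_ge0//.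
by rewrite real_normK ?num_real.
Qed.

Lemma enormD x y : enorm (x + y) <= enorm x + enorm y.
Proof.
rewrite -(ler_pXn2r (n := 2))// ?nnegrE ?addr_ge0 ?enorm_ge0//.
rewrite enorm_sqr dotDl ![dot _ (_ + _)]dotC !dotDl sqrrD !enorm_sqr (dotC y x).
have := dot_le x y; lra.
Qed.

Lemma enorm_triangle z x y : enorm (x - y) <= enorm (x - z) + enorm (z - y).
Proof. by rewrite (le_trans _ (enormD _ _))// addrA subrK. Qed.

(** The topology is that of the sup norm; this equivalence lets all arguments about interiors use
    Euclidean balls. *)
Lemma interior_cballP A x : A^° x <-> exists2 e : R, 0 < e & cball x e `<=` A.
Proof.
split=> [/nbhs_ballP[e /= e0 eA]|[e e0 eA]].
  exists (e / 2); rewrite ?divr_gt0// => y xy; apply: eA; split => // i j /=.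
  rewrite ord1 -ball_normE /ball_ /= distrC.
  have := coord_le_enorm (y - x) j; rewrite !mxE => h.
  rewrite (le_lt_trans h)// (le_lt_trans xy)//; lra.
apply/nbhs_ballP; exists (e / (d%:R + 1)) => /=; first by rewrite divr_gt0// ltr_wpDl.
move=> y xy; apply: eA; rewrite /cball /=.
have d0 : 0 < d%:R + 1 :> R by rewrite ltr_wpDl.
apply: (le_trans (enorm_le_sup (c := e / (d%:R + 1)) _ _)).
- by rewrite divr_ge0// ltW.
- move=> i; rewrite !mxE distrC ltW//; have [_ /(_ 0 i)] := xy.
  by rewrite -ball_normE.
- rewrite mulrA ler_pdivrMr// mulrC ler_wpM2l ?(ltW e0)//; lra.
Qed.

Lemma cball_compact (x : V) r : compact (cball x r).
Proof.
apply: bounded_closed_compact.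
  exists (enorm x + `|r|); split; first exact: num_real.
  move=> M hM y xy; rewrite /= [leLHS]/Num.Def.normr/= mx_normrE; apply/bigmax_leP; split => [|[i j] _] /=.
    by rewrite (le_trans _ (ltW hM))// addr_ge0// enorm_ge0.
  rewrite ord1 (le_trans (coord_le_enorm y j))// (le_trans _ (ltW hM))//.
  have := enormD (y - x) x; rewrite subrK => h; rewrite (le_trans h)// addrC lerD2l.
  by rewrite (le_trans xy)// ler_norm.
rewrite -(setCK (cball x r)); apply: open_closedC; rewrite openE => y /negP.
rewrite -ltNge => ry; apply/interior_cballP; exists ((enorm (y - x) - r) / 2).
  by rewrite divr_gt0// subr_gt0.
move=> z yz; apply/negP; rewrite -ltNge; have := enorm_triangle z y x.
move: yz; rewrite /cball/= (enorm_distC z y); lra.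
Qed.

(** A tile is the image of the compact unit ball under the continuous inverse of its
    homeomorphism. *)
Lemma tile_bounded (C : Type) (t : ctile R d C) : is_tile t ->
  exists H, forall x, t.1 x -> enorm x <= H.
Proof.
move=> [_ [f [g [fB gA fg gf [_ cg]]]]].
have tE : t.1 = g @` cball 0 1.
  apply/seteqP; split => [x tx|_ [y cy <-]]; last by apply: gA; exists y.
  by exists (f x); [apply: fB; exists x | rewrite fg].
have ct : compact t.1 by rewrite tE; apply: continuous_compact => //; exact: cball_compact.
have [M [_ HM]] := compact_bounded ct.
exists (d%:R * (`|M| + 1)) => x tx; apply: enorm_le_sup => [|i]; first by rewrite addr_ge0.
have := HM (`|M| + 1) _ x tx; rewrite ltr_pwDr ?ler_norm// => /(_ isT).
by apply: le_trans; rewrite [leRHS]/Num.Def.normr/= mx_normrE; apply: (le_bigmax _ (fun p => `|x p.1 p.2|) (0, i)).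
Qed.

End EuclideanNorm.

Section Isometries.
Variables (R : realType) (d : nat).
Local Notation V := 'rV[R]_d.

(** By polarization, x |-> O x - O 0 preserves the scalar product; the images of the basis vectors
    are the rows of an orthogonal matrix L, and scalar products with these rows recover the
    coordinates. *)
Lemma isometry_affine (O : V -> V) : isometry O ->
  exists L : 'M[R]_d, [/\ (forall x, O x = O 0 + x *m L), L *m L^T = 1%:M & L^T *m L = 1%:M].
Proof.
move=> isoO; have [f fE] : exists f : V -> V, forall x, f x = O x - O 0 by eexists.
have fB x y : enorm (f x - f y) = enorm (x - y).
  by rewrite !fE opprB addrA subrK isoO.
have fn x : enorm (f x) = enorm x.
  by have := fB x 0; rewrite (fE 0) subrr !subr0.
have fdot x y : dot (f x) (f y) = dot x y.
  have e u v : dot (u - v) (u - v) = dot u u + dot v v - 2 * dot u v :> R.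
    rewrite dotDl ![dot _ (_ - _)]dotC !dotDl !dotNl ![dot _ (- _)]dotC !dotNl (dotC v u); ring.
  have := fB x y; move=> /(congr1 (fun a => a ^+ 2)) /=; rewrite !enorm_sqr !e.
  rewrite -!enorm_sqr !fn; lra.
pose L : 'M[R]_d := \matrix_(i, j) f (delta_mx 0 i) 0 j.
have dotL x i : (f x *m L^T) 0 i = x 0 i.
  rewrite mxE (_ : \sum_j _ = dot (f x) (f (delta_mx 0 i))); last first.
    by apply: eq_bigr => j _; rewrite !mxE.
  rewrite fdot /dot (bigD1 i)//= big1 ?addr0 => [|j ji]; rewrite mxE ?eqxx ?mulr1//=.
  by rewrite (negbTE ji) mulr0.
have LLT : L *m L^T = 1%:M.
  apply/row_matrixP => i; rewrite row_mul; apply/matrixP => k j; rewrite ord1.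
  have -> : row i L = f (delta_mx 0 i) by apply/matrixP => a b; rewrite ord1 !mxE.
  by rewrite dotL !mxE eqxx eq_sym.
exists L; split => //; last exact: mulmx1C.
move=> x; rewrite -[LHS](subrK (O 0)) addrC; congr (_ + _); rewrite -fE.
have -> : x = f x *m L^T by apply/matrixP => i j; rewrite ord1 dotL.
by rewrite -mulmxA (mulmx1C LLT) mulmx1 (_ : f _ *m _ = x)//; apply/matrixP => i j; rewrite ord1 dotL.
Qed.

Lemma isometry_inverse (O : V -> V) : isometry O ->
  exists O', [/\ isometry O', cancel O O' & cancel O' O].
Proof.
move=> isoO; have [L [OE LLT LTL]] := isometry_affine isoO.
have c2 : cancel (fun y => (y - O 0) *m L^T) O.
  by move=> y; rewrite OE -mulmxA LTL mulmx1 addrC subrK.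
exists (fun y => (y - O 0) *m L^T); split => //.
  by move=> x y; rewrite -isoO !c2.
by move=> x; rewrite OE addrC addKr -mulmxA LLT mulmx1.
Qed.

(** The rescaling of O is O followed by a translation; this is why it stays in the group E. *)
Lemma rescaleE (O : V -> V) (lambda : R) : isometry O -> lambda != 0 ->
  forall x, rescale lambda O x = O x + (lambda - 1) *: O 0.
Proof.
move=> /isometry_affine[L [OE _ _]] l0 x.
rewrite /rescale OE (OE x) scalerDr -scalemxAl scalerA divff// scale1r.
by rewrite addrAC; congr (_ + _); rewrite scalerBl scale1r addrC subrK.
Qed.

Lemma rescale_isometry (O : V -> V) (lambda : R) : isometry O -> lambda != 0 ->
  isometry (rescale lambda O).
Proof.
move=> isoO l0 x y; rewrite !rescaleE// opprD addrACA subrr addr0; exact: isoO.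
Qed.

End Isometries.

(** * Packings, Banach limits and extents *)

Lemma pairwise_sym_in (T : eqType) (r : rel T) (l : seq T) x y :
  symmetric r -> pairwise r l -> x \in l -> y \in l -> x != y -> r x y.
Proof.
move=> rs; elim: l => //= z l IH /andP[/allP zl /IH{}IH].
rewrite !inE => /orP[/eqP->|xl] /orP[/eqP->|yl]; rewrite ?eqxx//.
- by move=> _; exact: zl.
- by move=> _; rewrite rs; exact: zl.
- exact: IH.
Qed.

Section Packing.
Variables (R : realType) (d : nat).
Local Notation V := 'rV[R]_d.
Implicit Types (A B : set V) (x y : V) (l : seq V).

Definition apart (delta : R) : rel V := fun x y => delta <= enorm (x - y).

Lemma apart_sym delta : symmetric (apart delta).
Proof. by move=> x y; rewrite /apart enorm_distC. Qed.

Lemma apart_uniq delta l : 0 < delta -> pairwise (apart delta) l -> uniq l.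
Proof.
move=> d0 h; rewrite uniq_pairwise; apply: sub_pairwise h => x y /= h.
by apply: contraTneq h => ->; rewrite /apart subrr enorm0 -ltNge.
Qed.

(** Two points in the same grid cell of side eta are at distance at most d eta < delta, so each cell
    contains at most one point of the list. *)
Lemma grid_count l (a : V) (eta delta : R) (n : 'I_d -> nat) :
  0 < eta -> d%:R * eta < delta -> pairwise (apart delta) l ->
  (forall x, x \in l -> forall i, 0 <= x 0 i - a 0 i < (n i)%:R * eta) ->
  (size l <= \prod_i n i)%N.
Proof.
move=> eta0 deta lsep lbox.
have delta0 : 0 < delta by rewrite (le_lt_trans _ deta)// mulr_ge0// ltW.
pose m := \max_i n i.
pose t x i := Num.truncn ((x 0 i - a 0 i) / eta).
pose c x : {ffun 'I_d -> 'I_m.+1} := [ffun i => inord (t x i)].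
have tP x i : x \in l -> (t x i)%:R * eta <= x 0 i - a 0 i < (t x i).+1%:R * eta.
  move=> xl; have /andP[x0 xn] := lbox x xl i.
  have /truncn_itv/andP[] : 0 <= (x 0 i - a 0 i) / eta by rewrite divr_ge0// ltW.
  by rewrite ler_pdivlMr// ltr_pdivrMr// => -> ->.
have tn x i : x \in l -> (t x i < n i)%N.
  move=> xl; have /andP[x0 xn] := lbox x xl i; have /andP[h _] := tP x i xl.
  by rewrite -(ltr_nat R) -(ltr_pM2r eta0) (le_lt_trans h).
have nm i : (n i <= m)%N by exact: leq_bigmax.
have cE x i : x \in l -> val (c x i) = t x i.
  by move=> xl; rewrite ffunE /= inordK// ltnS (leq_trans (ltnW (tn x i xl))).
have cinj : {in l &, injective c}.
  move=> x y xl yl cxy; apply/eqP/negPn/negP => xy.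
  have := pairwise_sym_in (@apart_sym _) lsep xl yl xy.
  rewrite /apart leNgt => /negP; apply; apply: le_lt_trans deta.
  apply: enorm_le_sup => [|i]; first exact: ltW.
  rewrite !mxE; have txy : t x i = t y i by rewrite -cE// -(cE y)// cxy.
  have /andP[] := tP x i xl; have /andP[] := tP y i yl.
  rewrite -txy -natr1 ler_norml; lra.
pose F (i : 'I_d) := [pred k : 'I_m.+1 | (k < n i)%N].
have cF : {subset map c l <= family F}.
  by move=> f /mapP[x xl ->]; apply/familyP => i; rewrite inE cE// tn.
rewrite -(size_map c) (leq_trans (uniq_leq_size (s2 := enum (family F)) _ _))//.
- by rewrite map_inj_in_uniq// (apart_uniq delta0).
- by move=> f /cF; rewrite mem_enum.
rewrite -cardE card_family foldrE big_map big_enum /=; apply: leq_prod => i _.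
have nmS : (n i <= m.+1)%N by rewrite leqW.
have winj : injective (widen_ord nmS) by move=> u w /(congr1 val) /= /val_inj.
rewrite -[leqRHS]card_ord -(fintype.card_image winj).
apply/subset_leq_card/fintype.subsetP => k kn.
have -> : k = widen_ord nmS (Ordinal (kn : (k < n i)%N)) by apply: val_inj.
exact: fintype.image_f.
Qed.

Definition packings A : set R :=
  [set (size l)%:R | l in [set l | pairwise (apart 1) l /\ forall x, x \in l -> A x]].

(** [sup] takes the value 0 on unbounded sets, so this number is meaningful for bounded A; hence the
    recurring hypothesis [ebounded]. *)
Definition packing_number A : R := sup (packings A).

Definition ebounded A := exists H, forall x, A x -> enorm x <= H.

Local Notation N := packing_number.

Lemma packings0 A : packings A 0. Proof. by exists [::]. Qed.

Lemma packing_number_le A (c : R) :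
  (forall l, pairwise (apart 1) l -> (forall x, x \in l -> A x) -> (size l)%:R <= c) -> N A <= c.
Proof.
move=> h; apply: ge_sup; first by exists 0; exact: packings0.
by move=> _ [l [lsep lA] <-]; exact: h.
Qed.

Lemma packing_box l (a : V) (h : 'I_d -> R) : pairwise (apart 1) l ->
  (forall i, 0 <= h i) -> (forall x, x \in l -> forall i, `|x 0 i - a 0 i| <= h i) ->
  (size l)%:R <= \prod_i (2 * (d%:R + 1) * h i + 1).
Proof.
move=> lsep h0 lh; have d0 : 0 < d%:R + 1 :> R by rewrite ltr_wpDl.
pose n i := (Num.truncn (2 * (d%:R + 1) * h i)).+1.
have e0 i : 0 <= 2 * (d%:R + 1) * h i by rewrite !mulr_ge0// ltW.
apply: (@le_trans _ _ (\prod_i (n i)%:R)).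
  rewrite -natr_prod ler_nat.
  apply: (@grid_count l (a - \row_i h i) (d%:R + 1)^-1 1) => //.
    by rewrite ltr_pdivrMr// mul1r ltrDl.
  move=> x xl i; have := lh x xl i; rewrite ler_norml => /andP[h1 h2].
  rewrite !mxE ltr_pdivlMr//; apply/andP; split; first lra.
  rewrite (le_lt_trans _ (truncnS_gt _))// [_ * h i]mulrC mulrCA [X in _ <= X]mulrA.
  rewrite ler_pM2r//; lra.
apply: ler_prod => i _; rewrite ler0n /n -natr1 lerD2r.
by have /andP[] := truncn_itv (e0 i).
Qed.

Lemma ebounded_sub A B : A `<=` B -> ebounded B -> ebounded A.
Proof. by move=> AB [H BH]; exists H => x /AB/BH. Qed.

Lemma packing_number_ge A l : ebounded A -> pairwise (apart 1) l ->
  (forall x, x \in l -> A x) -> (size l)%:R <= N A.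
Proof.
move=> [H AH] lsep lA; apply: ub_le_sup; last by exists l.
exists (\prod_(i < d) (2 * (d%:R + 1) * `|H| + 1)) => _ [m [msep mA] <-].
apply: (@packing_box m 0 (fun _ => `|H|)) => // x /mA/AH xH i.
by rewrite mxE subr0 (le_trans (coord_le_enorm x i))// (le_trans xH)// ler_norm.
Qed.

Lemma packing_number_ge0 A : ebounded A -> 0 <= N A.
Proof. by move=> bA; apply: (packing_number_ge (l := [::])). Qed.

Lemma packing_number_mono A B : ebounded B -> A `<=` B -> N A <= N B.
Proof.
move=> bB AB; apply: packing_number_le => l lsep lA.
by apply: packing_number_ge => // x /lA/AB.
Qed.

Lemma packing_numberU A B : ebounded A -> ebounded B -> N (A `|` B) <= N A + N B.
Proof.
move=> bA bB; apply: packing_number_le => l lsep lAB.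
rewrite -(count_predC (fun x => `[< A x >]) l) natrD -!size_filter lerD//.
  apply: packing_number_ge => //; first exact: pairwise_filter.
  by move=> x; rewrite mem_filter => /andP[/asboolP].
apply: packing_number_ge => //; first exact: pairwise_filter.
by move=> x; rewrite mem_filter => /andP[/= /asboolP nA /lAB[]].
Qed.

Lemma packing_number_isometry (f : V -> V) A : isometry f -> ebounded A ->
  N (f @` A) = N A.
Proof.
have le g B : isometry g -> ebounded (g @` B) -> N B <= N (g @` B).
  move=> gi bgB; apply: packing_number_le => l lsep lB.
  rewrite -(size_map g); apply: packing_number_ge => //.
    by rewrite pairwise_map; apply: sub_pairwise lsep => x y; rewrite /apart /= gi.
  by move=> _ /mapP[x /lB xB ->]; exists x.
have bd g B : isometry g -> ebounded B -> ebounded (g @` B).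
  move=> gi [H BH]; exists (H + enorm (g 0)) => _ [x /BH xH <-].
  rewrite -(subrK (g 0) (g x)) (le_trans (enormD _ _))// lerD2r gi subr0//.
move=> fi bA; have [g [gi fg gf]] := isometry_inverse fi.
apply/eqP; rewrite eq_le le ?andbT//; last exact: bd.
have E : g @` (f @` A) = A.
  apply/seteqP; split => [_ [_ [x xA <-] <-]|x xA]; first by rewrite fg.
  by exists (f x); [exists x | rewrite fg].
by rewrite (le_trans (le g _ gi _))// E.
Qed.

Definition far A B := forall x y, A x -> B y -> 1 <= enorm (x - y).

Lemma packing_number_far A B : ebounded A -> ebounded B -> far A B ->
  N A + N B <= N (A `|` B).
Proof.
move=> bA bB AB; have bAB : ebounded (A `|` B).
  move: bA bB => [H AH] [K BK]; exists (Num.max H K) => x [/AH|/BK] h.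
    by rewrite (le_trans h)// le_max lexx.
  by rewrite (le_trans h)// le_max lexx orbT.
rewrite -lerBrDr; apply: packing_number_le => l lsep lA; rewrite lerBrDr -lerBrDl.
apply: packing_number_le => m msep mB; rewrite lerBrDl -natrD -size_cat.
apply: packing_number_ge => //.
  rewrite pairwise_cat lsep msep !andbT; apply/allrelP => x y /lA xA /mB yB; exact: AB.
by move=> x; rewrite mem_cat => /orP[/lA|/mB]; [left|right].
Qed.

(** The points x + u, with u an integer vector with coordinates from 0 to n, are 1-separated and lie
    in the ball because |u| <= d n. *)
Lemma packing_number_ball A x (r : R) (n : nat) : ebounded A -> cball x r `<=` A ->
  d%:R * n%:R <= r -> n.+1%:R ^+ d <= N A.
Proof.
move=> bA xA nr.
pose p (f : {ffun 'I_d -> 'I_n.+1}) : V := x + \row_i (f i : nat)%:R.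
have : (size [seq p f | f <- enum {ffun 'I_d -> 'I_n.+1}])%:R <= N A.
  apply: packing_number_ge => //.
    rewrite pairwise_map; apply: sub_pairwise (_ : pairwise [rel f g | f != g] _) => [f g /=|]; last first.
      by rewrite -uniq_pairwise enum_uniq.
    apply: contraNT; rewrite /apart -ltNge => fg; apply/eqP/ffunP => i; apply/val_inj.
    have := le_lt_trans (coord_le_enorm _ i) fg.
    rewrite !mxE opprD addrACA subrr add0r; case: (ltngtP (f i) (g i)) => //= h.
      by rewrite distrC -natrB 1?ltnW// normr_nat ltrn1 ltnS leqn0 subn_eq0 leqNgt h.
    by rewrite -natrB 1?ltnW// normr_nat ltrn1 ltnS leqn0 subn_eq0 leqNgt h.
  move=> _ /mapP[f _ ->]; apply: xA; rewrite /cball/= /p addrAC subrr add0r.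
  apply: le_trans nr; apply: enorm_le_sup => // i.
  by rewrite mxE normr_nat ler_nat -ltnS.
by rewrite size_map -cardT card_ffun !card_ord natrX.
Qed.

End Packing.

Section BanachLimit.
Variable R : realType.
Implicit Types x y : nat -> R.

Definition bounded_seq x := exists B : R, forall n, `|x n| <= B.

(** The field [blimS] is the essential one: for densities indexed by powers of lambda, a dilation by
    lambda is a shift. *)
Record banach_limit (L : (nat -> R) -> R) : Prop := BanachLimit {
  blimD : forall x y, bounded_seq x -> bounded_seq y -> L (fun n => x n + y n) = L x + L y;
  blimZ : forall c x, bounded_seq x -> L (fun n => c * x n) = c * L x;
  blim_ge0 : forall x, bounded_seq x -> (forall n, 0 <= x n) -> 0 <= L x;
  blim1 : L (fun _ => 1) = 1;
  blimS : forall x, bounded_seq x -> L (fun n => x n.+1) = L x }.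

Definition cesaro x n := (n.+1%:R)^-1 * \sum_(i < n.+1) x i.

Lemma cesaro_bound x (B : R) n : (forall n, `|x n| <= B) -> `|cesaro x n| <= B.
Proof.
move=> xB; rewrite /cesaro normrM ger0_norm ?invr_ge0// mulrC ler_pdivrMr ?ltr0n//.
rewrite (le_trans (ler_norm_sum _ _ _))// mulr_natr.
by rewrite -[X in _ <= _ *+ X]card_ord -sumr_const ler_sum.
Qed.

(* Cesaro means along an ultrafilter. *)
Lemma banach_limit_exists : exists L, banach_limit L.
Proof.
have [U [UU ooU]] := ultraFilterLemma (F := \oo) _.
have UP : ProperFilter U by exact: ultra_proper.
pose L x := lim (cesaro x @ U).
have cv x : bounded_seq x -> cvg (cesaro x @ U).
  move=> [B xB].
  have [|p [_ cp]] := @segment_compact R (- B) B (cesaro x @ U) (fmap_proper_filter _ UP).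
    by apply: (@filterE _ U) => n; rewrite /= in_itv /= -ler_norml; exact: (cesaro_bound _ xB).
  apply/cvg_ex; exists p => A Ap.
  (* A cluster point of an ultrafilter is a limit: the complement of a neighbourhood cannot belong
     to the ultrafilter. *)
  have [//|nA] := in_ultra_setVsetC (cesaro x @^-1` A) UU.
  have [q [Aq nAq]] := cp _ _ (nA : (cesaro x @ U) (~` A)) Ap.
  by [].
have cl x l : cesaro x @ U --> l -> L x = l by move=> h; apply: cvg_lim.
exists L; split.
- move=> x y bx b_y; apply: cl.
  rewrite (_ : cesaro _ = cesaro x + cesaro y); first by apply: cvgD; exact: cv.
  by apply/funext => n; rewrite /cesaro big_split mulrDr.
- move=> c x bx; apply: cl.
  rewrite (_ : cesaro _ = fun n => c * cesaro x n); first by apply: cvgMr; exact: cv.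
  by apply/funext => n; rewrite /cesaro -mulr_sumr mulrCA.
- move=> x bx x0; apply: limr_ge; first exact: cv.
  by apply: filterE => n; rewrite /cesaro mulr_ge0 ?invr_ge0// sumr_ge0.
- apply: cl; rewrite (_ : cesaro _ = fun=> 1); first exact: cvg_cst.
  by apply/funext => n; rewrite /cesaro sumr_const card_ord mulVf// pnatr_eq0.
- move=> x bx; have [B xB] := bx.
  (* Shifting a bounded sequence changes its Cesaro means by (x (n+1) - x 0) / (n+1), which tends to
     0. *)
  apply: cl; rewrite (_ : cesaro _ = cesaro x + (fun n => n.+1%:R^-1 * (x n.+1 - x 0%N))).
    rewrite -[X in _ --> X]addr0; apply: cvgD; first exact: cv.
    apply: (@cvg_trans _ ((fun n => n.+1%:R^-1 * (x n.+1 - x 0%N)) @ \oo)).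
      by move=> A hA; exact: ooU.
    apply: (@squeeze_cvgr _ _ _ _ (fun n => - (harmonic n * (2 * B))) (fun n => harmonic n * (2 * B))).
    + near=> n; rewrite -ler_norml normrM ger0_norm ?invr_ge0// ler_wpM2l ?invr_ge0//.
      rewrite (le_trans (ler_normB _ _))//; have := xB n.+1; have := xB 0%N; lra.
    + rewrite -[X in _ --> X]oppr0; apply: cvgN; rewrite -[X in _ --> X](mul0r (2 * B)).
      by apply: cvgMl; exact: cvg_harmonic.
    + rewrite -[X in _ --> X](mul0r (2 * B)); apply: cvgMl; exact: cvg_harmonic.
  apply/funext => n; rewrite /cesaro /= -[RHS]/(_ + _) -mulrDr; congr (_ * _).
  rewrite [in RHS]big_ord_recl [in LHS]big_ord_recr /= /bump /=; ring.
Unshelve. all: by end_near.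
Qed.

Variable L : (nat -> R) -> R.
Hypothesis HL : banach_limit L.

Lemma blim_le x y : bounded_seq x -> bounded_seq y -> (forall n, x n <= y n) -> L x <= L y.
Proof.
move=> bx b_y xy; rewrite -subr_ge0.
have bN : bounded_seq (fun n => (-1) * x n).
  by have [B xB] := bx; exists B => n; rewrite mulN1r normrN.
have -> : L y - L x = L (fun n => y n + (-1) * x n).
  by rewrite (blimD HL)// (blimZ HL)// mulN1r.
apply: (blim_ge0 HL) => [|n]; last by rewrite mulN1r subr_ge0.
have [B xB] := bx; have [B' yB'] := b_y; exists (B' + B) => n.
by rewrite (le_trans (ler_normD _ _))// lerD// mulN1r normrN.
Qed.

Lemma blim_cst c : L (fun _ => c) = c.
Proof.
have -> : (fun _ : nat => c) = (fun n => c * (fun _ => 1) n) by apply/funext => n; rewrite mulr1.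
rewrite (blimZ HL) ?(blim1 HL) ?mulr1//.
by exists 1 => n; rewrite normr1.
Qed.

Lemma bounded_seqD x y : bounded_seq x -> bounded_seq y -> bounded_seq (fun n => x n + y n).
Proof.
move=> [B xB] [B' yB']; exists (B + B') => n.
by rewrite (le_trans (ler_normD _ _))// lerD.
Qed.

(* Shift invariance forces the limit of a geometric sequence to vanish. *)
Lemma blim_geometric (q c : R) : 0 <= q < 1 -> L (fun n => c * q ^+ n) = 0.
Proof.
move=> /andP[q0 q1].
have b : bounded_seq (fun n => q ^+ n).
  by exists 1 => n; rewrite ger0_norm ?exprn_ge0// exprn_ile1// ltW.
rewrite (blimZ HL)//; suff -> : L (fun n => q ^+ n) = 0 by rewrite mulr0.
have := blimS HL b.
have -> : (fun n => q ^+ n.+1) = (fun n => q * q ^+ n) by apply/funext => n; rewrite exprS.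
rewrite (blimZ HL)// => /eqP; rewrite -subr_eq0 -{2}[L _]mul1r -mulrBl mulf_eq0.
by rewrite subr_eq0 lt_eqF//= => /eqP.
Qed.

End BanachLimit.

Lemma bernoulli (R : realDomainType) (x : R) k : 0 <= x -> 1 + x * k%:R <= (1 + x) ^+ k.
Proof.
move=> x0; elim: k => [|k IH]; first by rewrite mulr0 addr0.
have h : (1 + x) * (1 + x * k%:R) <= (1 + x) ^+ k.+1 by rewrite exprS ler_wpM2l// addr_ge0.
apply: le_trans h; rewrite -natr1.
have : 0 <= x * (x * k%:R) by rewrite !mulr_ge0.
lra.
Qed.

Lemma pow_unbounded (R : realType) (c lambda : R) : 1 < lambda -> exists k, c <= lambda ^+ k.
Proof.
rewrite -subr_gt0 => l1; exists (Num.truncn (c / (lambda - 1))).+1.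
have := @bernoulli _ (lambda - 1) (Num.truncn (c / (lambda - 1))).+1 (ltW l1).
rewrite subrKC; apply: le_trans; apply: ler_wpDl => //.
by rewrite mulrC -ler_pdivrMr// ltW// truncnS_gt.
Qed.

(** * Outer, inner and boundary densities of dilated sets *)

Section Extent.
Variables (R : realType) (d : nat).
Local Notation V := 'rV[R]_d.
Implicit Types (A B : set V) (x y : V) (s r : R).

Definition scal s A : set V := [set s *: x | x in A].
(** Radius 1 matches the separation of packings: cores of sets with disjoint interiors are at
    distance at least 1, so packings of them can be concatenated. *)
Definition core s A : set V := [set x | cball x 1 `<=` scal s A].
Definition layer s A : set V := scal s A `\` core s A.

Local Notation N := (@packing_number R d).

Lemma cball_center x r : 0 <= r -> cball x r x.
Proof. by move=> r0; rewrite /cball/= subrr enorm0. Qed.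

Lemma core_sub s A : core s A `<=` scal s A.
Proof. by move=> x; apply; exact: cball_center. Qed.

Lemma scal_mono s A B : A `<=` B -> scal s A `<=` scal s B.
Proof. by move=> AB _ [x Ax <-]; exists x => //; exact: AB. Qed.

Lemma scal_scal s r A : scal s (scal r A) = scal (s * r) A.
Proof.
apply/seteqP; split => [_ [_ [x Ax <-] <-]|_ [x Ax <-]]; first by exists x; rewrite ?scalerA.
by exists (r *: x); [exists x | rewrite scalerA].
Qed.

Lemma core_mono s A B : A `<=` B -> core s A `<=` core s B.
Proof. by move=> AB x xA y /xA; exact: scal_mono. Qed.

Lemma core_scal s r A : core s (scal r A) = core (s * r) A.
Proof. by rewrite /core scal_scal. Qed.

Lemma layer_scal s r A : layer s (scal r A) = layer (s * r) A.
Proof. by rewrite /layer core_scal scal_scal. Qed.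

Lemma scal_bounded s A : ebounded A -> ebounded (scal s A).
Proof.
move=> [H AH]; exists (`|s| * `|H|) => _ [x /AH xH <-].
by rewrite enormZ ler_wpM2l// (le_trans xH)// ler_norm.
Qed.

Lemma image_bounded (f : V -> V) A : isometry f -> ebounded A -> ebounded (f @` A).
Proof.
move=> fi [H AH]; exists (H + enorm (f 0)) => _ [x /AH xH <-].
by rewrite -(subrK (f 0) (f x)) (le_trans (enormD _ _))// lerD2r fi subr0.
Qed.

Lemma scal_image s (f : V -> V) A : s != 0 ->
  scal s (f @` A) = rescale s f @` (scal s A).
Proof.
move=> s0; apply/seteqP; split => [_ [_ [x Ax <-] <-]|_ [_ [x Ax <-] <-]].
  by exists (s *: x); [exists x | rewrite /rescale scalerA mulVf ?scale1r ?ljn0//].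
by exists (f x); [exists x | rewrite /rescale scalerA mulVf ?scale1r ?ljn0//].
Qed.

Lemma core_image s (f : V -> V) A : s != 0 -> isometry f ->
  core s (f @` A) = rescale s f @` (core s A).
Proof.
move=> s0 fi; have gi := rescale_isometry fi s0.
have [h [hi gh hg]] := isometry_inverse gi.
rewrite /core scal_image//; apply/seteqP; split => [x xA|_ [x xA <-] y xy] /=.
  exists (h x) => // y yx; have [|z Az] := xA (rescale s f y).
    by rewrite /cball/= -(hg x) gi.
  by move=> /(can_inj gh) <-.
exists (h y) => //; apply: xA; rewrite /cball/= -gi hg; exact: xy.
Qed.

Lemma layer_image s (f : V -> V) A : s != 0 -> isometry f ->
  layer s (f @` A) = rescale s f @` (layer s A).
Proof.
move=> s0 fi; have gi := rescale_isometry fi s0.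
have [h [hi gh hg]] := isometry_inverse gi.
rewrite /layer core_image// scal_image//; apply/seteqP; split => [_ [[x Ax <-] nx]|_ [x [Ax nx] <-]].
  by exists x => //; split => // xc; apply: nx; exists x.
by split; [exists x | move=> [z zc /(can_inj gh) zx]; apply: nx; rewrite -zx].
Qed.

Definition seqU (T : eqType) (l : seq T) (f : T -> set V) : set V :=
  [set x | exists2 t, t \in l & f t x].

Lemma seqU_cons (T : eqType) t (l : seq T) (f : T -> set V) :
  seqU (t :: l) f = f t `|` seqU l f.
Proof.
apply/seteqP; split => x /=.
  by case=> u; rewrite inE => /orP[/eqP->|ul]; [left | right; exists u].
by case=> [fx|[u ul fx]]; [exists t; rewrite ?mem_head | exists u; rewrite ?inE ?ul ?orbT].
Qed.

Lemma seqU_bounded (T : eqType) (l : seq T) (f : T -> set V) :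
  (forall t, t \in l -> ebounded (f t)) -> ebounded (seqU l f).
Proof.
elim: l => [|t l IH] h; first by exists 0 => x [].
have [H1 h1] := h t (mem_head _ _).
have [|H2 h2] := IH; first by move=> u ul; apply: h; rewrite inE ul orbT.
rewrite seqU_cons; exists (Num.max H1 H2) => x [/h1|/h2] hx; rewrite (le_trans hx)// le_max lexx ?orbT//.
Qed.

Lemma packing_number0 : N set0 = 0.
Proof.
apply/eqP; rewrite eq_le packing_number_ge0 ?andbT; last by exists 0.
apply: packing_number_le => -[|x l] // _ /(_ x); rewrite mem_head => /(_ isT)//.
Qed.

Lemma packing_number_seqU (T : eqType) (l : seq T) (f : T -> set V) :
  (forall t, t \in l -> ebounded (f t)) -> N (seqU l f) <= \sum_(t <- l) N (f t).
Proof.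
elim: l => [|t l IH] h.
  rewrite big_nil (_ : seqU _ _ = set0) ?packing_number0//.
  by apply/seteqP; split => // x [].
have hl u : u \in l -> ebounded (f u) by move=> ul; apply: h; rewrite inE ul orbT.
rewrite seqU_cons big_cons (le_trans (packing_numberU _ _))//.
- by apply: h; rewrite mem_head.
- exact: seqU_bounded.
- by rewrite lerD2l IH.
Qed.

Lemma packing_number_seqU_far (T : eqType) (l : seq T) (f : T -> set V) : uniq l ->
  (forall t, t \in l -> ebounded (f t)) ->
  (forall t u, t \in l -> u \in l -> t != u -> far (f t) (f u)) ->
  \sum_(t <- l) N (f t) <= N (seqU l f).
Proof.
elim: l => [|t l IH] /=.
  by move=> _ _ _; rewrite big_nil packing_number_ge0//; exists 0 => x [].
move=> /andP[tl ul] h fr.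
have hl u : u \in l -> ebounded (f u) by move=> ul'; apply: h; rewrite inE ul' orbT.
rewrite big_cons seqU_cons.
rewrite (le_trans _ (packing_number_far _ _ _))//.
- rewrite lerD2l IH// => u w u_l wl; apply: fr; rewrite inE ?u_l ?wl orbT//.
- by apply: h; rewrite mem_head.
- exact: seqU_bounded.
- move=> x y fx [u u_l fy]; apply: (fr t u) => //; rewrite ?mem_head// ?inE ?u_l ?orbT//.
  by apply: contraNneq tl => ->.
Qed.

Definition int_disjoint A B := interior A `&` interior B = set0.

(** If x and y were closer than 1, the unit balls around both would contain a neighbourhood of y,
    and y / s would be interior to A and to B. *)
Lemma core_far s A B : 0 < s -> int_disjoint A B -> far (core s A) (core s B).
Proof.
move=> s0 AB x y xA yB; rewrite leNgt; apply/negP => xy.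
have E : forall C z, cball z 1 `<=` scal s C -> enorm (z - y) < 1 -> interior C (s^-1 *: y).
  move=> C z zC zy; apply/interior_cballP; exists ((1 - enorm (z - y)) / s).
    by rewrite divr_gt0// subr_gt0.
  move=> w wy; have [|c Cc sc] := zC (s *: w).
    rewrite /cball/= (le_trans (enorm_triangle y _ _))// (enorm_distC y z) -lerBrDr.
    have -> : s *: w - y = s *: (w - s^-1 *: y) by rewrite scalerBr scalerA divff ?gt_eqF// scale1r.
    by rewrite enormZ gtr0_norm// mulrC -ler_pdivlMr.
  by rewrite -[w]scale1r -(mulVf (lt0r_neq0 s0)) -scalerA -sc scalerA mulVf ?lt0r_neq0// scale1r.
have : (interior A `&` interior B) (s^-1 *: y).
  by split; [apply: (E _ x) | apply: (E _ y); rewrite ?subrr ?enorm0].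
by rewrite AB.
Qed.

Variables (lambda : R) (L : (nat -> R) -> R).
Hypotheses (l1 : 1 < lambda) (HL : banach_limit L).

Let l0 : 0 < lambda. Proof. exact: lt_trans l1. Qed.
Let lj0 j : 0 < lambda ^+ j. Proof. exact: exprn_gt0. Qed.
Let ljn0 j : lambda ^+ j != 0. Proof. by rewrite gt_eqF. Qed.

Definition density (F : R -> set V) (j : nat) : R := N (F (lambda ^+ j)) / (lambda ^+ j) ^+ d.

(* A substitute for the volume: extent is subadditive and iextent is
   superadditive on sets with disjoint interiors, and no assumption is made on
   the Lebesgue measure of boundaries. *)
Definition extent A := L (density (scal^~ A)).
Definition iextent A := L (density (core^~ A)).
Definition lextent A := L (density (layer^~ A)).

(** A lies in a cube, so the packing number of s A is at most a constant times s^d for s >= 1. *)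
Lemma density_bounded A (F : R -> set V) : ebounded A -> (forall s, F s `<=` scal s A) ->
  bounded_seq (density F).
Proof.
move=> [H AH] FA; exists ((2 * (d%:R + 1) * `|H| + 1) ^+ d) => j.
rewrite /density; set s := lambda ^+ j.
have bF : ebounded (F s) by apply: ebounded_sub (FA s) _; apply: scal_bounded; exists H.
rewrite ger0_norm ?divr_ge0 ?packing_number_ge0 ?exprn_ge0 ?(ltW l0)// ler_pdivrMr ?exprn_gt0//.
apply: packing_number_le => l lsep lF.
apply: (le_trans (packing_box (a := 0) (h := fun=> s * `|H|) lsep _ _)).
- by move=> _; rewrite mulr_ge0// ltW// /s lj0.
- move=> x /lF/FA[z /AH zH <-] i; rewrite !mxE subr0 normrM gtr0_norm ?lj0// ler_pM2l ?lj0//.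
  by rewrite (le_trans (coord_le_enorm z i))// (le_trans zH)// ler_norm.
rewrite prodr_const card_ord -exprMn lerXn2r ?nnegrE ?addr_ge0 ?mulr_ge0 ?addr_ge0 ?(ltW (lj0 j))//.
have s1 : 1 <= s by rewrite exprn_ege1// ltW.
rewrite [X in _ <= X]mulrDl mul1r; apply: lerD => //; rewrite le_eqVlt; apply/orP; left; apply/eqP; ring.
Qed.

Lemma layer_sub s A : layer s A `<=` scal s A.
Proof. by move=> x []. Qed.

Hint Resolve core_sub layer_sub : core.

Let b1 A : ebounded A -> bounded_seq (density (scal^~ A)).
Proof. by move=> bA; apply: (density_bounded bA) => s x. Qed.
Let b2 A : ebounded A -> bounded_seq (density (core^~ A)).
Proof. by move=> bA; apply: density_bounded bA _ => s; exact: core_sub. Qed.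
Let b3 A : ebounded A -> bounded_seq (density (layer^~ A)).
Proof. by move=> bA; apply: density_bounded bA _ => s; exact: layer_sub. Qed.

Let bs s A : ebounded A -> ebounded (core s A).
Proof. by move=> bA; apply: ebounded_sub (@core_sub s A) _; exact: scal_bounded. Qed.
Let bl s A : ebounded A -> ebounded (layer s A).
Proof. by move=> bA; apply: ebounded_sub (@layer_sub s A) _; exact: scal_bounded. Qed.

Lemma density_le F G j : N (F (lambda ^+ j)) <= N (G (lambda ^+ j)) -> density F j <= density G j.
Proof. by move=> h; rewrite /density ler_pM2r// invr_gt0 exprn_gt0. Qed.

Lemma density_ge0 A F j : ebounded A -> F (lambda ^+ j) `<=` scal (lambda ^+ j) A -> 0 <= density F j.
Proof.
move=> bA FA; rewrite divr_ge0 ?exprn_ge0 ?(ltW l0)// packing_number_ge0//.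
exact: ebounded_sub FA (scal_bounded _ bA).
Qed.

Lemma extent_mono A B : ebounded B -> A `<=` B -> extent A <= extent B.
Proof.
move=> bB AB; have bA := ebounded_sub AB bB.
apply: (blim_le HL); [exact: b1|exact: b1|] => j; apply: density_le.
by apply: packing_number_mono; [exact: scal_bounded | exact: scal_mono].
Qed.

Lemma iextent_ge0 A : ebounded A -> 0 <= iextent A.
Proof. by move=> bA; apply: (blim_ge0 HL (b2 bA)) => j; apply: density_ge0 bA _. Qed.

Lemma lextent_ge0 A : ebounded A -> 0 <= lextent A.
Proof. by move=> bA; apply: (blim_ge0 HL (b3 bA)) => j; apply: density_ge0 bA _. Qed.

Lemma iextent_le A : ebounded A -> iextent A <= extent A.
Proof.
move=> bA; apply: (blim_le HL); [exact: b2|exact: b1|] => j; apply: density_le.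
by apply: packing_number_mono; [exact: scal_bounded | exact: core_sub].
Qed.

Lemma extent_le_layer A : ebounded A -> extent A <= iextent A + lextent A.
Proof.
move=> bA; rewrite /iextent /lextent -(blimD HL (b2 bA) (b3 bA)).
apply: (blim_le HL); [exact: b1|exact: bounded_seqD (b2 bA) (b3 bA)|] => j.
rewrite /density -mulrDl ler_pM2r ?invr_gt0 ?exprn_gt0//.
apply: le_trans (packing_numberU (bs _ bA) (bl _ bA)).
apply: packing_number_mono.
  apply: ebounded_sub (scal_bounded (lambda ^+ j) bA).
  by move=> x [/core_sub|/layer_sub].
by move=> x xA; have [xc|nxc] := pselect (core (lambda ^+ j) A x); [left | right].
Qed.

Lemma blim_sum (T : eqType) (l : seq T) (F : T -> R -> set V) (A : T -> set V) :
  (forall t, t \in l -> ebounded (A t)) -> (forall t s, F t s `<=` scal s (A t)) ->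
  bounded_seq (fun j => \sum_(t <- l) density (F t) j) /\
  L (fun j => \sum_(t <- l) density (F t) j) = \sum_(t <- l) L (density (F t)).
Proof.
move=> + FA; elim: l => [|t l IH] h.
  split; first by exists 0 => j; rewrite big_nil normr0.
  rewrite big_nil (_ : (fun j => _) = (fun=> 0)) ?(blim_cst HL)//.
  by apply/funext => j; rewrite big_nil.
have [|bl' El] := IH; first by move=> u ul; apply: h; rewrite inE ul orbT.
have bt : bounded_seq (density (F t)) by apply: density_bounded (h t (mem_head _ _)) (FA t).
have E : (fun j => \sum_(t <- t :: l) density (F t) j) =
  (fun j => density (F t) j + \sum_(t <- l) density (F t) j).
  by apply/funext => j; rewrite big_cons.
by rewrite E; split; [exact: bounded_seqD | rewrite (blimD HL)// El big_cons].
Qed.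

Lemma extent_le_sum (T : eqType) (l : seq T) (f : T -> set V) A :
  (forall t, t \in l -> ebounded (f t)) -> A `<=` seqU l f ->
  extent A <= \sum_(t <- l) extent (f t).
Proof.
move=> h AU; have bU := seqU_bounded h.
have [bS <-] := @blim_sum _ l (fun t => scal^~ (f t)) f h (fun _ _ => @subset_refl _ _).
apply: (blim_le HL) => [||j]; [exact/b1/ebounded_sub/bU|by []|].
rewrite /density -mulr_suml ler_pM2r ?invr_gt0 ?exprn_gt0//.
apply: (le_trans _ (packing_number_seqU _)) => [|t tl]; last exact/scal_bounded/h.
apply: packing_number_mono; first by apply: seqU_bounded => t tl; exact/scal_bounded/h.
by move=> _ [x /AU[t tl tx] <-]; exists t => //; exists x.
Qed.

Lemma iextent_ge_sum (T : eqType) (l : seq T) (f : T -> set V) A : uniq l -> ebounded A ->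
  (forall t, t \in l -> f t `<=` A) ->
  (forall t u, t \in l -> u \in l -> t != u -> int_disjoint (f t) (f u)) ->
  \sum_(t <- l) iextent (f t) <= iextent A.
Proof.
move=> ul bA fA dis; have h t : t \in l -> ebounded (f t) by move=> /fA tA; exact: ebounded_sub bA.
have [bS <-] := @blim_sum _ l (fun t => core^~ (f t)) f h (fun t s => @core_sub s (f t)).
apply: (blim_le HL) => [||j]; [by []|exact: b2|].
rewrite /density -mulr_suml ler_pM2r ?invr_gt0 ?exprn_gt0//.
apply: (le_trans (packing_number_seqU_far _ _ _)) => //.
- by move=> t tl; exact/bs/h.
- by move=> t u tl u_l tu; apply: core_far => //; exact: dis.
apply: packing_number_mono; first exact: bs.
by move=> x [t tl tx]; apply: core_mono tx; exact: fA.
Qed.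

(** A piece with [~~ p t] has all its unit balls inside A, so after dilation by s >= 1 it lies in
    the core of A. In any other piece, a point of the layer of A is in the layer of that piece, by
    monotonicity of cores. *)
Lemma lextent_le_sum (T : eqType) (l : seq T) (p : pred T) (f : T -> set V) A :
  (forall t, t \in l -> ebounded (f t)) -> A `<=` seqU l f ->
  (forall t, t \in l -> f t `<=` A) ->
  (forall t x, t \in l -> ~~ p t -> f t x -> cball x 1 `<=` A) ->
  lextent A <= \sum_(t <- l | p t) lextent (f t).
Proof.
move=> h AU fA inner; have bU := seqU_bounded h.
rewrite -big_filter; set l' := [seq t <- l | p t].
have h' t : t \in l' -> ebounded (f t) by rewrite mem_filter => /andP[_ /h].
have [bS <-] := @blim_sum _ l' (fun t => layer^~ (f t)) f h' (fun t s => @layer_sub s (f t)).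
apply: (blim_le HL) => [||j]; [exact/b3/ebounded_sub/bU|by []|].
rewrite /density -mulr_suml ler_pM2r ?invr_gt0 ?exprn_gt0//.
apply: (le_trans _ (packing_number_seqU _)) => [|t tl]; last exact/bl/h'.
apply: packing_number_mono; first by apply: seqU_bounded => t tl; exact/bl/h'.
move=> _ [[x Ax <-] nc]; have [t tl tx] := AU x Ax.
have [pt|npt] := boolP (p t).
  exists t; first by rewrite mem_filter pt.
  by split; [exists x | move=> tc; apply: nc; apply: core_mono tc; exact: fA].
exfalso; apply: nc => y xy; set s := lambda ^+ j.
have s1 : 1 <= s by rewrite exprn_ege1// ltW.
have s0 : 0 < s by exact: lj0.
have sn0 : s != 0 by exact: ljn0.
exists (s^-1 *: y); last by rewrite scalerA divff ?scale1r ?ljn0//.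
apply: (inner t x tl npt tx); rewrite /cball/=.
have -> : s^-1 *: y - x = s^-1 *: (y - s *: x) by rewrite scalerBr scalerA mulVf ?scale1r ?ljn0//.
rewrite enormZ gtr0_norm ?invr_gt0// mulrC ler_pdivrMr// mul1r.
exact: le_trans s1.
Qed.

Lemma extent_isometry (f : V -> V) A : isometry f -> ebounded A -> extent (f @` A) = extent A.
Proof.
move=> fi bA; congr L; apply/funext => j; rewrite /density scal_image// packing_number_isometry//.
  exact: rescale_isometry.
exact: scal_bounded.
Qed.

Lemma iextent_isometry (f : V -> V) A : isometry f -> ebounded A -> iextent (f @` A) = iextent A.
Proof.
move=> fi bA; congr L; apply/funext => j; rewrite /density core_image// packing_number_isometry//.
  exact: rescale_isometry.
exact: bs.
Qed.

Lemma lextent_isometry (f : V -> V) A : isometry f -> ebounded A -> lextent (f @` A) = lextent A.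
Proof.
move=> fi bA; congr L; apply/funext => j; rewrite /density layer_image// packing_number_isometry//.
  exact: rescale_isometry.
exact: bl.
Qed.

(** Dilating by lambda moves the index of the density by one and changes the normalization by
    lambda^d; shift invariance does the rest. *)
Lemma blim_density_scal (F G : R -> set V) : bounded_seq (density F) ->
  (forall s, G s = F (s * lambda)) -> L (density G) = lambda ^+ d * L (density F).
Proof.
move=> bF GF; rewrite -(blimS HL bF) -(blimZ HL); last by have [B FB] := bF; exists B.
congr L; apply/funext => j; rewrite /density GF -exprSr mulrCA; congr (_ * _).
by rewrite exprS exprMn invfM mulrA divff ?mul1r// expf_neq0.
Qed.

Lemma extent_scal A : ebounded A -> extent (scal lambda A) = lambda ^+ d * extent A.
Proof. by move=> bA; apply: blim_density_scal (b1 bA) _ => s; exact: scal_scal. Qed.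

Lemma iextent_scal A : ebounded A -> iextent (scal lambda A) = lambda ^+ d * iextent A.
Proof. by move=> bA; apply: blim_density_scal (b2 bA) _ => s; exact: core_scal. Qed.

Lemma lextent_scal A : ebounded A -> lextent (scal lambda A) = lambda ^+ d * lextent A.
Proof. by move=> bA; apply: blim_density_scal (b3 bA) _ => s; exact: layer_scal. Qed.

Lemma blim_shift (u : nat -> R) k : bounded_seq u -> L (fun n => u (n + k)%N) = L u.
Proof.
elim: k u => [|k IH] u bu; first by congr L; apply/funext => n; rewrite addn0.
rewrite -(IH u bu) -[RHS](blimS HL); last by have [B uB] := bu; exists B.
by congr L; apply/funext => n; rewrite addSnnS.
Qed.

(** Once s = lambda^j satisfies s r >= 2, the core of s A contains a ball of radius s r - 1 >= s r /
    2, hence a grid of at least (c s)^d points. The earlier indices are dropped by [blim_shift]. *)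
Lemma iextent_gt0 A x r : ebounded A -> 0 < r -> cball x r `<=` A -> 0 < iextent A.
Proof.
move=> bA r0 xA; have d0 : 0 < d%:R + 1 :> R by rewrite ltr_wpDl.
pose c := r / 2 / (d%:R + 1); have c0 : 0 < c by rewrite !divr_gt0.
apply: (@lt_le_trans _ _ (c ^+ d)); first exact: exprn_gt0.
have [k Hk] := pow_unbounded (2 / r) l1.
rewrite /iextent -(blim_shift k (b2 bA)) -[X in X <= _](blim_cst HL).
apply: (blim_le HL) => [||j].
- by exists (`|c ^+ d|).
- by have [B uB] := b2 bA; exists B => n; exact: uB.
rewrite /density; set s := lambda ^+ (j + k).
have s0 : 0 < s by exact: lj0.
have sn0 : s != 0 by exact: ljn0.
have s2 : 2 / r <= s.
  by rewrite /s exprD (le_trans Hk)// ler_peMl ?(ltW (lj0 _))// exprn_ege1// ltW.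
have sr : 2 <= s * r by rewrite -ler_pdivrMr.
rewrite ler_pdivlMr ?exprn_gt0// -exprMn.
pose n := Num.truncn ((s * r - 1) / (d%:R + 1)).
apply: le_trans (packing_number_ball (A := core s A) (x := s *: x) (r := s * r - 1) (n := n) (bs _ bA) _ _).
- rewrite lerXn2r ?nnegrE//; first by rewrite mulr_ge0 ?(ltW c0)// ltW.
  apply: (@le_trans _ _ ((s * r - 1) / (d%:R + 1))); last by rewrite ltW// truncnS_gt.
  rewrite /c mulrAC ler_pM2r ?invr_gt0//; lra.
- move=> y yx z zy; exists (s^-1 *: z); last by rewrite scalerA divff ?scale1r ?ljn0//.
  apply: xA; rewrite /cball/=.
  have -> : s^-1 *: z - x = s^-1 *: (z - s *: x) by rewrite scalerBr scalerA mulVf ?scale1r ?ljn0//.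
  rewrite enormZ gtr0_norm ?invr_gt0// mulrC ler_pdivrMr// mulrC.
  rewrite (le_trans (enorm_triangle y _ _))//; move: yx zy; rewrite /cball/=; lra.
- have /truncn_itv/andP[h _] : 0 <= (s * r - 1) / (d%:R + 1) by rewrite divr_ge0 ?ltW//; lra.
  rewrite -/n in h; rewrite ler_pdivlMr// in h; rewrite (le_trans _ h)// mulrC ler_wpM2l//; lra.
Qed.

End Extent.

(** * Extents of boxes and cubes *)

Section Cubes.
Variables (R : realType) (d : nat).
Local Notation V := 'rV[R]_d.
Implicit Types (beta a s : R) (z w : 'rV[int]_d).

Definition box (a : R) : set V := [set x | forall i, 0 <= x 0 i <= a].

Definition lattice_point (beta : R) (z : 'rV[int]_d) : V := beta *: map_mx intr z.

Definition cube (beta : R) (z : 'rV[int]_d) : set V :=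
  [set x | forall i, 0 <= x 0 i - beta * (z 0 i)%:~R <= beta].

Lemma cubeE beta z : cube beta z = (fun x => x + lattice_point beta z) @` box beta.
Proof.
apply/seteqP; split => [x xz|_ [x xb <-] i].
  exists (x - lattice_point beta z); last by rewrite subrK.
  by move=> i; have := xz i; rewrite !mxE.
by rewrite !mxE addrK.
Qed.

Lemma translation_isometry (v : V) : isometry (fun x => x + v).
Proof. by move=> x y; rewrite opprD addrACA subrr addr0. Qed.

Lemma box_bounded a : ebounded (box a).
Proof.
exists (d%:R * `|a|) => x xa; apply: enorm_le_sup => // i.
by have /andP[x0 xi] := xa i; rewrite ger0_norm// (le_trans xi)// ler_norm.
Qed.

Lemma cube_bounded beta z : ebounded (cube beta z).
Proof.
by rewrite cubeE; apply: image_bounded (box_bounded beta); exact: translation_isometry.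
Qed.

Lemma enorm_delta (e : R) (i : 'I_d) : enorm (e *: delta_mx 0 i : V) = `|e|.
Proof.
rewrite enormZ /enorm (bigD1 i)//= big1 ?addr0 => [|j ji]; last first.
  by rewrite mxE (negbTE ji) andbF expr0n.
by rewrite mxE !eqxx expr1n sqrtr1 mulr1.
Qed.

Lemma cube_disjoint beta z w : 0 < beta -> z != w -> int_disjoint (cube beta z) (cube beta w).
Proof.
move=> b0 zw; apply/seteqP; split => // x [/interior_cballP[e e0 ez] /interior_cballP[f f0 fw]].
have [i zwi] : exists i, z 0 i != w 0 i.
  apply/existsP; apply: contraNT zw; rewrite negb_exists => /forallP h.
  by apply/eqP/matrixP => k j; rewrite ord1; apply/eqP; have := h j; rewrite negbK.
have key (u v : 'rV[int]_d) (r s : R) : 0 < r -> 0 < s -> cball x r `<=` cube beta u -> cball x s `<=` cube beta v ->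
    u 0 i < v 0 i -> False.
  move=> r0 s0 ru sv uv.
  have /(_ i)/andP[_ h1] := ru x (cball_center _ (ltW r0)).
  have xs : cball x s (x - s *: delta_mx 0 i).
    by rewrite /cball/= addrAC subrr add0r enormN enorm_delta gtr0_norm.
  have /(_ i)/andP[] := sv _ xs; rewrite !mxE !eqxx mulr1 => h2 _.
  have : (u 0 i)%:~R + 1 <= (v 0 i)%:~R :> R by rewrite -[1]/(1%:~R) -intrD ler_int lezD1.
  rewrite -(ler_pM2l b0) mulrDr mulr1; lra.
by case: (ltgtP (z 0 i) (w 0 i)) zwi => // h _; [apply: (key z w e f) | apply: (key w z f e)].
Qed.

Definition grid (n : nat) : seq 'rV[int]_d :=
  map (fun f : {ffun 'I_d -> 'I_n} => \row_i Posz (f i)) (enum {ffun 'I_d -> 'I_n}).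

Lemma grid_uniq n : uniq (grid n).
Proof.
rewrite map_inj_uniq ?enum_uniq// => f g /matrixP h; apply/ffunP => i.
by have := h 0 i; rewrite !mxE => -[] /val_inj.
Qed.

Lemma size_grid n : size (grid n) = (n ^ d)%N.
Proof. by rewrite size_map -cardT card_ffun !card_ord. Qed.

Lemma mem_grid n z : (z \in grid n) = [forall i, 0 <= z 0 i < n%:Z].
Proof.
apply/mapP/forallP => [[f _ ->] i|h].
  by rewrite mxE /= ltz_nat ltn_ord.
have a i : (`|z 0%R i| < n)%N by have /andP[h1 h2] := h i; rewrite -ltz_nat gez0_abs.
exists [ffun i => Ordinal (a i)]; first by rewrite mem_enum.
apply/matrixP => k i; rewrite ord1 !mxE ffunE /= gez0_abs//.
by have /andP[] := h i.
Qed.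

Lemma grid_cube_sub (beta : R) n z : 0 < beta -> z \in grid n -> cube beta z `<=` box (n%:R * beta).
Proof.
move=> b0; rewrite mem_grid => /forallP zn x xz i.
have /andP[z0 zi] := zn i; have /andP[h1 h2] := xz i.
have h3 : 0 <= (z 0 i)%:~R :> R by rewrite ler0z.
have h4 : (z 0 i)%:~R + 1 <= n%:R :> R by rewrite -[1]/(1%:~R) -intrD -[n%:R]/(n%:Z%:~R) ler_int lezD1.
have h5 : beta * ((z 0 i)%:~R + 1) <= beta * n%:R by rewrite ler_pM2l.
have h6 : 0 <= beta * (z 0 i)%:~R by rewrite mulr_ge0// ltW.
lra.
Qed.

Lemma box_cover (beta : R) n : 0 < beta -> (0 < n)%N -> box (n%:R * beta) `<=` seqU (grid n) (cube beta).
Proof.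
move=> b0 n0 x xb.
(* The minimum with n - 1 assigns the points of an upper face to the last cube. *)
pose t i := minn (Num.truncn (x 0 i / beta)) n.-1.
exists (\row_i Posz (t i)).
  rewrite mem_grid; apply/forallP => i; rewrite mxE /= ltz_nat.
  by rewrite -[X in (_ < X)%N](prednK n0) ltnS geq_minr.
move=> i; rewrite mxE /= -[(Posz _)%:~R]/((t i)%:R).
have /andP[x0 xn] := xb i.
have /truncn_itv/andP[] : 0 <= x 0 i / beta by rewrite divr_ge0// ltW.
rewrite ler_pdivlMr// ltr_pdivrMr// -natr1 => h1 h2.
rewrite /t; case: leqP => h; first lra.
have h3 : n.-1%:R * beta <= (Num.truncn (x 0 i / beta))%:R * beta by rewrite ler_pM2r// ler_nat ltnW.
have : n%:R * beta = n.-1%:R * beta + beta by rewrite -{1}(prednK n0) -natr1 mulrDl mul1r.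
lra.
Qed.

Variables (lambda : R) (L : (nat -> R) -> R).
Hypotheses (l1 : 1 < lambda) (HL : banach_limit L).

Local Notation extent := (@extent R d lambda L).
Local Notation iextent := (@iextent R d lambda L).
Local Notation lextent := (@lextent R d lambda L).

Let l0 : 0 < lambda. Proof. exact: lt_trans l1. Qed.

Lemma cube_extent beta z : extent (cube beta z) = extent (box beta).
Proof. by rewrite cubeE extent_isometry//; [exact: translation_isometry | exact: box_bounded]. Qed.

Lemma cube_iextent beta z : iextent (cube beta z) = iextent (box beta).
Proof. by rewrite cubeE iextent_isometry//; [exact: translation_isometry | exact: box_bounded]. Qed.

Definition slab (a : R) (p : 'I_d * bool) : set V :=
  [set x | (forall j, 0 <= x 0 j <= a) /\ `|x 0 p.1 - (if p.2 then a else 0)| <= 1].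

Lemma packing_slab a p : 0 <= a ->
  packing_number (slab a p) <= (2 * (d%:R + 1) + 1) * (2 * (d%:R + 1) * a + 1) ^+ d.-1.
Proof.
case: p => i b a0; apply: packing_number_le => l lsep ls.
pose c : V := \row_j if j == i then (if b then a else 0) else 0.
apply: (le_trans (packing_box (a := c) (h := fun j => if j == i then 1 else a) lsep _ _)).
- by move=> j; case: ifP.
- move=> x /ls[xa xi] j; rewrite mxE; case: eqP => [->//|_].
  by have /andP[x0 h] := xa j; rewrite subr0 ger0_norm.
rewrite (bigD1 i)//= eqxx mulr1 ler_pM2l; last by rewrite ltr_wpDl// mulr_ge0// ltW// ltr_wpDl.
rewrite (eq_bigr (fun=> 2 * (d%:R + 1) * a + 1)) => [|j /negbTE ->//].
by rewrite prodr_const cardC1 card_ord.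
Qed.

(** A point of the layer has a point w outside the box within distance 1; a coordinate where w
    leaves the box determines the nearby face, and the sign of that coordinate tells the lower face
    from the upper one. *)
Lemma layer_box s a : 0 < s -> 0 <= a -> layer s (box a) `<=` seqU (enum {: 'I_d * bool}) (slab (s * a)).
Proof.
move=> s0 a0 y [[x xa <-] /existsNP[w /not_implyP[wx wna]]].
have : ~ box a (s^-1 *: w).
  by move=> h; apply: wna; exists (s^-1 *: w) => //; rewrite scalerA divff ?gt_eqF// scale1r.
move=> /existsNP[i /negP]; rewrite negb_and -!ltNge => h.
have xi j : 0 <= s * x 0 j <= s * a.
  by have /andP[h1 h2] := xa j; rewrite mulr_ge0 ?(ltW s0)//= ler_pM2l.
have wxi : `|w 0 i - s * x 0 i| <= 1.
  by have := coord_le_enorm (w - s *: x) i; rewrite !mxE => /le_trans; apply.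
exists (i, 0 <= w 0 i); first by rewrite mem_enum.
split => [j|/=]; first by rewrite mxE.
rewrite !mxE; have := xi i; move: wxi; rewrite !ler_norml.
move: h; rewrite !mxE pmulr_rlt0 ?invr_gt0// mulrC ltr_pdivlMr// mulrC.
by case: (leP 0 (w 0 i)) => /= w0; lra.
Qed.

(** Each of the 2d slabs has packing number of order s^(d-1), so the density of the layer is of
    order lambda^-j, and a Banach limit sends geometric sequences to 0. *)
Lemma lextent_box a : 0 <= a -> lextent (box a) = 0.
Proof.
move=> a0; apply/eqP; rewrite eq_le (lextent_ge0 l1 HL) ?andbT; last exact: box_bounded.
pose K := (2 * (d%:R + 1) + 1) * (2 * (d%:R + 1) * a + 1) ^+ d.-1 * (d * 2)%:R.
have li1 : 0 <= lambda^-1 < 1 by rewrite invr_ge0 (ltW l0)/= invf_lt1.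
have d1 : 0 <= d%:R + 1 :> R by rewrite addr_ge0.
have D0 : 0 <= 2 * (d%:R + 1) :> R by rewrite mulr_ge0.
have A0 : 0 <= 2 * (d%:R + 1) + 1 :> R by rewrite addr_ge0.
have B0 (c : R) : 0 <= c -> 0 <= 2 * (d%:R + 1) * c + 1 by move=> c0; rewrite addr_ge0// mulr_ge0.
have Ba0 := B0 a a0.
have K0 : 0 <= K by rewrite /K; apply: mulr_ge0 => //; apply: mulr_ge0 => //; exact: exprn_ge0.
rewrite -(blim_geometric HL K li1).
apply: (blim_le HL).
- by apply: (density_bounded l1 (box_bounded a)) => s x [].
- exists K => j; rewrite ger0_norm ?mulr_ge0 ?exprn_ge0 ?invr_ge0 ?(ltW l0)//.
  have /andP[h1 h2] := li1.
  by rewrite ler_piMr// exprn_ile1// ltW.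
move=> j; rewrite /density; set s := lambda ^+ j.
have s0 : 0 < s by exact: exprn_gt0.
have s1 : 1 <= s by rewrite exprn_ege1// ltW.
rewrite ler_pdivrMr ?exprn_gt0//.
have bs t : t \in enum {: 'I_d * bool} -> ebounded (slab (s * a) t).
  by move=> _; apply: ebounded_sub (box_bounded (s * a)) => x [].
apply: le_trans (packing_number_mono _ (layer_box s0 a0)) _; first exact: seqU_bounded.
apply: le_trans (packing_number_seqU bs) _.
have [d0|d0] := posnP d.
  rewrite big_seq big1 => [|[i b] _]; last first.
    by exfalso; have : (i < 0)%N by rewrite -[X in (_ < X)%N]d0.
  by rewrite !mulr_ge0// ?exprn_ge0 ?invr_ge0 ?(ltW l0)// ltW.
pose M := (2 * (d%:R + 1) + 1) * (2 * (d%:R + 1) * a + 1) ^+ d.-1 * s ^+ d.-1.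
apply: (@le_trans _ _ (\sum_(t <- enum {: 'I_d * bool}) M)).
  apply: ler_sum => t _; apply: le_trans (packing_slab _ _) _; first by rewrite mulr_ge0// ltW.
  rewrite /M -[X in _ <= X]mulrA -exprMn ler_wpM2l//.
  have sa0 : 0 <= s * a by rewrite mulr_ge0// ltW.
  rewrite lerXn2r ?nnegrE ?(B0 _ sa0) ?(mulr_ge0 Ba0 (ltW s0))//.
  rewrite [X in _ <= X]mulrDl mul1r lerD// le_eqVlt; apply/orP; left; apply/eqP; ring.
rewrite big_const_seq count_predT -cardT card_prod card_ord card_bool iter_addr addr0.
rewrite /K -[X in X <= _]mulr_natr /M le_eqVlt; apply/orP; left; apply/eqP.
rewrite exprVn -[in s ^+ d](prednK d0) exprS -/s.
have sV : s^-1 * s = 1 by rewrite mulVf// gt_eqF.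
transitivity ((2 * (d%:R + 1) + 1) * (2 * (d%:R + 1) * a + 1) ^+ d.-1 * s ^+ d.-1 * (d * 2)%:R * (s^-1 * s)).
  by rewrite sV mulr1.
ring.
Qed.

Lemma iextent_box a : 0 <= a -> iextent (box a) = extent (box a).
Proof.
move=> a0; apply/eqP; rewrite eq_le (iextent_le l1 HL (box_bounded a))/=.
by have := extent_le_layer l1 HL (box_bounded a); rewrite lextent_box// addr0.
Qed.

(** The box splits into n^d cubes: subadditivity of the extent bounds it above, superadditivity of
    the inner extent bounds it below, and the two agree on boxes. *)
Lemma extent_box_scale n beta : 0 < beta -> (0 < n)%N ->
  extent (box (n%:R * beta)) = n%:R ^+ d * extent (box beta).
Proof.
move=> b0 n0; have sumE : \sum_(z <- grid n) extent (box beta) = n%:R ^+ d * extent (box beta).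
  by rewrite big_const_seq count_predT iter_addr addr0 size_grid -natrX mulr_natl.
have nb : 0 <= n%:R * beta by rewrite mulr_ge0// ltW.
apply/eqP; rewrite eq_le -sumE; apply/andP; split.
  have := extent_le_sum l1 HL (fun t _ => cube_bounded beta t) (box_cover b0 n0).
  by under eq_bigr do rewrite cube_extent.
rewrite -(iextent_box nb).
have := iextent_ge_sum l1 HL (grid_uniq n) (box_bounded (n%:R * beta)) (fun z => @grid_cube_sub beta n z b0)
  (fun t u _ _ => @cube_disjoint beta t u b0).
by under eq_bigr do rewrite cube_iextent iextent_box ?(ltW b0)//.
Qed.

(** For integer multiples this is [extent_box_scale]; the general case follows by monotonicity,
    squeezing beta between fractions with denominator n + 1 and letting n grow. *)
Lemma extent_box beta : 0 < beta -> extent (box beta) = beta ^+ d * extent (box 1).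
Proof.
move=> b0; set q := extent (box 1).
have q0 : 0 <= q by rewrite /q -(iextent_box ler01) (iextent_ge0 l1 HL)//; exact: box_bounded.
have mono a b : 0 <= a -> a <= b -> extent (box a) <= extent (box b).
  move=> a0 ab; apply: (extent_mono l1 HL); first exact: box_bounded.
  by move=> x xa i; have /andP[-> h] := xa i; rewrite /= (le_trans h).
have up n : extent (box beta) <= (beta + n.+1%:R^-1) ^+ d * q.
  have n0 : 0 < n.+1%:R :> R by [].
  set p := (Num.truncn (n.+1%:R * beta)).+1.
  have : n.+1%:R * beta <= p%:R * 1 by rewrite mulr1 ltW// truncnS_gt.
  move=> /mono; rewrite mulr_ge0 ?(ltW b0)// => /(_ isT).
  rewrite !extent_box_scale// -ler_pdivlMl ?exprn_gt0// => /le_trans; apply.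
  rewrite mulrA -exprVn -exprMn ler_wpM2r// lerXn2r ?nnegrE ?mulr_ge0 ?addr_ge0 ?invr_ge0 ?(ltW b0)//.
  rewrite ler_pdivrMl// mulrDr divff ?gt_eqF// /p -natr1 lerD2r.
  by have /truncn_itv/andP[] : 0 <= n.+1%:R * beta by rewrite mulr_ge0// ltW.
have low n : 1 <= n.+1%:R * beta -> (beta - n.+1%:R^-1) ^+ d * q <= extent (box beta).
  have n0 : 0 < n.+1%:R :> R by [].
  move=> nb; have /truncn_itv/andP[h1 h2] : 0 <= n.+1%:R * beta by rewrite mulr_ge0// ltW.
  set p := Num.truncn (n.+1%:R * beta) in h1 h2.
  have p0 : (0 < p)%N by rewrite lt0n; apply/eqP => p0; rewrite p0 ltNge nb in h2.
  have : p%:R * 1 <= n.+1%:R * beta by rewrite mulr1.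
  move=> /mono; rewrite mulr1 ler0n => /(_ isT); rewrite -[p%:R]mulr1.
  rewrite !extent_box_scale// -ler_pdivrMl ?exprn_gt0//; apply: le_trans.
  rewrite mulrA -exprVn -exprMn ler_wpM2r// lerXn2r ?nnegrE ?mulr_ge0 ?invr_ge0//.
    by rewrite subr_ge0 -[X in X <= _]mulr1 ler_pdivrMl.
  rewrite ler_pdivlMl// mulrBr divff ?gt_eqF//; move: h2; rewrite -natr1; lra.
have cvp : (fun n => (beta + n.+1%:R^-1) ^+ d * q) @ \oo --> beta ^+ d * q.
  apply: cvgMl; rewrite -[in X in _ --> X](addr0 beta).
  apply: (cvg_comp (fun n => beta + harmonic n) (fun x : R => x ^+ d)); last exact: exprn_continuous.
  by apply: cvgD; [exact: cvg_cst | exact: cvg_harmonic].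
have cvm : (fun n => (beta - n.+1%:R^-1) ^+ d * q) @ \oo --> beta ^+ d * q.
  apply: cvgMl; rewrite -[in X in _ --> X](subr0 beta).
  apply: (cvg_comp (fun n => beta - harmonic n) (fun x : R => x ^+ d)); last exact: exprn_continuous.
  by apply: cvgB; [exact: cvg_cst | exact: cvg_harmonic].
apply/eqP; rewrite eq_le; apply/andP; split.
  rewrite -(cvg_lim _ cvp)//; apply: limr_ge; first by apply/cvg_ex; exists (beta ^+ d * q).
  by near=> n; exact: up.
rewrite -(cvg_lim _ cvm)//; apply: limr_le; first by apply/cvg_ex; exists (beta ^+ d * q).
near=> n; apply: low.
rewrite -ler_pdivrMr//; near: n; exists (Num.truncn (1 / beta)) => // n /= h.
by rewrite ltW// (lt_le_trans (truncnS_gt _))// ler_nat ltnS.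
Unshelve. all: by end_near.
Qed.

Lemma extent_box_gt0 beta : 0 < beta -> 0 < extent (box beta).
Proof.
move=> b0; rewrite -iextent_box ?(ltW b0)//.
apply: (@iextent_gt0 _ _ _ _ l1 HL _ (const_mx (beta / 2)) (beta / 2)); [exact: box_bounded|exact: divr_gt0|].
move=> x xb i; have := coord_le_enorm (x - const_mx (beta / 2)) i.
move=> /le_trans/(_ xb); rewrite !mxE ler_norml; lra.
Qed.

End Cubes.

(** * Barycenters *)

Section IteratedIntegral.
Variable R : realType.

(* The integrand and all its partial integrals depend measurably on the
   variables that remain; the parameter space T collects these variables. *)
Fixpoint jointly_measurable d : forall (disp : measure_display) (T : measurableType disp),
    (T -> 'rV[R]_d -> R) -> Prop :=
  match d with
  | 0 => fun _ T g => measurable_fun setT (fun t : T => g t 0)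
  | d'.+1 => fun _ T g =>
     jointly_measurable (T := (T * measurableTypeR R)%type)
       (fun (tx : T * R) (y : 'rV[R]_d') => g tx.1 (row_mx tx.2%:M y))
  end.

(** Bounded with bounded support, uniformly in the parameter: a class stable under partial
    integration, in which iterated integrals are monotone and linear. *)
Definition tame d (disp : measure_display) (T : measurableType disp) (g : T -> 'rV[R]_d -> R) :=
  jointly_measurable g /\ exists B H : R, [/\ 0 <= B, 0 <= H, (forall t x, `|g t x| <= B) &
    (forall t (x : 'rV[R]_d) i, H < `|x 0 i| -> g t x = 0)].

Lemma row_mx_0 d (a : R) (y : 'rV[R]_d) : (row_mx a%:M y : 'rV[R]_d.+1) 0 0 = a.
Proof.
rewrite /row_mx mxE; case: splitP => j /= e; first by rewrite mxE !ord1 eqxx mulr1n.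
by move: e; rewrite add1n.
Qed.

Lemma row_mx_lift d (a : R) (y : 'rV[R]_d) i : (row_mx a%:M y : 'rV[R]_d.+1) 0 (lift 0 i) = y 0 i.
Proof.
rewrite /row_mx mxE; case: splitP => j /= e.
  by have := ltn_ord j; rewrite -e /bump.
by congr (y 0 _); apply: val_inj; move: e; rewrite /bump /= !add1n => -[].
Qed.

Section OneDimension.
Variables (disp : measure_display) (T : measurableType disp) (I : T -> R -> R) (B H : R).
Hypotheses (mI : measurable_fun setT (fun tx : T * measurableTypeR R => I tx.1 tx.2)).
Hypotheses (B0 : 0 <= B) (H0 : 0 <= H) (IB : forall t x, `|I t x| <= B)
  (IH : forall t x, H < `|x| -> I t x = 0).
Local Notation mu := (@lebesgue_measure R).

Lemma section_measurable t : measurable_fun setT (I t : measurableTypeR R -> R).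
Proof.
apply: (measurableT_comp (f := fun tx : T * measurableTypeR R => I tx.1 tx.2) (g := pair t)) => //.
Qed.

Lemma section_integrable t : mu.-integrable setT (EFin \o I t).
Proof.
have E : EFin \o I t = (EFin \o I t) \_ `[- H, H].
  apply/funext => x; rewrite patchE; case: ifPn => // /negP; rewrite inE /= in_itv /= -ler_norml => /negP.
  by rewrite -ltNge => /IH ->.
rewrite E; apply: (proj1 (integrable_mkcond (mu := mu) (D := `[- H, H]%classic) (EFin \o I t) _)) => //.
apply: measurable_bounded_integrable => //.
- by rewrite /= lebesgue_measure_itv /=; case: ifP => _; rewrite ?ltry// -EFinB ltry.
- by apply: measurable_funTS; exact: section_measurable.
- exists B; split; first exact: num_real.
  by move=> M BM x _ /=; exact: le_trans (IB t x) (ltW BM).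
Qed.

Lemma section_integral_measurable : measurable_fun setT (fun t => \int[mu]_(x in setT) I t x).
Proof.
have /measurable_EFinP := mI; set J := (EFin \o _) => mJ.
have E : (fun t => \int[mu]_(x in setT) I t x) =
  (fun t => fine ((fubini_F mu J^\+ t - fubini_F mu J^\- t)%E)).
  apply/funext => t; rewrite /Rintegral integralE /fubini_F; congr fine; congr (_ - _)%E;
  apply: eq_integral => x _; rewrite ?funeposE ?funenegE//.
rewrite E; apply: measurableT_comp; first exact: fine_measurable.
apply: emeasurable_funB; apply: measurable_fun_fubini_tonelli_F => //.
- exact: measurable_funepos.
- exact: measurable_funeneg.
Qed.

Lemma section_integral_bound t : `|\int[mu]_(x in setT) I t x| <= B * (2 * H).
Proof.
have iB : mu.-integrable setT (EFin \o (cst B \_ `[- H, H])).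
  rewrite -restrict_EFin.
  apply: (proj1 (integrable_mkcond (mu := mu) (D := `[- H, H]%classic) (EFin \o cst B) _)) => //.
  apply: measurable_bounded_integrable => //.
    by rewrite /= lebesgue_measure_itv /=; case: ifP => _; rewrite ?ltry// -EFinB ltry.
  exists B; split; first exact: num_real.
  by move=> M BM x _; rewrite /= ger0_norm// ltW.
have EB : \int[mu]_(x in setT) (cst B \_ `[- H, H]) x = B * (2 * H).
  rewrite -Rintegral_mkcond Rintegral_cst//; congr (_ * _).
  rewrite /= lebesgue_measure_itv /= lte_fin; case: ltP => h /=. by rewrite opprK mulr_natl mulr2n.
  have -> : H = 0 :> R; last by rewrite mulr0.
  by apply/eqP; rewrite eq_le H0 andbT; move: h => /= h; have : H <= - H := h; lra.
have cmp x : - (cst B \_ `[- H, H]) x <= I t x <= (cst B \_ `[- H, H]) x.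
  rewrite patchE; case: ifPn => [_|/negP]; first by rewrite -ler_norml.
  rewrite inE /= in_itv /= -ler_norml => /negP; rewrite -ltNge => /IH ->.
  by rewrite oppr0 lexx.
rewrite ler_norml -EB; apply/andP; split.
  rewrite -mulN1r -RintegralZl//; apply: le_Rintegral => //.
  - exact: (integrableZl measurableT (-1) iB).
  - exact: section_integrable.
  - by move=> x _; rewrite mulN1r; have /andP[] := cmp x.
apply: le_Rintegral => //; first exact: section_integrable.
by move=> x _; have /andP[] := cmp x.
Qed.

End OneDimension.

Lemma integral_Rd0 d (f : 'rV[R]_d -> R) : (forall x, f x = 0) -> integral_Rd f = 0.
Proof.
elim: d f => [|d IH] f f0 /=; first exact: f0.
have -> : (fun x : R => integral_Rd (fun y => f (row_mx x%:M y))) = fun=> 0.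
  by apply/funext => x; apply: IH => y; exact: f0.
rewrite /Rintegral integral0//.
Qed.

Lemma tame_slice d disp (T : measurableType disp) (g : T -> 'rV[R]_d.+1 -> R) : tame g ->
  tame (fun (tx : T * measurableTypeR R) (y : 'rV[R]_d) => g tx.1 (row_mx tx.2%:M y)).
Proof.
move=> [mg [B [H [B0 H0 gB gH]]]]; split; first exact: mg.
exists B, H; split => // t x i Hx; apply: (gH _ _ (lift 0 i)); by rewrite row_mx_lift.
Qed.

(** Induction on d, the first variable joining the parameter space; the outer integral is then
    handled by the one-dimensional section lemmas. *)
Lemma tame_integral d disp (T : measurableType disp) (g : T -> 'rV[R]_d -> R) : tame g ->
  measurable_fun setT (fun t => integral_Rd (g t)) /\
  exists2 B : R, 0 <= B & forall t, `|integral_Rd (g t)| <= B.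
Proof.
elim: d disp T g => [|d IHd] disp T g tg.
  by have [mg [B [H [B0 H0 gB gH]]]] := tg; split => //; exists B => // t; exact: gB.
have [mg [B [H [B0 H0 gB gH]]]] := tg.
have [mI [B' B'0 IB]] := IHd _ _ _ (tame_slice tg).
have vanish t (x : R) : H < `|x| -> integral_Rd (fun y => g t (row_mx x%:M y)) = 0.
  by move=> Hx; apply: integral_Rd0 => y; apply: (gH _ _ 0); rewrite row_mx_0.
have IB' t x := IB (t, x).
split; first exact: (section_integral_measurable mI).
exists (B' * (2 * H)); first by rewrite !mulr_ge0.
by move=> t; exact: (section_integral_bound mI B'0 H0 IB' vanish).
Qed.

Lemma tame_section_integrable d disp (T : measurableType disp) (g : T -> 'rV[R]_d.+1 -> R) t : tame g ->
  (@lebesgue_measure R).-integrable setT (EFin \o (fun x : R => integral_Rd (fun y => g t (row_mx x%:M y)))).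
Proof.
move=> tg; have [mI [B' B'0 IB]] := tame_integral (tame_slice tg).
have [mg [B [H [B0 H0 gB gH]]]] := tg.
apply: (section_integrable (I := fun t x => integral_Rd (fun y => g t (row_mx x%:M y))) (B := B') (H := H)) => //.
- by move=> u x; exact: (IB (u, x)).
- by move=> u x Hx; apply: integral_Rd0 => y; apply: (gH _ _ 0); rewrite row_mx_0.
Qed.

Lemma integral_Rd_le d disp (T : measurableType disp) (g h : T -> 'rV[R]_d -> R) : tame g -> tame h ->
  (forall t x, g t x <= h t x) -> forall t, integral_Rd (g t) <= integral_Rd (h t).
Proof.
elim: d disp T g h => [|d IHd] disp T g h tg th gh t /=; first exact: gh.
apply: le_Rintegral => //; [exact: tame_section_integrable|exact: tame_section_integrable|].
move=> x _; apply: (IHd _ _ _ _ (tame_slice tg) (tame_slice th) _ (t, x)) => u y; exact: gh.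
Qed.

Lemma integral_RdZ d disp (T : measurableType disp) (g : T -> 'rV[R]_d -> R) c : tame g ->
  forall t, integral_Rd (fun x => c * g t x) = c * integral_Rd (g t).
Proof.
elim: d disp T g => [//|d IHd] disp T g tg t /=.
rewrite -RintegralZl//; last exact: tame_section_integrable.
by apply: eq_Rintegral => x _; exact: (IHd _ _ _ (tame_slice tg) (t, x)).
Qed.

Lemma integral_Rd_box d (a b : 'I_d -> R) : (forall i, a i < b i) ->
  integral_Rd (fun x : 'rV[R]_d => \prod_i \1_(`[a i, b i]%classic) (x 0 i)) = \prod_i (b i - a i).
Proof.
elim: d a b => [|d IHd] a b ab /=; first by rewrite !big_ord0.
have E (x : R) : integral_Rd (fun y : 'rV[R]_d => \prod_i \1_(`[a i, b i]%classic) ((row_mx x%:M y : 'rV[R]_d.+1) 0 i))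
    = \1_(`[a 0, b 0]%classic) x * \prod_i (b (lift 0 i) - a (lift 0 i)).
  have [xab|xab] := boolP (x \in `[a 0, b 0]%classic); rewrite indicE ?xab ?(negbTE xab) ?mul0r ?mul1r.
    rewrite -IHd//; congr integral_Rd; apply/funext => y.
    rewrite big_ord_recl row_mx_0 indicE xab mul1r; apply: eq_bigr => i _; by rewrite row_mx_lift.
  apply: integral_Rd0 => y; by rewrite big_ord_recl row_mx_0 indicE (negbTE xab) mul0r.
under eq_Rintegral do rewrite E mulrC.
rewrite RintegralZl//; last first.
  rewrite (_ : _ \o _ = EFin \o \1_(`[a 0, b 0]%classic))//.
  apply: integrable_indic_itv.
rewrite big_ord_recl mulrC; congr (_ * _).
rewrite /Rintegral integral_indic// setIT /= lebesgue_measure_itv /= lte_fin ab//.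
Qed.

(** [kappa] records the cell indices of coordinates already moved into the parameter. As sequences
    of integers are countable, measurability of each fibre suffices for an arbitrary F. *)
Lemma jointly_measurable_cells d disp (T : measurableType disp) (kappa : T -> seq int) (F : seq int -> R) (c : R) :
  (forall s, measurable (kappa @^-1` [set s])) ->
  jointly_measurable (fun t (x : 'rV[R]_d) => F (kappa t ++ [seq Num.floor (c * x 0 i) | i <- enum 'I_d])).
Proof.
elim: d disp T kappa => [|d IHd] disp T kappa mk.
  rewrite /= => _ B mB; rewrite setTI.
  rewrite (_ : _ @^-1` _ = \bigcup_(s in [set s : seq int | B (F s)]) kappa @^-1` [set s]).
    rewrite bigcup_mkcond; apply: countable_bigcupT_measurable => [|s]; first exact: countableP.
    by case: ifP.
  apply/seteqP; split => [t|t [s /= Bs ks]]; rewrite /= enum_ord0 cats0 ?ks//.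
  by exists (kappa t).
rewrite /=.
have mk' (s : seq int) : measurable ((fun tx : T * measurableTypeR R =>
    rcons (kappa tx.1) (Num.floor (c * tx.2))) @^-1` [set s]).
  case: (lastP s) => [|s' z].
    by rewrite (_ : _ @^-1` _ = set0)//; apply/seteqP; split => // -[t x] /=; case: (kappa t).
  rewrite (_ : _ @^-1` _ = (kappa @^-1` [set s']) `*` ((fun x : measurableTypeR R => Num.floor (c * x)) @^-1` [set z])).
    apply: measurableX; first exact: mk.
    rewrite (_ : _ @^-1` _ = (fun x : measurableTypeR R => c * x) @^-1` `[z%:~R, (z + 1)%:~R[).
      rewrite -[X in measurable X]setTI; apply: (measurable_funM (f := cst c)) => //.
    apply/seteqP; split => x /=; rewrite in_itv /=.
      by move=> <-; rewrite floor_le_tmp //= floorD1_gt.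
    by move=> h; apply: floor_def.
  apply/seteqP; split => -[t x] /=; first by move=> /rcons_inj[-> ->].
  by move=> [-> ->].
have := IHd _ _ (fun tx : T * measurableTypeR R => rcons (kappa tx.1) (Num.floor (c * tx.2))) mk'.
congr jointly_measurable; apply/funext => -[t x]; apply/funext => y; congr F.
rewrite enum_ordSl /= cat_rcons row_mx_0; congr (_ ++ _ :: _).
by rewrite -map_comp; apply: eq_map => i /=; rewrite row_mx_lift.
Qed.

Lemma jointly_measurable_cvg d disp (T : measurableType disp) (g : nat -> T -> 'rV[R]_d -> R) h :
  (forall n, jointly_measurable (g n)) -> (forall t x, (fun n => g n t x) @ \oo --> h t x) ->
  jointly_measurable h.
Proof.
elim: d disp T g h => [|d IHd] disp T g h mg gh.
  by apply: (measurable_fun_cvg (h := fun n t => g n t 0)) => // t _; exact: gh.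
apply: (IHd _ (T * measurableTypeR R)%type
  (fun n (tx : T * measurableTypeR R) (y : 'rV[R]_d) => g n tx.1 (row_mx tx.2%:M y))
  (fun (tx : T * measurableTypeR R) (y : 'rV[R]_d) => h tx.1 (row_mx tx.2%:M y))).
  by move=> n; exact: mg.
by move=> t x; exact: gh.
Qed.

Lemma jointly_measurableM d disp (T : measurableType disp) (g h : T -> 'rV[R]_d -> R) :
  jointly_measurable g -> jointly_measurable h -> jointly_measurable (fun t x => g t x * h t x).
Proof.
elim: d disp T g h => [|d IHd] disp T g h mg mh; first exact: measurable_funM.
exact: (IHd _ _ _ _ mg mh).
Qed.

Lemma jointly_measurable_base d disp (T : measurableType disp) (g : T -> R) :
  measurable_fun setT g -> jointly_measurable (fun t (x : 'rV[R]_d) => g t).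
Proof.
elim: d disp T g => [|d IHd] disp T g mg //.
apply: (IHd _ (T * measurableTypeR R)%type (fun tx : T * measurableTypeR R => g tx.1)).
exact: measurableT_comp.
Qed.

Lemma jointly_measurable_coord d disp (T : measurableType disp) i :
  jointly_measurable (fun (t : T) (x : 'rV[R]_d) => x 0 i).
Proof.
elim: d disp T i => [|d IHd] disp T i; first by case: i.
case: (unliftP 0 i) => [j|] ->.
  rewrite /=; have := IHd _ (T * measurableTypeR R)%type j; congr jointly_measurable.
  by apply/funext => -[t x]; apply/funext => y; rewrite row_mx_lift.
have := @jointly_measurable_base d _ (T * measurableTypeR R)%type snd (measurable_snd).
by congr jointly_measurable; apply/funext => -[t x]; apply/funext => y; rewrite row_mx_0.
Qed.

(** The indicator of a closed set is the pointwise limit of those of the unions of grid cells of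
    side 1 / (n+1) that meet the set. *)
Lemma jointly_measurable_indic d disp (T : measurableType disp) (A : set 'rV[R]_d) :
  closed A -> jointly_measurable (fun (t : T) => \1_A : 'rV[R]_d -> R).
Proof.
move=> cA; pose cells n (x : 'rV[R]_d) := [seq Num.floor (n.+1%:R * x 0 i) | i <- enum 'I_d].
pose F n (s : seq int) : R := if `[< exists2 a, A a & s = cells n a >] then 1 else 0.
apply: (jointly_measurable_cvg (g := fun n t x => F n (cells n x))).
  move=> n; apply: (@jointly_measurable_cells d _ T (fun=> [::]) (F n) n.+1%:R) => s.
  by have [->|s0] := eqVneq s [::]; [rewrite (_ : _ @^-1` _ = setT) //; apply/seteqP; split
    | rewrite (_ : _ @^-1` _ = set0) //; apply/seteqP; split => // t /= e; rewrite -e eqxx in s0].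
move=> _ x; apply: cvg_near_cst; have [Ax|nAx] := pselect (A x).
  by apply: nearW => n; rewrite /F asboolT ?indicE ?mem_set//; exists x.
have : (~` A)^° x by have := closed_openC cA; rewrite openE => /(_ x nAx).
move=> /interior_cballP[e e0 eA].
near=> n; rewrite indicE memNset// /F asboolF// => -[a Aa] xa.
apply: (eA a) => //; rewrite /cball /=.
apply: (@le_trans _ _ (d%:R * n.+1%:R^-1)).
  apply: enorm_le_sup => [|i]; first by rewrite invr_ge0.
  have /eq_in_map/(_ i) := xa; rewrite mem_enum => /(_ isT) fl.
  have n0 : 0 < n.+1%:R :> R by [].
  have := floor_itv (n.+1%:R * x 0 i); have := floor_itv (n.+1%:R * a 0 i).
  rewrite -fl intrD => /andP[h1 h2] /andP[h3 h4]; rewrite !mxE.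
  rewrite -[leRHS]mulr1 ler_pdivlMl// -[X in X * _](gtr0_norm n0) -normrM mulrBr ler_norml; lra.
rewrite ler_pdivrMr// mulrC -ler_pdivrMr// ltW//.
near: n; exists (Num.truncn (d%:R / e)) => // n /= h.
by rewrite (lt_le_trans (truncnS_gt _))// ler_nat ltnS.
Unshelve. all: by end_near.
Qed.

(** Integrating a i - h <= y i <= a i + h over A bounds the i-th moment; the ball contained in A
    makes the integral of its indicator positive, which permits the division. *)
Lemma barycenter_in_box d (A : set 'rV[R]_d) (a : 'rV[R]_d) (h r : R) (x : 'rV[R]_d) : closed A ->
  (forall y, A y -> forall i, `|y 0 i - a 0 i| <= h) -> 0 < r -> cball x r `<=` A ->
  forall i, `|barycenter A 0 i - a 0 i| <= h.
Proof.
move=> cA Ah r0 xA i.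
have x_in : A x by apply: xA; rewrite /cball/= subrr enorm0 ltW.
have h0 : 0 <= h by apply: le_trans (Ah x x_in i).
pose H : R := \sum_j (`|a 0 j| + h).
have Hj (y : 'rV[R]_d) j : A y -> `|y 0 j| <= H.
  move=> Ay; have := Ah y Ay j; rewrite /H (bigD1 j)//= => k.
  have : 0 <= \sum_(j0 | j0 != j) (`|a 0 j0| + h) by apply: sumr_ge0 => l _; rewrite addr_ge0.
  have := ler_normD (y 0 j - a 0 j) (a 0 j); rewrite subrK; lra.
have H0 : 0 <= H by apply: sumr_ge0 => j _; rewrite addr_ge0.
have vanish (y : 'rV[R]_d) j : H < `|y 0 j| -> (\1_A : _ -> R) y = 0.
  move=> Hy; rewrite indicE memNset// => /Hj yH; have := yH j; rewrite leNgt Hy//.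
have t1 : tame (fun _ : measurableTypeR R => \1_A : 'rV[R]_d -> R).
  split; first exact: jointly_measurable_indic.
  exists 1, H; split => //.
  by move=> _ y; rewrite indicE normr_nat lern1; case: (y \in A).
have tx : tame (fun (_ : measurableTypeR R) (y : 'rV[R]_d) => y 0 i * \1_A y).
  split; first by apply: jointly_measurableM; [exact: jointly_measurable_coord|exact: jointly_measurable_indic].
  exists H, H; split => //; last by move=> _ y j Hy; rewrite (vanish y j)// mulr0.
  by move=> _ y; rewrite indicE; have [/set_mem/Hj|_] := boolP (y \in A); rewrite ?mulr1// mulr0 normr0.
have tZ c g : tame g -> tame (fun (t : measurableTypeR R) (y : 'rV[R]_d) => c * g t y).
  move=> [mg [B [H' [B0 H'0 gB gH]]]]; split.
    by apply: (jointly_measurableM (g := fun _ _ => c)) => //; apply: (@jointly_measurable_base d _ (measurableTypeR R) (fun=> c)).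
  exists (`|c| * B), H'; split => //; first by rewrite mulr_ge0.
    by move=> t y; rewrite normrM ler_wpM2l.
  by move=> t y j Hy; rewrite (gH t y j)// mulr0.
set v := integral_Rd (\1_A : 'rV[R]_d -> R).
have v0 : 0 < v.
  (* A cube of half-side e fits in the ball because d e <= r, and its integral is computed
     explicitly. *)
  pose e := r / (d%:R + 1); have d0 : 0 < d%:R + 1 :> R by rewrite ltr_wpDl.
  have e0 : 0 < e by rewrite divr_gt0.
  pose Q := [set y : 'rV[R]_d | forall j, y 0 j \in `[x 0 j - e, x 0 j + e]].
  have QA : Q `<=` A.
    move=> y Qy; apply: xA; rewrite /cball /=; apply: (@le_trans _ _ (d%:R * e)).
      apply: enorm_le_sup => [|j]; first exact: ltW.
      by have := Qy j; rewrite in_itv /= !mxE ler_norml => /andP[]; lra.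
    rewrite /e mulrA ler_pdivrMr// mulrC ler_wpM2l ?(ltW r0)//; lra.
  have QE : (fun y : 'rV[R]_d => \prod_j \1_(`[x 0 j - e, x 0 j + e]%classic) (y 0 j)) = (\1_Q : _ -> R).
    apply/funext => y; rewrite [RHS]indicE; have [/set_mem Qy|/negP nQ] := boolP (y \in Q).
      by rewrite big1// => j _; rewrite indicE mem_set//=; exact: Qy.
    have [j nj] : exists j, y 0 j \notin `[x 0 j - e, x 0 j + e].
      apply: contrapT => hn; apply: nQ; apply: mem_set => j; apply: contrapT => /negP hj.
      by apply: hn; exists j.
    by rewrite (bigD1 j)//= indicE memNset ?mul0r//; exact/negP.
  have cQ : closed Q.
    rewrite (_ : Q = \bigcap_j (fun y : 'rV[R]_d => y 0 j) @^-1` [set` `[x 0 j - e, x 0 j + e]]).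
      apply: closed_bigI => j _; apply: closed_comp; last exact: itv_closed.
      by move=> y _; exact: coord_continuous.
    by apply/seteqP; split => y Qy j => [_|]; exact: Qy.
  have tQ : tame (fun _ : measurableTypeR R => \1_Q : 'rV[R]_d -> R).
    split; first exact: jointly_measurable_indic.
    exists 1, H; split => //.
      by move=> _ y; rewrite indicE normr_nat lern1; case: (y \in Q).
    by move=> _ y j Hy; rewrite indicE memNset// => /QA /Hj yH; have := yH j; rewrite leNgt Hy.
  have hle : integral_Rd (\1_Q : 'rV[R]_d -> R) <= v.
    apply: (integral_Rd_le tQ t1 _ 0) => _ y.
    rewrite !indicE; have [/set_mem/QA/mem_set ->//|_] := boolP (y \in Q).
    by case: (y \in A).
  apply: lt_le_trans hle; rewrite -QE integral_Rd_box => [|j]; last by lra.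
  by apply: prodr_gt0 => j _; lra.
have key c : integral_Rd (fun y : 'rV[R]_d => c * \1_A y) = c * v.
  exact: (integral_RdZ c t1 0).
rewrite /barycenter !mxE -/v.
have lo : (a 0 i - h) * v <= integral_Rd (fun y : 'rV[R]_d => y 0 i * \1_A y).
  rewrite -key; apply: (integral_Rd_le (tZ (a 0 i - h) _ t1) tx _ 0) => _ y.
  rewrite indicE; have [/set_mem/Ah/(_ i)|_] := boolP (y \in A); rewrite ?mulr0// !mulr1 ler_norml; lra.
have hi : integral_Rd (fun y : 'rV[R]_d => y 0 i * \1_A y) <= (a 0 i + h) * v.
  rewrite -key; apply: (integral_Rd_le tx (tZ (a 0 i + h) _ t1) _ 0) => _ y.
  rewrite indicE; have [/set_mem/Ah/(_ i)|_] := boolP (y \in A); rewrite ?mulr0// !mulr1 ler_norml; lra.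
set I := integral_Rd _ in lo hi *.
have lo' : a 0 i - h <= I / v by rewrite ler_pdivlMr.
have hi' : I / v <= a 0 i + h by rewrite ler_pdivrMr.
rewrite mulrC ler_norml; lra.
Qed.

End IteratedIntegral.

(** * The hierarchy of a substitution *)

HB.instance Definition _ (R : realType) d (C : Type) := gen_eqMixin (ctile R d C).
HB.instance Definition _ (R : realType) d (C : Type) := gen_choiceMixin (ctile R d C).

Lemma uniq_map_inj (T U : eqType) (f : T -> U) (l : seq T) : uniq (map f l) -> {in l &, injective f}.
Proof.
elim: l => //= x l IH /andP[xl /IH{}IH] y z; rewrite !inE.
move=> /orP[/eqP->|yl] /orP[/eqP->|zl] //; last exact: IH.
  by move=> fxz; rewrite fxz map_f in xl.
by move=> fyx; rewrite -fyx map_f in xl.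
Qed.

Section Hierarchy.
Variables (R : realType) (d : nat) (C : Type).
Local Notation V := 'rV[R]_d.
Variables (E : set (V -> V)) (k : nat) (P : 'I_k -> ctile R d C).
Variables (lambda : R) (S : 'I_k -> set (ctile R d C)).
Variables (n : nat) (ty : 'I_k -> 'I_n) (M : 'M[nat]_n).
Hypotheses (hE : isometry_group E) (hP : forall i, is_tile (P i)).
Hypothesis (hS : substitution_rule E P lambda S).
Hypotheses (hty : type_numbering P lambda S ty) (hM : substitution_matrix E P S ty M).

Lemma lambda_gt1 : 1 < lambda. Proof. by case: hS. Qed.
Lemma lambda_gt0 : 0 < lambda. Proof. exact: lt_trans lambda_gt1. Qed.
Lemma lambda_neq0 : lambda != 0. Proof. by rewrite gt_eqF// lambda_gt0. Qed.

Lemma E_isometry O : E O -> isometry O. Proof. by case: hE => h _ _ _; exact: h. Qed.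

Lemma E_id : E id.
Proof.
case: hE => _ h _ _; have := h 0; congr E; by apply/funext => x; rewrite addr0.
Qed.

Lemma E_rescale O : E O -> E (rescale lambda O).
Proof.
move=> EO; have := rescaleE (E_isometry EO) lambda_neq0; case: hE => _ ht hc _ h.
rewrite (_ : rescale lambda O = (fun x => x + (lambda - 1) *: O 0) \o O); first exact: hc.
by apply/funext => x; rewrite h.
Qed.

Lemma rescale_comp (O O' : V -> V) : rescale lambda (O \o O') = rescale lambda O \o rescale lambda O'.
Proof.
by apply/funext => x; rewrite /rescale /= scalerA mulVf ?scale1r// lambda_neq0.
Qed.

Lemma rescale_id (O : V -> V) : O =1 id -> rescale lambda O = id.
Proof.
by move=> h; apply/funext => x; rewrite /rescale h scalerA divff ?scale1r// lambda_neq0.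
Qed.

Lemma map_tile_comp (f g : V -> V) (t : ctile R d C) : map_tile (f \o g) t = map_tile f (map_tile g t).
Proof. by rewrite /map_tile /= image_comp. Qed.

Lemma map_tile_id (f : V -> V) (t : ctile R d C) : f =1 id -> map_tile f t = t.
Proof.
move=> h; rewrite /map_tile (_ : f = id); last exact/funext.
by rewrite image_id; case: t.
Qed.

(** If f (p_i) = f' (p_j), the inverse of f' composed with f carries p_i to p_j, and the last clause
    of [substitution_rule] shows that its rescaling carries S_i to S_j. *)
Lemma ecopy_type i j q : ecopy E (P i) q -> ecopy E (P j) q -> ty i = ty j.
Proof.
case: hS => _ _ _ hwd; case: (hE) => _ _ _ hinv; case: hty => _ hst.
move=> [f Ef ->] [f' Ef' eq]; apply/hst.
have [g [Eg gK Kg]] := hinv _ Ef'.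
exists (g \o f); split.
- by move=> x y; rewrite /= (E_isometry Eg) (E_isometry Ef).
- by rewrite map_tile_comp eq -map_tile_comp map_tile_id.
- have rg : rescale lambda g \o rescale lambda f' = id.
    by rewrite -rescale_comp rescale_id.
  have -> : map_tile (rescale lambda (g \o f)) @` S i =
      map_tile (rescale lambda g) @` (map_tile (rescale lambda f) @` S i).
    rewrite image_comp; congr (_ @` _); apply/funext => t /=.
    by rewrite rescale_comp map_tile_comp.
  rewrite (hwd i j f f' Ef Ef' eq) image_comp.
  rewrite -[RHS]image_id; congr (_ @` _); apply/funext => t /=.
  by rewrite -map_tile_comp map_tile_id// => x; rewrite rg.
Qed.

(* (i, O) presents the tile O(p_i); a tile can have several presentations. *)
Definition pres : Type := ('I_k * (V -> V))%type.
HB.instance Definition _ := Equality.on pres.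
Implicit Types (p q r : pres) (l : seq pres) (A B : set V).

Definition tile_of p : ctile R d C := map_tile p.2 (P p.1).
Definition supp p : set V := p.2 @` (P p.1).1.
Definition type_of p : 'I_n := ty p.1.
Definition good p := E p.2.

Lemma supp_tile p q : tile_of p = tile_of q -> supp p = supp q.
Proof. by move=> /(congr1 fst). Qed.

(** A tiling is countable by definition; finiteness of S_i comes from the matrix, which counts its
    tiles of each of the n types. *)
Lemma S_finite i : finite_set (S i).
Proof.
have -> : S i = \bigcup_(b in [set: 'I_n]) [set q | S i q /\ has_type E P ty q b].
  apply/seteqP; split => [q Siq|q [b _ []]//].
  case: hS => _ _ hgen _; have [j hj] := hgen i q Siq.
  by exists (ty j) => //; split => //; exists j.
apply: bigcup_finite; first exact: finite_finset.
move=> b _; apply/finite_setP; exists (M (ty i) b); exact: hM.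
Qed.

(** Choosing one presentation for every tile of S_i turns the subdivision into a finite list, over
    which sums can be taken. *)
Lemma children_exist i : exists l, [/\
  forall q, q \in l -> good q /\ S i (tile_of q),
  forall t, S i t -> exists2 q, q \in l & tile_of q = t,
  uniq (map tile_of l) &
  forall b, count (fun q => type_of q == b) l = M (ty i) b].
Proof.
case: (hS) => _ _ hgen _.
have [pr prP] : {pr : ctile R d C -> pres & forall t, S i t -> good (pr t) /\ tile_of (pr t) = t}.
  have h t : exists p : pres, S i t -> good p /\ tile_of p = t.
    have [St|nSt] := pselect (S i t); last by exists (i, id).
    by have [j [f Ef e]] := hgen i t St; exists (j, f).
  by exists (fun t => projT1 (cid (h t))) => t; exact: projT2 (cid (h t)).
pose s := enum_fset (fset_set (S i)).
have sS t : (t \in s) = (t \in S i) by rewrite -in_fset_set//; exact: S_finite.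
have mapE : map tile_of (map pr s) = s.
  rewrite -map_comp -[RHS]map_id; apply/eq_in_map => t; rewrite sS => /set_mem/prP[_].
  by [].
exists (map pr s); split.
- by move=> _ /mapP[t + ->]; rewrite sS => /set_mem St; have [h1 h2] := prP t St; rewrite h2.
- move=> t St; have [h1 h2] := prP t St; exists (pr t) => //; apply: map_f.
  by rewrite sS; exact: mem_set.
- by rewrite mapE fset_uniq.
move=> b; rewrite count_map -size_filter -(card_fset_set (hM i b)).
have fin : finite_set [set q | S i q /\ has_type E P ty q b].
  by apply/finite_setP; exists (M (ty i) b); exact: hM.
apply: perm_size; apply: uniq_perm; [exact/filter_uniq/fset_uniq|exact: fset_uniq|].
move=> t; rewrite mem_filter sS /=; apply/andP/idP => [[tb /set_mem St]|].
  rewrite in_fset_set// mem_set//; split=> //; have [h1 h2] := prP t St.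
  by exists (pr t).1; [exact/eqP | exists (pr t).2].
rewrite in_fset_set// => /set_mem [St [j jb je]]; split; last exact: mem_set.
have [h1 h2] := prP t St; apply/eqP; rewrite -jb /=; apply: (@ecopy_type _ _ t) => //.
by exists (pr t).2.
Qed.
Definition prototile_children i : seq pres := projT1 (cid (children_exist i)).

Lemma prototile_childrenP i : [/\
  forall q, q \in prototile_children i -> good q /\ S i (tile_of q),
  forall t, S i t -> exists2 q, q \in prototile_children i & tile_of q = t,
  uniq (map tile_of (prototile_children i)) &
  forall b, count (fun q => type_of q == b) (prototile_children i) = M (ty i) b].
Proof. exact: projT2 (cid (children_exist i)). Qed.

Definition move_pres (f : V -> V) q : pres := (q.1, f \o q.2).
Definition children p : seq pres := map (move_pres (rescale lambda p.2)) (prototile_children p.1).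
Definition descend l : seq pres := flatten (map children l).
Definition descendants m l : seq pres := iter m descend l.

Lemma tile_of_move f q : tile_of (move_pres f q) = map_tile f (tile_of q).
Proof. exact: map_tile_comp. Qed.

Lemma supp_move f q : supp (move_pres f q) = f @` supp q.
Proof. by rewrite /supp image_comp. Qed.

Lemma children_good p q : good p -> q \in children p -> good q.
Proof.
move=> gp /mapP[r rp ->]; case: hE => _ _ hc _; apply: hc; first exact: E_rescale.
by have [h _ _ _] := prototile_childrenP p.1; have [] := h r rp.
Qed.

Lemma good_isometry p : good p -> isometry p.2.
Proof. exact: E_isometry. Qed.

Lemma supp_scal p : scal lambda (supp p) = rescale lambda p.2 @` [set lambda *: x | x in (P p.1).1].
Proof. by rewrite /supp scal_image// lambda_neq0. Qed.

Lemma supp_children p : scal lambda (supp p) = seqU (children p) supp.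
Proof.
rewrite supp_scal; have [h1 h2 _ _] := prototile_childrenP p.1.
case: hS => _ /(_ p.1)[_ hin hcov _] _ _.
apply/seteqP; split => [_ [x xP <-]|x [q /mapP[r rp ->]]].
  have [t St tx] := hcov x xP; have [r rp rt] := h2 t St.
  exists (move_pres (rescale lambda p.2) r); first exact: map_f.
  by rewrite supp_move; exists x => //; move: tx; rewrite -rt.
rewrite supp_move => -[y ry <-]; have [_ St] := h1 r rp.
by exists y => //; have [_ hsub] := hin _ St; exact: hsub.
Qed.

Lemma child_sub p q : q \in children p -> supp q `<=` scal lambda (supp p).
Proof. by move=> qp x qx; rewrite supp_children; exists q. Qed.

Lemma image_interior (f : V -> V) A : isometry f -> interior (f @` A) = f @` interior A.
Proof.
move=> fi; have [g [gi fg gf]] := isometry_inverse fi.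
apply/seteqP; split => [x /interior_cballP[e e0 eA]|_ [x /interior_cballP[e e0 eA] <-]].
  exists (g x) => //; apply/interior_cballP; exists e => // y yx.
  have [|a Aa fa] := eA (f y); first by rewrite /cball/= -{1}(gf x) fi.
  by rewrite -(fg y) -fa fg.
apply/interior_cballP; exists e => // y yx; exists (g y) => //; apply: eA.
by rewrite /cball/= -fi gf.
Qed.

Lemma image_int_disjoint (f : V -> V) A B : isometry f -> int_disjoint A B -> int_disjoint (f @` A) (f @` B).
Proof.
move=> fi AB; rewrite /int_disjoint !image_interior//.
apply/seteqP; split => // _ [[x Ax <-] [y By yx]].
have [g [gi fg gf]] := isometry_inverse fi.
have xy : y = x by rewrite -(fg y) yx fg.
have : (interior A `&` interior B) x by split; rewrite -?xy//; move: Ax; rewrite xy.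
by rewrite AB.
Qed.

Lemma scal_interior_sub (s : R) A : 0 < s -> scal s (interior A) `<=` interior (scal s A).
Proof.
move=> s0 _ [x /interior_cballP[e e0 eA] <-]; apply/interior_cballP.
exists (s * e); first exact: mulr_gt0.
move=> y yx; exists (s^-1 *: y); last by rewrite scalerA divff ?scale1r// gt_eqF.
apply: eA; rewrite /cball/=.
have -> : s^-1 *: y - x = s^-1 *: (y - s *: x) by rewrite scalerBr scalerA mulVf ?scale1r// gt_eqF.
by rewrite enormZ gtr0_norm ?invr_gt0// ler_pdivrMl.
Qed.

Lemma scal_interior (s : R) A : 0 < s -> interior (scal s A) = scal s (interior A).
Proof.
move=> s0; apply/seteqP; split; last exact: scal_interior_sub.
move=> x xA; have sV0 : 0 < s^-1 by rewrite invr_gt0.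
have := @scal_interior_sub s^-1 (scal s A) sV0.
rewrite scal_scal mulVf ?gt_eqF// => h.
exists (s^-1 *: x); last by rewrite scalerA divff ?scale1r// gt_eqF.
have : interior (scal 1 A) (s^-1 *: x) by apply: h; exists x.
by rewrite (_ : scal 1 A = A)//; apply/seteqP; split => [_ [y Ay <-]|y Ay]; [rewrite scale1r | exists y; rewrite ?scale1r].
Qed.

Lemma int_disjoint_sub A A' B B' : A `<=` A' -> B `<=` B' -> int_disjoint A' B' -> int_disjoint A B.
Proof.
move=> AA BB d'; apply/seteqP; split => // x [xA xB].
by have : (interior A' `&` interior B') x; [split; [exact: (interiorS AA)|exact: (interiorS BB)] | rewrite d'].
Qed.

Lemma scal_int_disjoint (s : R) A B : 0 < s -> int_disjoint A B -> int_disjoint (scal s A) (scal s B).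
Proof.
move=> s0 AB; rewrite /int_disjoint !scal_interior//; apply/seteqP; split => // _ [[x Ax <-] [y By yx]].
have xy : y = x.
  by have := congr1 (fun z => s^-1 *: z) yx; rewrite !scalerA mulVf ?gt_eqF// !scale1r.
by have : (interior A `&` interior B) x; [split; rewrite -?xy//; move: Ax; rewrite xy | rewrite AB].
Qed.

Lemma children_disjoint p q r : good p -> q \in children p -> r \in children p -> q != r ->
  int_disjoint (supp q) (supp r).
Proof.
move=> gp /mapP[q' q'p ->] /mapP[r' r'p ->] qr; rewrite !supp_move.
apply: image_int_disjoint; first by apply: rescale_isometry; [exact: good_isometry|exact: lambda_neq0].
have [h1 h2 h3 _] := prototile_childrenP p.1.
case: hS => _ /(_ p.1)[_ _ _ hdis] _ _.
apply: (hdis (tile_of q') (tile_of r')); [by have [] := h1 q' q'p|by have [] := h1 r' r'p|].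
move=> e; move/negP: qr; apply; apply/eqP; congr move_pres.
exact: (uniq_map_inj h3).
Qed.

Variables (center : 'I_k -> V) (eps : R).
Hypotheses (eps0 : 0 < eps) (hcenter : forall i, cball (center i) eps `<=` (P i).1).

Definition pcenter p : V := p.2 (center p.1).

Lemma supp_ball p : good p -> cball (pcenter p) eps `<=` supp p.
Proof.
move=> gp y yc; have [g [gi fg gf]] := isometry_inverse (good_isometry gp).
exists (g y) => //; apply: hcenter; rewrite /cball/= -(good_isometry gp) gf; exact: yc.
Qed.

Lemma supp_interior p : good p -> interior (supp p) (pcenter p).
Proof. by move=> gp; apply/interior_cballP; exists eps => //; exact: supp_ball. Qed.

Lemma int_disjoint_neq p q : good p -> int_disjoint (supp p) (supp q) -> tile_of p != tile_of q.
Proof.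
move=> gp pq; apply/eqP => e.
have : (interior (supp p) `&` interior (supp q)) (pcenter p).
  by rewrite -(supp_tile e); split; exact: supp_interior.
by rewrite pq.
Qed.

(** Distinct presentations have disjoint interiors, and supports have interior points; so no tile is
    presented twice and counting presentations counts tiles. *)
Definition packing l :=
  [/\ uniq l, forall p, p \in l -> good p &
      forall p q, p \in l -> q \in l -> p != q -> int_disjoint (supp p) (supp q)].

Lemma move_pres_inj (f g : V -> V) : cancel f g -> injective (move_pres f).
Proof.
move=> fg [i a] [j b] [-> ab]; congr pair; apply/funext => x.
by rewrite -(fg (a x)) -(fg (b x)); congr g; exact: (congr1 (fun h => h x) ab).
Qed.

Lemma children_uniq p : good p -> uniq (children p).
Proof.
move=> gp; have [_ _ h3 _] := prototile_childrenP p.1.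
have [g [_ fg _]] := isometry_inverse (rescale_isometry (good_isometry gp) lambda_neq0).
by rewrite map_inj_uniq ?(map_uniq h3)//; exact: move_pres_inj fg.
Qed.

Lemma in_descend l q : reflect (exists2 p, p \in l & q \in children p) (q \in descend l).
Proof. exact: flatten_mapP. Qed.

Lemma descend_packing l : packing l -> packing (descend l).
Proof.
move=> [ul gl dl].
have dis p q r s : p \in l -> q \in l -> p != q -> r \in children p -> s \in children q ->
    int_disjoint (supp r) (supp s).
  move=> pl ql pq rp sq; apply: int_disjoint_sub (child_sub rp) (child_sub sq) _.
  by apply: scal_int_disjoint; [exact: lambda_gt0|exact: dl].
split.
- elim: l ul gl dl dis => //= p l IH /andP[pl ul] gl dl dis.
  rewrite /descend /= cat_uniq; apply/and3P; split.
  + by apply: children_uniq; apply: gl; rewrite mem_head.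
  + apply/hasPn => r /flatten_mapP[q ql rq]; apply/negP => /= rp.
    have gr : good r by apply: children_good rp; apply: gl; rewrite mem_head.
    have pq : p != q by apply: contraNneq pl => ->.
    have := dis p q r r (mem_head _ _) _ pq rp rq; rewrite inE ql orbT => /(_ isT).
    by move=> /(int_disjoint_neq gr); rewrite eqxx.
  + apply: IH => // [q ql|q r ql rl|q r s t ql rl].
    * by apply: gl; rewrite inE ql orbT.
    * by apply: dl; rewrite inE ?ql ?rl orbT.
    * by apply: dis; rewrite inE ?ql ?rl orbT.
- by move=> q /in_descend[p /gl gp qp]; exact: children_good qp.
- move=> q r /in_descend[p pl qp] /in_descend[p' p'l rp'] qr.
  have [pp|pp] := eqVneq p p'; last exact: dis pp qp rp'.
  by apply: children_disjoint qp _ qr; [exact: gl|rewrite pp].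
Qed.

Lemma descendants_packing m l : packing l -> packing (descendants m l).
Proof. by move=> pl; elim: m => //= m; exact: descend_packing. Qed.

Lemma descendants_good m l q : (forall p, p \in l -> good p) -> q \in descendants m l -> good q.
Proof.
move=> gl; elim: m q => [|m IH] q /=; first exact: gl.
by move=> /in_descend[p /IH gp]; exact: children_good.
Qed.

Lemma descendants_sub m l1 l2 : {subset l1 <= l2} -> {subset descendants m l1 <= descendants m l2}.
Proof.
move=> l12; elim: m => //= m IH q /in_descend[p /IH pl qp]; apply/in_descend; by exists p.
Qed.

Lemma supp_descendants m p : scal (lambda ^+ m) (supp p) = seqU (descendants m [:: p]) supp.
Proof.
elim: m => [|m IH] /=.
  rewrite expr0; apply/seteqP; split => [_ [x px <-]|x [q]].
    by exists p; rewrite ?mem_head// scale1r.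
  by rewrite inE => /eqP -> px; exists x; rewrite ?scale1r.
rewrite exprS -scal_scal IH; apply/seteqP; split => [_ [x [q qp qx] <-]|x [r /in_descend[q qp rq] rx]].
  have : scal lambda (supp q) (lambda *: x) by exists x.
  rewrite supp_children => -[r rq rx]; exists r => //; apply/in_descend; by exists q.
have [y qy yx] := child_sub rq rx.
by exists y => //; exists q.
Qed.

Lemma sum_children (f : 'I_n -> R) p :
  \sum_(q <- children p) f (type_of q) = \sum_b (M (type_of p) b)%:R * f b.
Proof.
rewrite big_map -[LHS]/(\sum_(q <- prototile_children p.1) f (type_of q)).
have [_ _ _ cnt] := prototile_childrenP p.1.
under [in RHS]eq_bigr do rewrite -[M _ _]cnt -sum1_count natr_sum mulr_suml.
rewrite (exchange_big_dep xpredT) //=; apply: eq_bigr => q _.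
by rewrite (big_pred1 (type_of q)) => [|b]; rewrite ?mul1r// eq_sym.
Qed.

Lemma sum_descend (x : 'cV[R]_n) l :
  \sum_(q <- descend l) x (type_of q) 0 = \sum_(p <- l) (real_mx R M *m x) (type_of p) 0.
Proof.
rewrite big_flatten big_map; apply: eq_bigr => p _.
by rewrite (sum_children (fun b => x b 0)) mxE; apply: eq_bigr => b _; rewrite mxE.
Qed.

Lemma sum_descendants m (x : 'cV[R]_n) l :
  \sum_(q <- descendants m l) x (type_of q) 0 =
  \sum_(p <- l) (iter m (mulmx (real_mx R M)) x) (type_of p) 0.
Proof. by elim: m x => [//|m IH] x /=; rewrite sum_descend IH -iterSr. Qed.

(** [inflate] may subdivide a tile through any of its presentations; the well-definedness clause of
    the substitution rule replaces it by the presentation found among the descendants. *)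
Lemma iter_inflate_descendant m (T0 : set (ctile R d C)) (pr : ctile R d C -> pres) t :
  (forall u, T0 u -> good (pr u) /\ tile_of (pr u) = u) ->
  iter m (inflate E P lambda S) T0 t ->
  exists u q, [/\ T0 u, q \in descendants m [:: pr u] & tile_of q = t].
Proof.
move=> prP; elim: m t => [|m IH] t /=.
  by move=> T0t; exists t, (pr t); have [_ e] := prP t T0t; rewrite mem_head.
move=> [w [i [f [Tw Ef we tS]]]]; have [u [q [T0u qu qw]]] := IH w Tw.
have gq : good q.
  by apply: descendants_good qu => p; rewrite inE => /eqP ->; have [] := prP u T0u.
case: hS => _ _ _ /(_ i q.1 f q.2 Ef gq) hwd.
rewrite hwd in tS; last by rewrite -we -qw.
have [s Ss st] := tS; have [_ /(_ s Ss)[r rq rs] _ _] := prototile_childrenP q.1.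
exists u, (move_pres (rescale lambda q.2) r); split => //.
  by apply/in_descend; exists q => //; exact: map_f.
by rewrite tile_of_move rs.
Qed.

Lemma descendant_iter_inflate m (T0 : set (ctile R d C)) l q :
  (forall p, p \in l -> good p /\ T0 (tile_of p)) -> q \in descendants m l ->
  iter m (inflate E P lambda S) T0 (tile_of q).
Proof.
move=> lT; elim: m q => [|m IH] q /=; first by move=> /lT[].
move=> /in_descend[r rl /mapP[s sr ->]]; exists (tile_of r), r.1, r.2.
have gr : good r by apply: descendants_good rl => p /lT[].
split => //; first exact: IH.
rewrite tile_of_move; have [/(_ s sr)[_ Ss] _ _ _] := prototile_childrenP r.1.
by exists (tile_of s).
Qed.

(** Finitely many tiles of an iterated inflation descend from finitely many tiles of T0, which
    reduces statements about infinite tilings to finite lists. *)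
Lemma ancestors m (T0 : set (ctile R d C)) (lt : seq (ctile R d C)) : Omega_EP E P T0 ->
  (forall t, t \in lt -> iter m (inflate E P lambda S) T0 t) ->
  exists l0, [/\ packing l0, forall p, p \in l0 -> T0 (tile_of p) &
    forall t, t \in lt -> exists2 q, q \in descendants m l0 & tile_of q = t].
Proof.
move=> [[_ _ _ hdis] hgen] ltT.
case: lt ltT => [|t0 lt] ltT; first by exists [::]; split.
(* A default value for the choice of presentations on all tiles; it exists because the list is
   nonempty. *)
have p0 : pres.
  suff : exists i : 'I_k, True by move=> /cid[i _]; exact: (i, id).
  case: m ltT => [|m] /(_ t0 (mem_head _ _)) /=.
    by move=> /hgen[i _]; exists i.
  by move=> [_ [i _]]; exists i.
have h t : exists p : pres, T0 t -> good p /\ tile_of p = t.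
  have [T0t|nT] := pselect (T0 t); last by exists p0.
  by have [j [f Ef e]] := hgen t T0t; exists (j, f).
pose pr t := projT1 (cid (h t)).
have prP t : T0 t -> good (pr t) /\ tile_of (pr t) = t by exact: (projT2 (cid (h t))).
have g t : exists u, iter m (inflate E P lambda S) T0 t ->
    T0 u /\ exists2 q, q \in descendants m [:: pr u] & tile_of q = t.
  have [it|nit] := pselect (iter m (inflate E P lambda S) T0 t); last by exists t.
  have [u [q [T0u qu qt]]] := iter_inflate_descendant prP it.
  by exists u => _; split => //; exists q.
pose anc t := projT1 (cid (g t)).
have ancP t := projT2 (cid (g t)).
pose us := undup (map anc (t0 :: lt)).
have usT u : u \in us -> T0 u.
  by rewrite mem_undup => /mapP[t /ltT it ->]; have [] := ancP t it.
exists (map pr us); split.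
- split.
  + rewrite map_inj_in_uniq ?undup_uniq// => u w /usT Tu /usT Tw e.
    by have [_ <-] := prP u Tu; have [_ <-] := prP w Tw; rewrite e.
  + by move=> _ /mapP[u /usT Tu ->]; have [] := prP u Tu.
  + move=> _ _ /mapP[u /usT Tu ->] /mapP[w /usT Tw ->] uw.
    have := hdis u w Tu Tw; have [_ eu] := prP u Tu; have [_ ew] := prP w Tw.
    rewrite -[supp (pr u)]/((tile_of (pr u)).1) -[supp (pr w)]/((tile_of (pr w)).1) eu ew.
    by apply => e; rewrite e eqxx in uw.
- by move=> _ /mapP[u /usT Tu ->]; have [_ ->] := prP u Tu.
- move=> t tl; have [Tu [q qu qt]] := ancP t (ltT t tl).
  exists q => //; apply: descendants_sub qu => p; rewrite inE => /eqP ->.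
  by apply: map_f; rewrite mem_undup; apply: map_f.
Qed.

End Hierarchy.

(** * Interior points, diameters and barycenters of tiles *)

HB.instance Definition _ (R : realType) d := Uniform_isComplete.Build 'rV[R]_d (@cauchy_cvg 'rV[R]_d).

(** If all the closed sets had empty interior, their complements would be countably many dense open
    sets, and by Baire's theorem would have a common point outside the cover. *)
Lemma countable_closed_cover (R : realType) d (T : Type) (A : set T) (f : T -> set 'rV[R]_d) :
  countable A -> (forall t, A t -> closed (f t)) -> setT `<=` \bigcup_(t in A) f t ->
  exists2 t, A t & interior (f t) !=set0.
Proof.
move=> /countable_injP[g ginj] cf cov; apply: contrapT => no.
pose F i := \bigcap_(t in [set t | A t /\ g t = i]) ~` f t.
have Fod i : open (F i) /\ dense (F i).
  have [[t [At gt]]|nt] := pselect (exists t, A t /\ g t = i); last first.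
    rewrite (_ : F i = setT); first by split; [exact: openT | move=> O + _; rewrite setIT].
    by apply/seteqP; split => // x _ t tA; exfalso; apply: nt; exists t.
  have -> : F i = ~` f t.
    apply/seteqP; split => [x /(_ t)|x fx u [Au gu]]; first exact.
    by rewrite (_ : u = t)//; apply: ginj; rewrite ?in_setE// gu.
  split; first exact/closed_openC/cf.
  move=> O [x Ox] oO; apply: contrapT => h; apply: no; exists t => //; exists x.
  rewrite /interior; have : nbhs x O by exact: open_nbhs_nbhs.
  apply: filterS => y Oy; apply: contrapT => nfy; apply: h; by exists y.
have := Baire Fod; move=> /(_ setT); case; [by exists 0|exact: openT|].
move=> x [_ hx]; have [t At fx] := cov x I; exact: (hx (g t) I t).
Qed.

Lemma closed_isometry_image (R : realType) d (f : 'rV[R]_d -> 'rV[R]_d) A : isometry f ->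
  closed A -> closed (f @` A).
Proof.
move=> fi cA; have [g [gi fg gf]] := isometry_inverse fi.
rewrite -(setCK (f @` A)); apply: open_closedC; rewrite openE => y ny.
have oA : (~` A)^° (g y).
  have := closed_openC cA; rewrite openE; apply => Ag; apply: ny.
  by exists (g y).
have [e e0 eA] := (interior_cballP _ _).1 oA.
apply/interior_cballP; exists e => // z zy [x Ax xz]; apply: (eA x) => //.
by rewrite /cball/= -fi gf xz.
Qed.

Section TileGeometry.
Variables (R : realType) (d : nat) (C : Type).
Local Notation V := 'rV[R]_d.
Variables (E : set (V -> V)) (k : nat) (P : 'I_k -> ctile R d C).
Variables (lambda : R) (S : 'I_k -> set (ctile R d C)).
Variables (n : nat) (ty : 'I_k -> 'I_n) (M : 'M[nat]_n).
Hypotheses (hE : isometry_group E) (hP : forall i, is_tile (P i)).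
Hypothesis (hS : substitution_rule E P lambda S).
Hypotheses (hty : type_numbering P lambda S ty) (hM : substitution_matrix E P S ty M).
Hypothesis (prim : primitive_mx M).

Local Notation descendants := (@descendants R d C E k P lambda S n ty M hE hS hty hM).
Local Notation type_of := (@type_of R d k n ty).
Local Notation supp := (@supp R d C k P).
Local Notation tile_of := (@tile_of R d C k P).
Local Notation good := (@good R d E k).
Local Notation pres := (@pres R d k).

Lemma iter_real_mx m (x : 'cV[R]_n) : iter m (mulmx (real_mx R M)) x = real_mx R (M ^+ m) *m x.
Proof.
elim: m => [|m IH] /=.
  rewrite expr0 (_ : real_mx R 1 = 1%:M) ?mul1mx//.
  by apply/matrixP => i j; rewrite !mxE; case: eqP.
rewrite IH exprS mulmxA; congr (_ *m _); apply/matrixP => i j; rewrite !mxE natr_sum.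
by apply: eq_bigr => l _; rewrite !mxE natrM.
Qed.

(** Summing the indicator of type b over the descendants of p gives an entry of M^m, which is
    positive for a suitable m. *)
Lemma all_types_occur : exists2 m, (0 < m)%N & forall p b, exists2 q, q \in descendants m [:: p] & type_of q = b.
Proof.
have [m m0 Mm] := prim; exists m => // p b.
have sumE := sum_descendants hE hS hty hM m (\col_a (a == b)%:R) [:: p].
have rhsE : (real_mx R (M ^+ m) *m \col_a (a == b)%:R) (type_of p) 0 = ((M ^+ m) (type_of p) b)%:R.
  rewrite mxE (bigD1 b)//= big1 => [|a /negbTE ab]; last by rewrite !mxE ab mulr0.
  by rewrite !mxE eqxx mulr1 addr0.
rewrite big_seq1 iter_real_mx rhsE in sumE.
have [/hasP[q qm /eqP qb]|no] := boolP (has (fun q => type_of q == b) (descendants m [:: p])); first by exists q.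
have : (0 < (M ^+ m) (type_of p) b)%N by [].
rewrite -(ltr_nat R) -sumE big_seq big1 ?ltxx// => q qm; rewrite mxE.
by case: eqP => // qb; move/hasPn: no => /(_ q qm); rewrite qb eqxx.
Qed.

Lemma good_id i : good (i, id). Proof. exact: E_id. Qed.

Lemma supp_id i : supp (i, id) = (P i).1.
Proof. by rewrite /supp image_id. Qed.

(* Baire's theorem yields one tile of T with interior points, and primitivity
   transports them to every prototile; invariance of domain is not needed. *)
Lemma centers_exist (T : set (ctile R d C)) : Omega_EP E P T ->
  exists (center : 'I_k -> V) (eps : R), 0 < eps /\ forall i, cball (center i) eps `<=` (P i).1.
Proof.
move=> [[cT hT cov _] gT].
have [|t Tt [x0 /interior_cballP[e e0 et]]] := @countable_closed_cover R d _ T fst cT _ cov.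
  by move=> t /hT[[]].
have [i0 [f Ef tf]] := gT t Tt.
have [g [gi fg gf]] := isometry_inverse (E_isometry hE Ef).
have ball0 : cball (g x0) e `<=` (P i0).1.
  move=> y yx; have : t.1 (f y) by apply: et; rewrite /cball/= -{1}(gf x0) (E_isometry hE Ef).
  by rewrite tf => -[z Pz fz]; move: Pz; rewrite -(fg y) -fz fg.
have [m m0 hm] := all_types_occur.
have lm0 : 0 < lambda ^+ m by apply: exprn_gt0; exact: lambda_gt0 hS.
have h i : exists c, cball c (e / lambda ^+ m) `<=` (P i).1.
  have [q qm qi0] := hm (i, id) (ty i0).
  have gq : good q.
    by apply: descendants_good qm => p; rewrite inE => /eqP ->; exact: good_id.
  (* Prototiles of the same type are related by an isometry u that may lie outside E; it still
     transports balls. *)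
  have [_ /(_ i0 q.1)[/(_ (esym qi0)) [u [ui uP _]] _]] := hty.
  have sqE : supp q = (q.2 \o u) @` (P i0).1.
    by rewrite /supp -(congr1 fst uP) /= image_comp.
  have fi : isometry (q.2 \o u) by move=> x y; rewrite /= (good_isometry hE gq) ui.
  have [w [wi fw wf]] := isometry_inverse fi.
  have ball_q : cball ((q.2 \o u) (g x0)) e `<=` supp q.
    move=> y yc; rewrite sqE; exists (w y); last exact: wf.
    by apply: ball0; rewrite /cball/= -fi wf.
  set c := (q.2 \o u) (g x0) in ball_q.
  exists ((lambda ^+ m)^-1 *: c) => y yc.
  have : scal (lambda ^+ m) (supp (i, id)) (lambda ^+ m *: y).
    rewrite (supp_descendants hE hS hty hM); exists q => //; apply: ball_q; rewrite /cball/=.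
    have -> : lambda ^+ m *: y - c = lambda ^+ m *: (y - (lambda ^+ m)^-1 *: c).
      by rewrite scalerBr scalerA divff ?scale1r// gt_eqF.
    rewrite enormZ gtr0_norm// mulrC -ler_pdivlMr//; exact: yc.
  rewrite supp_id => -[z Pz /(congr1 (fun v => (lambda ^+ m)^-1 *: v))].
  by rewrite !scalerA mulVf ?gt_eqF// !scale1r => <-.
exists (fun i => projT1 (cid (h i))), (e / lambda ^+ m); split; first exact: divr_gt0.
by move=> i; exact: (projT2 (cid (h i))).
Qed.

Lemma supp_bounded p : good p -> ebounded (supp p).
Proof.
move=> gp; apply: image_bounded; first exact: good_isometry gp.
exact: (tile_bounded (hP p.1)).
Qed.

Lemma supp_closed p : good p -> closed (supp p).
Proof.
move=> gp; apply: closed_isometry_image; first exact: good_isometry gp.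
by case: (hP p.1).
Qed.

Variables (center : 'I_k -> V) (eps : R).
Hypotheses (eps0 : 0 < eps) (hcenter : forall i, cball (center i) eps `<=` (P i).1).
Local Notation pcenter := (@pcenter R d k center).

Lemma diameter_bound : exists2 D : R, 0 < D & forall p x, good p -> supp p x -> enorm (x - pcenter p) <= D.
Proof.
have h i : exists H, forall x, (P i).1 x -> enorm x <= H by exact: tile_bounded (hP i).
pose H i := projT1 (cid (h i)); have HP i x : (P i).1 x -> enorm x <= H i by exact: (projT2 (cid (h i))).
have s0 i : 0 <= `|H i| + enorm (center i) by rewrite addr_ge0// enorm_ge0.
exists (1 + \sum_i (`|H i| + enorm (center i))).
  by rewrite ltr_pwDl// sumr_ge0.
move=> p _ gp [x px <-]; rewrite -[pcenter p]/(p.2 (center p.1)) (good_isometry hE gp).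
rewrite (bigD1 p.1)//= (le_trans (enormD _ _))// enormN.
have : 0 <= \sum_(i | i != p.1) (`|H i| + enorm (center i)) by apply: sumr_ge0.
have := HP p.1 x px; have := ler_norm (H p.1); lra.
Qed.

(** A barycenter may lie outside its tile, but it lies in every coordinate box around the tile. *)
Lemma barycenter_near : exists2 D : R, 0 < D &
  forall p, good p -> enorm (barycenter (tile_of p).1 - pcenter p) <= D.
Proof.
have [D D0 hD] := diameter_bound; exists (d%:R * D + 1).
  by rewrite ltr_wpDl// mulr_ge0// ltW.
move=> p gp; apply: (@le_trans _ _ (d%:R * D)); last by rewrite lerDl.
apply: enorm_le_sup => [|i]; first exact: ltW.
have : `|barycenter (supp p) 0 i - pcenter p 0 i| <= D.
  apply: (barycenter_in_box (supp_closed gp) _ eps0 (supp_ball hE hcenter gp)).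
  move=> y sy j; have := coord_le_enorm (y - pcenter p) j; rewrite !mxE => /le_trans; apply.
  exact: hD.
rewrite -[(tile_of p).1]/(supp p); move: (barycenter _) => b.
by rewrite !mxE.
Qed.

End TileGeometry.

(** * Volumes of the tiles *)

Section MaximumPrinciple.
Variables (R : realType) (n : nat) (M : 'M[nat]_n) (mu : R) (b : 'cV[R]_n).
Hypotheses (mu0 : 0 < mu) (prim : primitive_mx M) (b0 : forall a, 0 < b a 0)
  (Mb : forall a, (real_mx R M *m b) a 0 <= mu * b a 0).

Lemma real_mulmx_mono (x y : 'cV[R]_n) (N : 'M[nat]_n) : (forall a, x a 0 <= y a 0) ->
  forall a, (real_mx R N *m x) a 0 <= (real_mx R N *m y) a 0.
Proof. by move=> xy a; rewrite !mxE; apply: ler_sum => c _; rewrite ler_wpM2l// mxE. Qed.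

Lemma supersolution_pow m a : (real_mx R (M ^+ m) *m b) a 0 <= mu ^+ m * b a 0.
Proof.
rewrite -iter_real_mx; elim: m a => [|m IH] a /=; first by rewrite mul1r.
apply: (le_trans (real_mulmx_mono (y := mu ^+ m *: b) M _ a)); first by move=> c; rewrite mxE; exact: IH.
by rewrite -scalemxAr mxE exprS [mu * _]mulrC -mulrA ler_pM2l ?exprn_gt0.
Qed.

Lemma subsolution_pow (x : 'cV[R]_n) m a : (forall c, mu * x c 0 <= (real_mx R M *m x) c 0) ->
  mu ^+ m * x a 0 <= (real_mx R (M ^+ m) *m x) a 0.
Proof.
move=> Mx; rewrite -iter_real_mx; elim: m a => [|m IH] a /=; first by rewrite mul1r.
apply: (@le_trans _ _ ((real_mx R M *m (mu ^+ m *: x)) a 0)); last first.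
  by apply: real_mulmx_mono => c; rewrite mxE; exact: IH.
by rewrite -scalemxAr mxE exprS [mu * _]mulrC -mulrA ler_pM2l ?exprn_gt0.
Qed.

(* At an index maximizing x / b, the inequalities for a positive power of M
   are equalities, which forces x / b to be constant. *)
Lemma subsolution_proportional (x : 'cV[R]_n) : (forall a, 0 <= x a 0) ->
  (forall a, mu * x a 0 <= (real_mx R M *m x) a 0) ->
  exists2 s, 0 <= s & x = s *: b.
Proof.
move=> x0 Mx; case: (posnP n) => [n0|n0].
  exists 0 => //; apply/matrixP => a; exfalso; have := ltn_ord a; by rewrite {2}n0.
pose a1 : 'I_n := Ordinal n0.
pose a0 := [arg max_(a > a1) (x a 0 / b a 0)]%O.
have a0P a : x a 0 / b a 0 <= x a0 0 / b a0 0 by rewrite /a0; case: arg_maxP => // i _; exact.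
set s := x a0 0 / b a0 0 in a0P.
have s0 : 0 <= s by rewrite divr_ge0// ltW.
have xs a : x a 0 <= s * b a 0 by rewrite -ler_pdivrMr.
have [m _ Mm] := prim.
have : (real_mx R (M ^+ m) *m (s *: b - x)) a0 0 <= 0.
  rewrite mulmxBr -scalemxAr mxE [X in X + _]mxE [X in _ + X]mxE subr_le0.
  apply: le_trans (subsolution_pow m a0 Mx).
  have -> : x a0 0 = s * b a0 0 by rewrite /s divfK// gt_eqF.
  by rewrite mulrCA ler_wpM2l// supersolution_pow.
rewrite mxE => le0; exists s => //; apply/matrixP => a j; rewrite ord1 [RHS]mxE.
have ge0 c : 0 <= (real_mx R (M ^+ m)) a0 c * (s *: b - x) c 0.
  by apply: mulr_ge0; [rewrite mxE ler0n | rewrite !mxE subr_ge0].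
have : \sum_c (real_mx R (M ^+ m)) a0 c * (s *: b - x) c 0 = 0.
  by apply/eqP; rewrite eq_le le0 sumr_ge0.
move=> /psumr_eq0P => /(_ (fun c _ => ge0 c) a isT)/eqP.
rewrite mulf_eq0 mxE pnatr_eq0 eqn0Ngt Mm /= !mxE subr_eq0 => /eqP ->//.
Qed.

End MaximumPrinciple.

Section Volume.
Variables (R : realType) (d : nat) (C : Type).
Local Notation V := 'rV[R]_d.
Variables (E : set (V -> V)) (k : nat) (P : 'I_k -> ctile R d C).
Variables (lambda : R) (S : 'I_k -> set (ctile R d C)).
Variables (n : nat) (ty : 'I_k -> 'I_n) (M : 'M[nat]_n).
Hypotheses (hE : isometry_group E) (hP : forall i, is_tile (P i)).
Hypothesis (hS : substitution_rule E P lambda S).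
Hypotheses (hty : type_numbering P lambda S ty) (hM : substitution_matrix E P S ty M).
Hypothesis (prim : primitive_mx M).
Variables (center : 'I_k -> V) (eps : R).
Hypotheses (eps0 : 0 < eps) (hcenter : forall i, cball (center i) eps `<=` (P i).1).
Variables (L : (nat -> R) -> R) (HL : banach_limit L).

Local Notation descendants := (@descendants R d C E k P lambda S n ty M hE hS hty hM).
Local Notation type_of := (@type_of R d k n ty).
Local Notation supp := (@supp R d C k P).
Local Notation good := (@good R d E k).
Local Notation pres := (@pres R d k).
Local Notation extent := (@extent R d lambda L).
Local Notation iextent := (@iextent R d lambda L).
Local Notation lextent := (@lextent R d lambda L).
Let l1 : 1 < lambda := lambda_gt1 hS.
Let l0 : 0 < lambda := lambda_gt0 hS.

Definition representative a : 'I_k := projT1 (cid (hty.1 a)).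
Lemma representativeP a : ty (representative a) = a.
Proof. exact: projT2 (cid (hty.1 a)). Qed.

Definition type_vector (h : set V -> R) : 'cV[R]_n := \col_a h (P (representative a)).1.

Lemma type_vectorE (h : set V -> R) : (forall f A, isometry f -> ebounded A -> h (f @` A) = h A) ->
  forall p, good p -> h (supp p) = type_vector h (type_of p) 0.
Proof.
move=> hiso p gp; rewrite hiso; [|exact: good_isometry gp|exact: (tile_bounded (hP p.1))].
rewrite mxE; have [_ /(_ p.1 (representative (type_of p)))[/(_ (esym (representativeP _)))[u [ui uP _]] _]] := hty.
by rewrite -(congr1 fst uP) /= hiso//; exact: (tile_bounded (hP p.1)).
Qed.

Lemma scal_iter (h : set V -> R) : (forall A, ebounded A -> h (scal lambda A) = lambda ^+ d * h A) ->
  forall m A, ebounded A -> h (scal (lambda ^+ m) A) = (lambda ^+ d) ^+ m * h A.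
Proof.
move=> hs; elim => [|m IH] A bA.
  rewrite !expr0 mul1r (_ : scal 1 A = A)//.
  by apply/seteqP; split => [_ [y Ay <-]|y Ay]; [rewrite scale1r | exists y; rewrite ?scale1r].
by rewrite [in LHS]exprS -scal_scal hs ?IH ?mulrA -?exprS//; exact: scal_bounded.
Qed.

Local Notation mu := (lambda ^+ d).
Let mu0 : 0 < mu. Proof. exact: exprn_gt0. Qed.

Let bdesc m p q : good p -> q \in descendants m [:: p] -> good q.
Proof. by move=> gp; apply: descendants_good => r; rewrite inE => /eqP ->. Qed.

Let bsupp p : good p -> ebounded (supp p). Proof. exact: supp_bounded. Qed.

Let packing1 p : good p -> packing E P [:: p].
Proof.
move=> gp; split => // [q|q r]; first by rewrite inE => /eqP ->.
by rewrite !inE => /eqP -> /eqP ->; rewrite eqxx.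
Qed.

Let sum_type (h : set V -> R) m p :
  (forall f A, isometry f -> ebounded A -> h (f @` A) = h A) -> good p ->
  \sum_(q <- descendants m [:: p]) h (supp q) =
    (real_mx R (M ^+ m) *m type_vector h) (type_of p) 0.
Proof.
move=> hiso gp; rewrite big_seq (eq_bigr (fun q => type_vector h (type_of q) 0)); last first.
  by move=> q qp; apply: type_vectorE => //; exact: bdesc qp.
by rewrite -big_seq sum_descendants big_seq1 iter_real_mx.
Qed.

Let good_rep a : good (representative a, id). Proof. exact: E_id hE. Qed.
Let type_rep a : type_of (representative a, id) = a. Proof. exact: representativeP. Qed.

(** Exact scaling combined with subadditivity over the descendants; the inner extent satisfies the
    opposite inequality by superadditivity. *)
Lemma extent_subsolution m a : mu ^+ m * type_vector extent a 0 <= (real_mx R (M ^+ m) *m type_vector extent) a 0.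
Proof.
have ga := good_rep a; have iso := @extent_isometry R d lambda L l1.
rewrite -{1}(type_rep a) -type_vectorE//.
rewrite -(scal_iter (extent_scal l1 HL))//; last exact: bsupp.
have := sum_type m iso ga; rewrite type_rep => <-.
apply: (extent_le_sum l1 HL) => [q /(bdesc ga)|]; first exact: bsupp.
by rewrite (supp_descendants hE hS hty hM).
Qed.

(** Descendants far from the boundary of the dilated tile may be omitted from the sum; this strict
    gain is what forces the layers to vanish. *)
Lemma lextent_subsolution m a (keep : pred pres) :
  (forall q x, q \in descendants m [:: (representative a, id)] -> ~~ keep q -> supp q x ->
     cball x 1 `<=` scal (lambda ^+ m) (supp (representative a, id))) ->
  mu ^+ m * type_vector lextent a 0 <=
    \sum_(q <- descendants m [:: (representative a, id)] | keep q) lextent (supp q).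
Proof.
move=> inner; have ga := good_rep a; have iso := @lextent_isometry R d lambda L l1.
rewrite -{1}(type_rep a) -type_vectorE//.
rewrite -(scal_iter (lextent_scal l1 HL))//; last exact: bsupp.
apply: (lextent_le_sum l1 HL) => //.
- by move=> q /(bdesc ga); exact: bsupp.
- by rewrite (supp_descendants hE hS hty hM).
- by move=> q qa; rewrite (supp_descendants hE hS hty hM) => x qx; exists q.
Qed.

Lemma iextent_supersolution a : (real_mx R M *m type_vector iextent) a 0 <= mu * type_vector iextent a 0.
Proof.
have ga := good_rep a; have iso := @iextent_isometry R d lambda L l1.
rewrite -{2}(type_rep a) -type_vectorE//.
rewrite -(iextent_scal l1 HL)//; last exact: bsupp.
have := sum_type 1 iso ga; rewrite type_rep expr1 => <-.
have [ul gl dl] := descendants_packing hE hS hty hM eps0 hcenter 1 (packing1 ga).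
apply: (iextent_ge_sum l1 HL) => //.
- by apply: scal_bounded; exact: bsupp.
- by move=> q qa; rewrite -[lambda]expr1 (supp_descendants hE hS hty hM) => x qx; exists q.
Qed.

Lemma iextent_pos a : 0 < type_vector iextent a 0.
Proof.
rewrite mxE; apply: (iextent_gt0 l1 HL (x := center (representative a)) (r := eps)) => //.
exact: (tile_bounded (hP _)).
Qed.

(** The descendant containing the dilated centre has all its points within 2 D of it; for lambda^m
    eps >= 2 D + 1 their unit balls stay in the dilated inscribed ball. *)
Lemma inner_descendant : exists m, forall p, good p -> exists2 q0, q0 \in descendants m [:: p] &
  forall x, supp q0 x -> cball x 1 `<=` scal (lambda ^+ m) (supp p).
Proof.
have [D D0 hD] := diameter_bound hE hP center.
have [m hm] := pow_unbounded ((2 * D + 1) / eps) l1; exists m => p gp.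
set s := lambda ^+ m in hm; have s0 : 0 < s by exact: exprn_gt0.
have sc : scal s (supp p) (s *: pcenter center p).
  by exists (pcenter center p) => //; apply: (supp_ball hE hcenter gp); apply: cball_center; exact: ltW.
rewrite (supp_descendants hE hS hty hM) in sc; have [q0 q0p cq] := sc; exists q0 => // x qx y yx.
have gq := bdesc gp q0p.
exists (s^-1 *: y); last by rewrite scalerA divff ?scale1r// gt_eqF.
apply: (supp_ball hE hcenter gp); rewrite /cball/=.
have -> : s^-1 *: y - pcenter center p = s^-1 *: (y - s *: pcenter center p).
  by rewrite scalerBr scalerA mulVf ?scale1r// gt_eqF.
rewrite enormZ gtr0_norm ?invr_gt0// ler_pdivrMl//.
have h1 := hD q0 x gq qx; have h2 := hD q0 _ gq cq.
have h3 := enorm_triangle x y (s *: pcenter center p).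
have h4 := enorm_triangle (pcenter center q0) x (s *: pcenter center p).
rewrite (enorm_distC (pcenter center q0) (s *: _)) in h4.
move: hm; rewrite ler_pdivrMr//; move: yx; rewrite /cball/=; lra.
Qed.

(* The layers form a subsolution, hence a multiple of iextent; it is 0 because a
   descendant deep inside a tile does not meet the boundary layer. *)
Lemma lextent_zero a : type_vector lextent a 0 = 0.
Proof.
have lge c : 0 <= type_vector lextent c 0.
  by rewrite mxE; apply: (lextent_ge0 l1 HL); exact: (tile_bounded (hP _)).
have iso := @lextent_isometry R d lambda L l1.
have sub c : mu * type_vector lextent c 0 <= (real_mx R M *m type_vector lextent) c 0.
  have := @lextent_subsolution 1 c xpredT (fun q x _ => ltac:(by [])).
  by rewrite expr1 sum_type// type_rep expr1.
have [s s0 sE] := subsolution_proportional mu0 prim iextent_pos iextent_supersolution lge sub.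
have [m hm] := inner_descendant.
have [q0 q0a inner] := hm _ (good_rep a).
have h : mu ^+ m * type_vector lextent a 0 <=
    \sum_(q <- descendants m [:: (representative a, id)] | q != q0) lextent (supp q).
  by apply: lextent_subsolution => q x _; rewrite negbK => /eqP ->; exact: inner.
have gq0 := bdesc (good_rep a) q0a.
(* Omitting q0 improves the inequality by the layer of q0. With layers equal to s times the inner
   extents b and M^m b <= mu^m b, this leaves s b <= 0 at the type of q0. *)
have [ul _ _] := descendants_packing hE hS hty hM eps0 hcenter m (packing1 (good_rep a)).
have := sum_type m iso (good_rep a); rewrite type_rep (bigD1_seq q0)//= => sumE.
have {}h : mu ^+ m * type_vector lextent a 0 + lextent (supp q0) <=
    (real_mx R (M ^+ m) *m type_vector lextent) a 0.
  by rewrite -sumE addrC lerD2r.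
have h2 := supersolution_pow mu0 iextent_supersolution m a.
rewrite (type_vectorE iso gq0) sE -scalemxAr [X in _ * X + _]mxE [X in _ + X]mxE [X in _ <= X]mxE in h.
have h3 := ler_wpM2l s0 h2.
have : s * type_vector iextent (type_of q0) 0 <= 0 by lra.
rewrite pmulr_lle0 ?iextent_pos// => s00.
by rewrite sE mxE (le_anti (introT andP (conj s00 s0))) mul0r.
Qed.

Definition volume : 'cV[R]_n := type_vector extent.

Lemma extent_volume p : good p -> extent (supp p) = volume (type_of p) 0.
Proof. by move=> gp; apply: type_vectorE => // f A; exact: extent_isometry. Qed.

Lemma type_vector_extent : type_vector iextent = volume.
Proof.
apply/matrixP => a j; rewrite ord1; have := lextent_zero a; rewrite !mxE => l00.
have b := tile_bounded (hP (representative a)).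
apply/eqP; rewrite eq_le (iextent_le l1 HL b)/=.
by have := extent_le_layer l1 HL b; rewrite l00 addr0.
Qed.

Lemma iextent_volume p : good p -> iextent (supp p) = volume (type_of p) 0.
Proof.
by move=> gp; rewrite -type_vector_extent; apply: type_vectorE => // f A; exact: iextent_isometry.
Qed.

Lemma volume_gt0 a : 0 < volume a 0.
Proof. by rewrite -type_vector_extent iextent_pos. Qed.

(** With the layers gone, outer and inner extents are the same vector, which is both a subsolution
    and a supersolution. *)
Lemma volume_eigenvector : real_mx R M *m volume = mu *: volume.
Proof.
apply/matrixP => a j; rewrite ord1 [RHS]mxE; apply/eqP; rewrite eq_le; apply/andP; split.
  by have := iextent_supersolution a; rewrite type_vector_extent.
by have := extent_subsolution 1 a; rewrite !expr1.
Qed.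

End Volume.

(** * Discrepancy *)

Section LatticeAverages.
Variables (R : realType) (d : nat).
Local Notation Z := 'rV[int]_d.
Implicit Types (a b c z : Z) (L H : nat).

Definition offset L (f : {ffun 'I_d -> 'I_L}) : Z := \row_i Posz (f i).

Definition window c H : pred Z := [pred z : Z | [forall i, `|z 0 i - c 0 i| <= H%:Z]].

(** The box has cells from a to a + L - 1 in each coordinate and the window from c - H to c + H,
    whence the + 1. *)
Definition box_in c H L a := [forall i : 'I_d, (c 0 i - H%:Z <= a 0 i) && (a 0 i + L%:Z <= c 0 i + H%:Z + 1)].

Lemma offset_inj L : injective (@offset L).
Proof.
move=> f g /matrixP h; apply/ffunP => i; have := h 0 i; rewrite !mxE => -[]; exact: val_inj.
Qed.

Lemma offset_bound L (f : {ffun 'I_d -> 'I_L}) i : (0 <= offset f 0 i) && (offset f 0 i + 1 <= L%:Z).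
Proof. by rewrite mxE /= -PoszD lez_nat addn1 ltn_ord. Qed.

Lemma box_in_window c H L a f : box_in c H L a -> window c H (a + @offset L f).
Proof.
move=> /forallP h; apply/forallP => i; have := h i; rewrite mxE.
have /andP[] := offset_bound f i; move: (offset f 0 i) (a 0 i) (c 0 i) => u v w.
rewrite ler_norml; lia.
Qed.

Variables (phi : Z -> R) (Gamma : seq Z).
Hypotheses (phi01 : forall z, 0 <= phi z <= 1)
  (phiG : forall z i, phi (z + delta_mx 0 i) != phi z -> z \in Gamma).

(** Each nonzero term is at most 1 and marks a distinct point of Gamma inside the window. *)
Lemma unit_shift_sum c H L a i : box_in c H L a ->
  \sum_f `|phi (a + delta_mx 0 i + @offset L f) - phi (a + offset f)| <= (count (window c H) Gamma)%:R.
Proof.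
move=> aH; apply: (@le_trans _ _ (\sum_(f : {ffun 'I_d -> 'I_L}) (a + offset f \in Gamma)%:R)).
  apply: ler_sum => f _; have [_|nG] := boolP (_ \in Gamma).
    have := phi01 (a + delta_mx 0 i + offset f); have := phi01 (a + offset f).
    rewrite -[true%:R]/(1 : R) ler_norml; lra.
  rewrite addrAC (_ : phi (a + offset f + delta_mx 0 i) = phi (a + offset f)) ?subrr ?normr0//.
  by apply/eqP; apply: contraNT nG => /phiG.
rewrite -natr_sum ler_nat.
pose P := [pred f : {ffun 'I_d -> 'I_L} | a + offset f \in Gamma].
have -> : \sum_(f : {ffun 'I_d -> 'I_L}) (a + offset f \in Gamma : nat) = #|P| :> nat.
  by rewrite -sum1_card [RHS]big_mkcond; apply: eq_bigr => f _; rewrite inE; case: ifP.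
rewrite -size_filter cardE -(size_map (fun f => a + offset f)); apply: uniq_leq_size.
  rewrite map_inj_uniq ?enum_uniq// => f g /addrI; exact: offset_inj.
by move=> z /mapP[f]; rewrite mem_enum inE => fG ->; rewrite mem_filter box_in_window.
Qed.

Definition dist1 a b : nat := (\sum_i `|a 0%R i - b 0%R i|)%N.

(** The box is moved from a to b by unit steps towards b; every intermediate corner lies
    coordinatewise between the two, so the box never leaves the window. *)
Lemma shift_sum c H L a b : box_in c H L a -> box_in c H L b ->
  \sum_f `|phi (a + @offset L f) - phi (b + offset f)| <=
  (dist1 a b)%:R * (count (window c H) Gamma)%:R.
Proof.
move=> + bH; move En: (dist1 a b) => n; elim: n a En => [|n IH] a En aH.
  suff -> : a = b by rewrite big1 ?mul0r// => f _; rewrite subrr normr0.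
  apply/matrixP => k i; rewrite ord1; apply/eqP; rewrite -subr_eq0 -absz_eq0.
  by move/eqP: En; rewrite sum_nat_eq0 => /forallP /(_ i) /=.
have [i ni] : exists i, a 0 i != b 0 i.
  apply/existsP; apply: contra_eqT En; rewrite negb_exists => /forallP h.
  by rewrite /dist1 big1// => i _; apply/eqP; rewrite absz_eq0 subr_eq0 -[_ == _]negbK h.
pose a' := if a 0 i < b 0 i then a + delta_mx 0 i else a - delta_mx 0 i.
have a'E j : a' 0 j = a 0 j + (if j == i then (if a 0 i < b 0 i then 1 else -1) else 0).
  rewrite /a'; case: ifP => _; rewrite !mxE eqxx /=; case: eqP => _ //=; rewrite ?oppr0//.
have a'H : box_in c H L a'.
  apply/forallP => j; have /forallP/(_ j)/andP[h1 h2] := aH; have /forallP/(_ j)/andP[h3 h4] := bH.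
  rewrite a'E; case: eqP => [ji|_]; last by rewrite addr0 h1 h2.
  subst j; move: ni; case: ltP => h ni; apply/andP; lia.
have dE : dist1 a' b = n.
  rewrite /dist1 (bigD1 i)//= in En; rewrite /dist1 (bigD1 i)//=.
  have -> : (\sum_(j | j != i) `|a' 0%R j - b 0%R j| = \sum_(j | j != i) `|a 0%R j - b 0%R j|)%N.
    by apply: eq_bigr => j /negbTE ji; rewrite a'E ji addr0.
  move: En; rewrite a'E eqxx; move: (bigop _ _ _) ni => s.
  case: ltP; move: (a 0 i) (b 0 i) => u v h ni En; lia.
apply: (@le_trans _ _ (\sum_(f : {ffun 'I_d -> 'I_L}) (`|phi (a + offset f) - phi (a' + offset f)| +
   `|phi (a' + offset f) - phi (b + offset f)|))).
  by apply: ler_sum => f _; rewrite (le_trans _ (ler_normD _ _))// addrA subrK.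
rewrite big_split /= -natr1 mulrDl mul1r addrC lerD// ?IH//.
case lt : (a 0 i < b 0 i).
  have a'a : a' = a + delta_mx 0 i by rewrite /a' lt.
  by under eq_bigr do rewrite distrC; rewrite a'a; exact: unit_shift_sum.
have a'a : a' + delta_mx 0 i = a by rewrite /a' lt subrK.
by have := @unit_shift_sum c H L a' i a'H; rewrite a'a.
Qed.

Definition average L a : R := (L%:R ^+ d)^-1 * \sum_f phi (a + @offset L f).

Lemma card_offsets L : #|{ffun 'I_d -> 'I_L}| = (L ^ d)%N.
Proof. by rewrite card_ffun !card_ord. Qed.

Lemma average_mean L (x : R) : (0 < L)%N ->
  x = (L%:R ^+ d)^-1 * \sum_(f : {ffun 'I_d -> 'I_L}) x.
Proof.
move=> L0; rewrite sumr_const card_offsets -[X in _ * X]mulr_natl natrX mulrA mulVf ?mul1r//.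
by rewrite expf_neq0// pnatr_eq0 -lt0n.
Qed.

Lemma dist1_le a b H : (forall i, `|a 0 i - b 0 i| <= H%:Z) -> (dist1 a b <= d * H)%N.
Proof.
move=> h; rewrite /dist1 (leq_trans (_ : _ <= \sum_(i < d) H)%N)//; last by rewrite sum_nat_const card_ord.
by apply: leq_sum => i _; have := h i; lia.
Qed.

(* Both averages are compared with the average over the big box of the averages
   over the translates of the small box. *)
Lemma average_compare c H L L' a b : (0 < L)%N -> (L <= L')%N -> (L <= H)%N ->
  box_in c H L a -> box_in c H (L + L')%N b ->
  `|average L a - average L' b| <=
    3 * d%:R * H%:R / L%:R ^+ d * (count (window c H) Gamma)%:R.
Proof.
move=> L0 LL' LH aH bH; have L'0 : (0 < L')%N by exact: leq_trans LL'.
set K := (count _ _)%:R; have K0 : 0 <= K by exact: ler0n.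
have vL0 : 0 < L%:R ^+ d :> R by rewrite exprn_gt0// ltr0n.
have vL'0 : 0 < L'%:R ^+ d :> R by rewrite exprn_gt0// ltr0n.
(* P is the double average. Reaching it from the small box takes at most 2 d H unit steps, and from
   the large box at most d L <= d H; this is the factor 3. *)
pose P := (L%:R ^+ d)^-1 * ((L'%:R ^+ d)^-1 *
  \sum_(f : {ffun 'I_d -> 'I_L}) \sum_(g : {ffun 'I_d -> 'I_L'}) phi (b + offset g + offset f)).
have bL f : box_in c H L' (b + @offset L f).
  apply/forallP => i; have /forallP/(_ i)/andP[h1 h2] := bH.
  rewrite mxE; have := offset_bound f i.
  move: (offset f 0 i) (b 0 i) (c 0 i) h1 h2 => u v w h1 h2 /andP[h3 h4]; apply/andP; split; lia.
have bL' g : box_in c H L (b + @offset L' g).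
  apply/forallP => i; have /forallP/(_ i)/andP[h1 h2] := bH.
  rewrite mxE; have := offset_bound g i.
  move: (offset g 0 i) (b 0 i) (c 0 i) h1 h2 => u v w h1 h2 /andP[h3 h4]; apply/andP; split; lia.
have bb : box_in c H L' b.
  apply/forallP => i; have /forallP/(_ i)/andP[h1 h2] := bH.
  move: (b 0 i) (c 0 i) h1 h2 => u v h1 h2; apply/andP; split; lia.
have e1 : `|average L' b - P| <= (d * L)%:R / L'%:R ^+ d * K.
  have -> : average L' b - P = (L%:R ^+ d)^-1 * \sum_(f : {ffun 'I_d -> 'I_L}) ((L'%:R ^+ d)^-1 *
      \sum_(g : {ffun 'I_d -> 'I_L'}) (phi (b + offset g) - phi (b + offset f + offset g))).
    rewrite [in RHS](eq_bigr (fun f => average L' b - (L'%:R ^+ d)^-1 *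
      \sum_(g : {ffun 'I_d -> 'I_L'}) phi (b + offset g + offset f))).
      by rewrite sumrB mulrBr -average_mean// /P [in LHS]mulr_sumr.
    move=> f _; rewrite /average -mulrBr -sumrB; congr (_ * _); apply: eq_bigr => g _.
    by rewrite (addrAC b).
  rewrite normrM gtr0_norm ?invr_gt0// ler_pdivrMl//.
  apply: (le_trans (ler_norm_sum _ _ _)).
  have <- : \sum_(f : {ffun 'I_d -> 'I_L}) ((d * L)%:R / L'%:R ^+ d * K) = L%:R ^+ d * ((d * L)%:R / L'%:R ^+ d * K).
    by rewrite sumr_const card_offsets -[LHS]mulr_natl natrX.
  apply: ler_sum => f _; rewrite normrM gtr0_norm ?invr_gt0// ler_pdivrMl//.
  apply: (le_trans (ler_norm_sum _ _ _)); apply: le_trans (shift_sum bb (bL f)) _.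
  rewrite [X in _ <= X](_ : _ = (d * L)%:R * K); last first.
    by rewrite mulrA mulrCA divff ?mulr1// gt_eqF.
  rewrite ler_wpM2r// ler_nat; apply: dist1_le => i.
  rewrite mxE ler_norml; have := offset_bound f i; move: (offset f 0 i) (b 0 i) => u v.
  by move=> /andP[h1 h2]; apply/andP; split; lia.
have e2 : `|average L a - P| <= (d * (2 * H))%:R / L%:R ^+ d * K.
  have -> : average L a - P = (L'%:R ^+ d)^-1 * \sum_(g : {ffun 'I_d -> 'I_L'}) ((L%:R ^+ d)^-1 *
      \sum_(f : {ffun 'I_d -> 'I_L}) (phi (a + offset f) - phi (b + offset g + offset f))).
    rewrite [in RHS](eq_bigr (fun g => average L a - (L%:R ^+ d)^-1 *
      \sum_(f : {ffun 'I_d -> 'I_L}) phi (b + offset g + offset f))).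
      by rewrite sumrB mulrBr -average_mean// /P exchange_big mulrCA [in LHS]mulr_sumr.
    by move=> g _; rewrite /average -mulrBr -sumrB.
  rewrite normrM gtr0_norm ?invr_gt0// ler_pdivrMl//.
  apply: (le_trans (ler_norm_sum _ _ _)).
  have <- : \sum_(f : {ffun 'I_d -> 'I_L'}) ((d * (2 * H))%:R / L%:R ^+ d * K) = L'%:R ^+ d * ((d * (2 * H))%:R / L%:R ^+ d * K).
    by rewrite sumr_const card_offsets -[LHS]mulr_natl natrX.
  apply: ler_sum => g _; rewrite normrM gtr0_norm ?invr_gt0// ler_pdivrMl//.
  apply: (le_trans (ler_norm_sum _ _ _)); apply: le_trans (shift_sum aH (bL' g)) _.
  rewrite [X in _ <= X](_ : _ = (d * (2 * H))%:R * K); last first.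
    by rewrite mulrA mulrCA divff ?mulr1// gt_eqF.
  rewrite ler_wpM2r// ler_nat; apply: dist1_le => i.
  have /forallP/(_ i)/andP[] := aH; have /forallP/(_ i)/andP[] := bL' g.
  rewrite ler_norml; move: ((b + offset g) 0 i) (a 0 i) (c 0 i) => u v w *.
  by apply/andP; split; lia.
have -> : average L a - average L' b = (average L a - P) - (average L' b - P) by ring.
apply: (le_trans (ler_normB _ _)); apply: (le_trans (lerD e2 e1)).
have e3 : (d * L)%:R / L'%:R ^+ d * K <= (d * H)%:R / L%:R ^+ d * K.
  rewrite ler_wpM2r// ler_pM ?invr_ge0 ?(ltW vL'0)// ?ler_nat ?leq_mul//.
  by rewrite lef_pV2 ?posrE// lerXn2r ?nnegrE// ler_nat.
apply: (le_trans (lerD (lexx _) e3)); rewrite !natrM le_eqVlt; apply/orP; left; apply/eqP; ring.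
Qed.

Lemma average1 a : average 1 a = phi a.
Proof.
rewrite /average expr1n invr1 mul1r (eq_bigr (fun=> phi a)).
  by rewrite sumr_const card_offsets exp1n.
by move=> f _; congr phi; apply/matrixP => k i; rewrite !mxE ord1 (ord1 (f i)) addr0.
Qed.

Lemma average_le c H L a (s : seq Z) : (0 < L)%N -> box_in c H L a ->
  (forall z, phi z != 0 -> z \in s) ->
  0 <= average L a <= (L%:R ^+ d)^-1 * (count (window c H) s)%:R.
Proof.
move=> L0 aH sP; have vL0 : 0 < L%:R ^+ d :> R by rewrite exprn_gt0// ltr0n.
rewrite mulr_ge0 ?invr_ge0 ?(ltW vL0)//=; last first.
  by apply: sumr_ge0 => f _; have /andP[] := phi01 (a + offset f).
rewrite ler_pM2l ?invr_gt0//.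
apply: (@le_trans _ _ (\sum_(f : {ffun 'I_d -> 'I_L}) (a + offset f \in s)%:R)).
  apply: ler_sum => f _; have [_|ns] := boolP (_ \in s).
    by have /andP[] := phi01 (a + offset f).
  have [->//|/sP] := eqVneq (phi (a + offset f)) 0; by rewrite (negbTE ns).
rewrite -natr_sum ler_nat.
pose P := [pred f : {ffun 'I_d -> 'I_L} | a + offset f \in s].
have -> : \sum_(f : {ffun 'I_d -> 'I_L}) (a + offset f \in s : nat) = #|P| :> nat.
  by rewrite -sum1_card [RHS]big_mkcond; apply: eq_bigr => f _; rewrite inE; case: ifP.
rewrite -size_filter cardE -(size_map (fun f => a + offset f)); apply: uniq_leq_size.
  rewrite map_inj_uniq ?enum_uniq// => f g /addrI; exact: offset_inj.
by move=> z /mapP[f]; rewrite mem_enum inE => fG ->; rewrite mem_filter box_in_window.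
Qed.

End LatticeAverages.

Definition cell (R : realType) d (x : 'rV[R]_d) : 'rV[int]_d := \row_i Num.floor (x 0 i).

Lemma cell_bound (R : realType) d (x : 'rV[R]_d) i :
  (cell x 0 i)%:~R <= x 0 i < (cell x 0 i)%:~R + 1.
Proof. by rewrite mxE; have := floor_itv (x 0 i); rewrite intrD. Qed.

Lemma geometric_sum_le (R : realType) (x : R) m : 0 <= x < 1 -> \sum_(i < m) x ^+ i <= (1 - x)^-1.
Proof.
move=> /andP[x0 x1]; rewrite -[leRHS]mul1r ler_pdivlMr ?subr_gt0//.
have := subrX1 x m; have : 0 <= x ^+ m by exact: exprn_ge0.
lra.
Qed.

(** * Telescoping the weighted count along the generations *)

Section Discrepancy.
Variables (R : realType) (d : nat) (C : Type).
Local Notation V := 'rV[R]_d.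
Variables (E : set (V -> V)) (k : nat) (P : 'I_k -> ctile R d C).
Variables (lambda : R) (S : 'I_k -> set (ctile R d C)).
Variables (n : nat) (ty : 'I_k -> 'I_n) (M : 'M[nat]_n).
Hypotheses (d2 : (2 <= d)%N) (hE : isometry_group E).
Hypothesis (hS : substitution_rule E P lambda S).
Hypotheses (hty : type_numbering P lambda S ty) (hM : substitution_matrix E P S ty M).
Variables (center : 'I_k -> V) (eps : R).
Hypotheses (eps0 : 0 < eps) (hcenter : forall i, cball (center i) eps `<=` (P i).1).

Local Notation descend := (@descend R d C E k P lambda S n ty M hE hS hty hM).
Local Notation descendants := (@descendants R d C E k P lambda S n ty M hE hS hty hM).
Local Notation children := (@children R d C E k P lambda S n ty M hE hS hty hM).
Local Notation type_of := (@type_of R d k n ty).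
Local Notation supp := (@supp R d C k P).
Local Notation good := (@good R d E k).
Local Notation pres := (@pres R d k).
Local Notation packing := (@packing R d C E k P).
Local Notation pcenter := (@pcenter R d k center).
Local Notation Z := 'rV[int]_d.
Let l1 : 1 < lambda := lambda_gt1 hS.
Let l0 : 0 < lambda := lambda_gt0 hS.

Definition cover_bound (h : R) : nat := ((Num.truncn (2 * h * (d%:R + 1) / eps)).+1 ^ d)%N.

(** Centres of distinct tiles are at distance at least eps, since otherwise one centre would be
    interior to both; [grid_count] then applies. *)
Lemma packing_count (l : seq pres) (x0 : V) h : packing l -> 0 <= h ->
  (forall p, p \in l -> forall i, `|pcenter p 0 i - x0 0 i| <= h) -> (size l <= cover_bound h)%N.
Proof.
move=> [ul gl dl] h0 lh; have d0 : 0 < d%:R + 1 :> R by rewrite ltr_wpDl.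
have far p q : p \in l -> q \in l -> p != q -> eps <= enorm (pcenter p - pcenter q).
  move=> pl ql pq; rewrite leNgt; apply/negP => lt.
  have : (interior (supp p) `&` interior (supp q)) (pcenter q).
    split; last exact: (supp_interior hE eps0 hcenter (gl q ql)).
    apply/interior_cballP; exists (eps - enorm (pcenter p - pcenter q)); first by rewrite subr_gt0.
    move=> y yq; apply: (supp_ball hE hcenter (gl p pl)); rewrite /cball/=.
    rewrite (le_trans (enorm_triangle (pcenter q) _ _))// (enorm_distC (pcenter q)).
    by rewrite -lerBrDr; exact: yq.
  by rewrite (dl p q).
have -> : cover_bound h = (\prod_(i < d) (Num.truncn (2 * h * (d%:R + 1) / eps)%R).+1)%N.
  by rewrite prod_nat_const card_ord.
rewrite -(size_map pcenter).
apply: (@grid_count _ _ _ (x0 - const_mx h) (eps / (d%:R + 1)) eps).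
- by rewrite divr_gt0.
- by rewrite mulrA ltr_pdivrMr// mulrC ltr_pM2l// ltrDl.
- rewrite pairwise_map; apply: (sub_in_pairwise (P := mem l) (r := [rel p q | p != q])).
  + by move=> p q pl ql /= pq; exact: far.
  + exact/allP.
  + by rewrite -uniq_pairwise.
- move=> _ /mapP[p pl ->] i; have := lh p pl i; rewrite ler_norml => /andP[h1 h2].
  rewrite !mxE; apply/andP; split; first lra.
  rewrite mulrA ltr_pdivlMr// -ltr_pdivrMr//.
  apply: le_lt_trans (truncnS_gt _); rewrite ler_pM2r ?invr_gt0// ler_pM2r//; lra.
Qed.

(** The location of a tile is any point within D1 of its centre; it is later taken to be the
    barycenter. *)
Variables (loc : set V -> V) (D0 D1 : R).
Hypotheses (hD0 : forall p x, good p -> supp p x -> enorm (x - pcenter p) <= D0)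
  (hD1 : forall p, good p -> enorm (loc (supp p) - pcenter p) <= D1) (D00 : 0 < D0) (D10 : 0 < D1).
Variables (e : 'cV[R]_n) (C0 rho : R).
Hypotheses (C00 : 0 <= C0) (rho0 : 0 < rho) (rho_lambda : rho < lambda)
  (he : forall m a, `|(iter m (mulmx (real_mx R M)) e) a 0| <= C0 * rho ^+ m).

(** D2 bounds the distance from the location of a child to lambda times that of its parent. D3 adds
    room, in units of lambda^j, for boxes of sides lambda^j and lambda^(j+1) and for the rounding of
    corners. *)
Let D2 : R := D1 + lambda * (D0 + D1).
Let D3 : R := D2 + 2 + lambda.
Let D20 : 0 < D2. Proof. by apply: addr_gt0 => //; apply: mulr_gt0 => //; exact: addr_gt0. Qed.
Let D30 : 0 < D3. Proof. by apply: addr_gt0 => //; apply: addr_gt0 => //; exact: D20. Qed.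

Definition side j : nat := Num.truncn (lambda ^+ j).
Definition corner j p : Z := cell (lambda ^+ j *: loc (supp p)).
Definition radius j : nat := (Num.truncn (lambda ^+ j * D3)).+1.

Let lj1 j : 1 <= lambda ^+ j. Proof. by rewrite exprn_ege1// ltW. Qed.
Let lj0 j : 0 < lambda ^+ j. Proof. exact: exprn_gt0. Qed.

Lemma side_gt0 j : (0 < side j)%N.
Proof. by rewrite /side truncn_gt0. Qed.

Lemma side_le j : (side j)%:R <= lambda ^+ j.
Proof. by have /truncn_itv/andP[] : 0 <= lambda ^+ j by exact: ltW. Qed.

Lemma side_ge j : lambda ^+ j / 2 <= (side j)%:R.
Proof.
have := truncnS_gt (lambda ^+ j); rewrite -/(side j) -natr1.
have : 1 <= (side j)%:R :> R by rewrite (ler_nat R 1) side_gt0.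
lra.
Qed.

Lemma side_mono j : (side j <= side j.+1)%N.
Proof. by rewrite le_truncn// exprS ler_peMl// ltW. Qed.

Lemma radius_ge j : lambda ^+ j * D3 <= (radius j)%:R.
Proof. by rewrite ltW// truncnS_gt. Qed.

Lemma radius_le j : (radius j)%:R <= lambda ^+ j * (D3 + 1).
Proof.
rewrite /radius -natr1 [leRHS]mulrDr mulr1; apply: lerD => //.
by have /truncn_itv/andP[] : 0 <= lambda ^+ j * D3 by rewrite mulr_ge0// ltW.
Qed.

Lemma child_location p q : good p -> q \in children p ->
  enorm (loc (supp q) - lambda *: loc (supp p)) <= D2.
Proof.
move=> gp qp; have gq : good q by apply: children_good qp.
have [x px xq] : scal lambda (supp p) (pcenter q).
  apply: (child_sub qp).
  by apply: (supp_ball hE hcenter gq); apply: cball_center; exact: ltW.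
rewrite (le_trans (enorm_triangle (pcenter q) _ _))// lerD ?hD1//.
rewrite -xq -scalerBr enormZ gtr0_norm// ler_pM2l//.
rewrite (le_trans (enorm_triangle (pcenter p) _ _))// lerD ?hD0// enorm_distC hD1//.
Qed.

Lemma window_near j j' p z i : (j <= j')%N -> good p -> window (corner j' p) (radius j) z ->
  `|pcenter p 0 i - ((lambda ^+ j')^-1 *: map_mx intr z) 0 i| <= D3 + 2 + D1.
Proof.
move=> jj gp /forallP/(_ i) zw.
have h1 := coord_le_enorm (loc (supp p) - pcenter p) i; have h2 := hD1 gp.
have /andP[h3 h4] := cell_bound (lambda ^+ j' *: loc (supp p)) i.
rewrite -/(corner j' p) in h3 h4.
have h5 : `|(z 0 i)%:~R - (corner j' p 0 i)%:~R| <= (radius j)%:R :> R.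
  by rewrite -intrB -intr_norm -[(radius j)%:R]/((radius j)%:Z%:~R) ler_int.
move: (corner j' p) h3 h4 h5 => cr h3 h4 h5.
have h6 := radius_le j; have s1 := lj1 j'.
have jl : lambda ^+ j <= lambda ^+ j' by rewrite ler_eXn2l.
have h7 : lambda ^+ j * (D3 + 1) <= lambda ^+ j' * (D3 + 1) by rewrite ler_wpM2r// addr_ge0// (ltW D30).
rewrite !mxE in h1 h3 h4 *; set s := lambda ^+ j' in h3 h4 h7 s1 *.
have s0 : 0 < s by exact: lj0.
have h8 : `|loc (supp p) 0 i - s^-1 * (z 0 i)%:~R| <= D3 + 2.
  rewrite -(ler_pM2l s0) -{1}(gtr0_norm s0) -normrM mulrBr mulrA divff ?gt_eqF// mul1r.
  have -> : s * (D3 + 2) = s * (D3 + 1) + s by ring.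
  move: h5; rewrite !ler_norml => /andP[h51 h52].
  move: h3 h4 h51 h52 (le_trans h6 h7) s1.
  move: (s * loc _ _ _) (s * (D3 + 1)) (z 0 i)%:~R (cr 0 i)%:~R (radius j)%:R.
  by move=> u v w y r *; apply/andP; split; lra.
move: (le_trans h1 h2) h8; move: (loc _ _ _) (s^-1 * _) (pcenter p 0 i) (D3 + 2) => u v w y.
rewrite !ler_norml => /andP[h11 h12] /andP[h81 h82].
by apply/andP; split; lra.
Qed.

Let Cov : nat := cover_bound (D3 + 2 + D1).

(** Double counting: if z lies in the window of p, the centre of p is in a fixed-size box around z /
    lambda^j', and at most [Cov] tiles of a packing have their centres there. *)
Lemma window_overlap j j' (l : seq pres) (s : seq Z) : (j <= j')%N -> packing l ->
  \sum_(p <- l) (count (window (corner j' p) (radius j)) s)%:R <= (Cov * size s)%:R :> R.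
Proof.
move=> jj pl; rewrite -natr_sum ler_nat.
have -> : (\sum_(p <- l) count (window (corner j' p) (radius j)) s =
    \sum_(z <- s) count (fun p => window (corner j' p) (radius j) z) l)%N.
  under eq_bigr do rewrite -sum1_count big_mkcond /=.
  by rewrite exchange_big /=; apply: eq_bigr => z _; rewrite -sum1_count [RHS]big_mkcond.
apply: (@leq_trans (\sum_(z <- s) Cov)%N); last by rewrite big_const_seq count_predT iter_addn_0.
apply: leq_sum => z _; rewrite -size_filter.
have [ul gl dl] := pl.
apply: (@packing_count _ ((lambda ^+ j')^-1 *: map_mx intr z)).
- split; first exact: filter_uniq.
    by move=> p; rewrite mem_filter => /andP[_ /gl].
  by move=> p q; rewrite !mem_filter => /andP[_ pl'] /andP[_ ql]; exact: dl.
- by apply: addr_ge0; [apply: addr_ge0 => //; exact: ltW D30 | exact: ltW].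
- by move=> p; rewrite mem_filter => /andP[zw /gl gp] i; exact: window_near zw.
Qed.

(* Ancestors of generation j weigh their averages of phi over boxes of side
   lambda^j; passing from j to j + 1 costs only the gradient of phi. *)
Definition level_sum (phi : Z -> R) j (l : seq pres) : R :=
  \sum_(p <- l) (iter j (mulmx (real_mx R M)) e) (type_of p) 0 * average phi (side j) (corner j p).

Let chmax : nat := (\sum_i size (prototile_children hE hS hty hM i))%N.

Lemma size_children p : (size (children p) <= chmax)%N.
Proof. by rewrite size_map /chmax (bigD1 p.1)//= leq_addr. Qed.

Let x : R := rho * lambda / lambda ^+ d.

(** rho < lambda and d >= 2 enter here together: rho lambda < lambda^2 <= lambda^d. *)
Lemma ratio_lt1 : 0 <= x < 1.
Proof.
rewrite /x divr_ge0 ?mulr_ge0 ?exprn_ge0 ?ltW//= ltr_pdivrMr ?exprn_gt0// mul1r.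
apply: (@lt_le_trans _ _ (lambda ^+ 2)); first by rewrite expr2 ltr_pM2r.
by rewrite ler_eXn2l.
Qed.

(** The factor 3 d H / L^d of [average_compare], with H <= lambda^j (D3 + 1) and L >= lambda^j /
    2. *)
Let K1 : R := 3 * d%:R * (D3 + 1) * 2 ^+ d.
Let K1_ge0 : 0 <= K1.
Proof. by rewrite /K1 !mulr_ge0 ?exprn_ge0// addr_ge0// ltW. Qed.

Section TestFunction.
Variables (phi : Z -> R) (Gamma s : seq Z).
Hypotheses (phi01 : forall z, 0 <= phi z <= 1)
  (phiG : forall z i, phi (z + delta_mx 0 i) != phi z -> z \in Gamma)
  (phis : forall z, phi z != 0 -> z \in s).

Lemma side_inv j : ((side j)%:R ^+ d)^-1 <= 2 ^+ d / (lambda ^+ j) ^+ d.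
Proof.
have s0 : 0 < (side j)%:R :> R by rewrite ltr0n side_gt0.
rewrite -[leLHS]mul1r ler_pdivrMr ?exprn_gt0// mulrAC ler_pdivlMr ?exprn_gt0// mul1r -exprMn.
apply: lerXn2r; rewrite ?nnegrE ?mulr_ge0// ?(ltW (lj0 j))//.
by have := side_ge j; rewrite ler_pdivrMr// mulrC.
Qed.

Lemma average_child_parent j p q : good p -> q \in children p ->
  `|average phi (side j) (corner j q) - average phi (side j.+1) (corner j.+1 p)| <=
    K1 * (lambda ^+ j / (lambda ^+ j) ^+ d) *
      (count (window (corner j.+1 p) (radius j)) Gamma)%:R.
Proof.
move=> gp qp; set cnt := (count _ _)%:R.
have s0 := lj0 j; have s1 := lj1 j; have r1 := radius_ge j; have r2 := radius_le j.
have sj := side_le j; have sj' := side_le j.+1; rewrite exprS in sj'.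
have hD3 : lambda ^+ j * D3 = lambda ^+ j * D2 + 2 * lambda ^+ j + lambda * lambda ^+ j by rewrite /D3; ring.
have near i : `|(corner j q 0 i)%:~R - (corner j.+1 p 0 i)%:~R| <= lambda ^+ j * D2 + 1 :> R.
  have h1 := coord_le_enorm (loc (supp q) - lambda *: loc (supp p)) i.
  have h2 := child_location gp qp.
  have /andP[h3 h4] := cell_bound (lambda ^+ j *: loc (supp q)) i.
  have /andP[h5 h6] := cell_bound (lambda ^+ j.+1 *: loc (supp p)) i.
  rewrite -/(corner j q) in h3 h4; rewrite -/(corner j.+1 p) in h5 h6.
  move: (corner j q) (corner j.+1 p) h3 h4 h5 h6 => u w h3 h4 h5 h6.
  rewrite !mxE in h1 h3 h4 h5 h6; rewrite exprSr -mulrA in h5 h6.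
  have h7 : `|lambda ^+ j * loc (supp q) 0 i - lambda ^+ j * (lambda * loc (supp p) 0 i)| <= lambda ^+ j * D2.
    by rewrite -mulrBr normrM gtr0_norm// ler_pM2l// (le_trans h1).
  move: h7; rewrite !ler_norml => /andP[h71 h72]; apply/andP; split; lra.
apply: (@le_trans _ _ (3 * d%:R * (radius j)%:R / (side j)%:R ^+ d * cnt)).
  have D2l : 0 <= lambda ^+ j * D2 by rewrite mulr_ge0// ltW.
  have ll : 0 <= lambda * lambda ^+ j by rewrite mulr_ge0// ltW.
  apply: average_compare => //; [exact: side_gt0|exact: side_mono| | |].
  - by rewrite -(ler_nat R); lra.
  - apply/forallP => i; have := near i; rewrite ler_norml => /andP[h1 h2].
    apply/andP; split; rewrite -(ler_int R) !intrD ?intrN -!pmulrn; lra.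
  - apply/forallP => i; rewrite -!(ler_int R) !intrD ?intrN -!pmulrn natrD; apply/andP; split; lra.
rewrite ler_wpM2r ?ler0n//.
have -> : K1 * (lambda ^+ j / (lambda ^+ j) ^+ d) =
   3 * d%:R * (lambda ^+ j * (D3 + 1)) * (2 ^+ d / (lambda ^+ j) ^+ d) by rewrite /K1; ring.
apply: ler_pM; rewrite ?mulr_ge0 ?invr_ge0 ?exprn_ge0//; last exact: side_inv.
by rewrite ler_wpM2l// mulr_ge0.
Qed.

Let B : R := C0 * K1 * chmax%:R * Cov%:R.
Let B_ge0 : 0 <= B. Proof. by apply: mulr_ge0 => //; apply: mulr_ge0 => //; apply: mulr_ge0 => //; exact: K1_ge0. Qed.

(** The weights M^j e of the children of p add up to the weight M^(j+1) e of p. The difference is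
    therefore a sum of child weights times differences of averages, and overlapping windows are
    counted by [window_overlap]. *)
Lemma level_sum_step j l : packing l ->
  `|level_sum phi j (descend l) - level_sum phi j.+1 l| <= B * x ^+ j * (size Gamma)%:R.
Proof.
move=> pl; have [ul gl dl] := pl; set w := iter j (mulmx (real_mx R M)) e.
have -> : level_sum phi j (descend l) - level_sum phi j.+1 l =
  \sum_(p <- l) \sum_(q <- children p) w (type_of q) 0 *
     (average phi (side j) (corner j q) - average phi (side j.+1) (corner j.+1 p)).
  rewrite /level_sum big_flatten big_map -sumrB; apply: eq_bigr => p _.
  under [in RHS]eq_bigr do rewrite mulrBr.
  rewrite sumrB -mulr_suml; congr (_ - _ * _).
  rewrite iterS -/w; have := sum_descend hE hS hty hM w [:: p].
  by rewrite -[descend _]/(children p ++ [::]) cats0 big_seq1 => ->.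
apply: (le_trans (ler_norm_sum _ _ _)).
set c := C0 * rho ^+ j * (K1 * (lambda ^+ j / (lambda ^+ j) ^+ d)) * chmax%:R.
have r0 : 0 <= C0 * rho ^+ j by rewrite mulr_ge0 ?exprn_ge0 ?(ltW rho0).
have q0 : 0 <= K1 * (lambda ^+ j / (lambda ^+ j) ^+ d).
  by apply: mulr_ge0; [exact: K1_ge0 | rewrite divr_ge0 ?exprn_ge0 ?(ltW l0)].
have c0 : 0 <= c by apply: mulr_ge0 => //; exact: mulr_ge0.
apply: (@le_trans _ _ (\sum_(p <- l) c * (count (window (corner j.+1 p) (radius j)) Gamma)%:R)).
  rewrite big_seq [leRHS]big_seq; apply: ler_sum => p /gl gp.
  set cnt := (count _ _)%:R; have cnt0 : 0 <= cnt by exact: ler0n.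
  apply: (le_trans (ler_norm_sum _ _ _)).
  apply: (@le_trans _ _ (\sum_(q <- children p) C0 * rho ^+ j * (K1 * (lambda ^+ j / (lambda ^+ j) ^+ d) * cnt))).
    rewrite big_seq [leRHS]big_seq; apply: ler_sum => q qp; rewrite normrM.
    by apply: ler_pM => //; [exact: he | exact: average_child_parent].
  rewrite big_const_seq count_predT iter_addr addr0 -[leLHS]mulr_natr.
  have -> : c * cnt = C0 * rho ^+ j * (K1 * (lambda ^+ j / (lambda ^+ j) ^+ d) * cnt) * chmax%:R.
    by rewrite /c; move: (K1 * _) (C0 * _) => u v; ring.
  rewrite ler_wpM2l ?ler_nat ?size_children//.
  by apply: mulr_ge0 => //; exact: mulr_ge0.
rewrite -mulr_sumr; apply: (le_trans (ler_wpM2l c0 (window_overlap Gamma (leqnSn j) pl))).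
rewrite natrM le_eqVlt; apply/orP; left; apply/eqP; rewrite /c /B /x.
have -> : (rho * lambda / lambda ^+ d) ^+ j = rho ^+ j * (lambda ^+ j / (lambda ^+ j) ^+ d).
  by rewrite !exprMn exprVn -!exprM mulnC mulrA.
ring.
Qed.

(** At the oldest generation the averages are bounded by the number of points of the support s in
    the windows; this crude bound is harmless since it decays like x^m. *)
Lemma level_sum_top m l : packing l ->
  `|level_sum phi m l| <= C0 * 2 ^+ d * Cov%:R * (size s)%:R * x ^+ m.
Proof.
move=> pl; have [ul gl dl] := pl; apply: (le_trans (ler_norm_sum _ _ _)).
set c := C0 * rho ^+ m * (2 ^+ d / (lambda ^+ m) ^+ d).
have c0 : 0 <= c by rewrite /c !mulr_ge0 ?invr_ge0 ?exprn_ge0 ?exprn_ge0 ?(ltW rho0) ?(ltW l0).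
apply: (@le_trans _ _ (\sum_(p <- l) c * (count (window (corner m p) (radius m)) s)%:R)).
  apply: ler_sum => p _; rewrite normrM /c -mulrA; apply: ler_pM => //.
  have bin : box_in (corner m p) (radius m) (side m) (corner m p).
    apply/forallP => i; rewrite -!(ler_int R) !intrD ?intrN -!pmulrn.
    have := side_le m; have := radius_ge m.
    have : lambda ^+ m <= lambda ^+ m * D3.
      rewrite ler_peMr ?(ltW (lj0 m))// /D3; have := D20; have := l1; lra.
    move=> h1 h2 h3; apply/andP; split; have := ler0n R (radius m); lra.
  have /andP[a0 a1] := average_le phi01 (side_gt0 m) bin phis.
  rewrite ger0_norm// (le_trans a1)// ler_wpM2r//; exact: side_inv.
rewrite -mulr_sumr; apply: (le_trans (ler_wpM2l c0 (window_overlap s (leqnn m) pl))).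
have xm : rho ^+ m / (lambda ^+ m) ^+ d <= x ^+ m.
  have -> : x ^+ m = rho ^+ m / (lambda ^+ m) ^+ d * lambda ^+ m.
    by rewrite /x !exprMn exprVn -!exprM [(d * m)%N]mulnC; ring.
  by rewrite ler_peMr// mulr_ge0 ?invr_ge0 ?exprn_ge0 ?exprn_ge0 ?(ltW rho0) ?(ltW l0).
have -> : c * (Cov * size s)%:R = C0 * 2 ^+ d * Cov%:R * (size s)%:R * (rho ^+ m / (lambda ^+ m) ^+ d).
  by rewrite /c natrM; ring.
by rewrite ler_wpM2l// !mulr_ge0 ?exprn_ge0.
Qed.

Lemma level_sum_descendants m j l : packing l ->
  `|level_sum phi j (descendants m l)| <=
    \sum_(i < m) B * x ^+ (j + i) * (size Gamma)%:R + `|level_sum phi (j + m) l|.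
Proof.
move=> pl; elim: m j => [|m IH] j; first by rewrite big_ord0 add0r addn0.
have pm := descendants_packing hE hS hty hM eps0 hcenter m pl.
have := level_sum_step j pm; have := IH j.+1.
rewrite big_ord_recl addn0 /= => h1 h2.
apply: (@le_trans _ _ (`|level_sum phi j (descend (descendants m l)) - level_sum phi j.+1 (descendants m l)| +
   `|level_sum phi j.+1 (descendants m l)|)).
  by rewrite (le_trans _ (ler_normD _ _))// subrK.
rewrite -addrA; apply: lerD => //; apply: (le_trans h1); rewrite addSnnS lerD2r.
by apply: ler_sum => i _; rewrite /bump /= addnA addn1.
Qed.

Definition discrepancy_constant : R := Num.max (B / (1 - x)) (C0 * 2 ^+ d * Cov%:R).

Lemma discrepancy_bound m l : packing l ->
  `|\sum_(q <- descendants m l) e (type_of q) 0 * phi (cell (loc (supp q)))| <=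
    discrepancy_constant * (size Gamma)%:R + discrepancy_constant * (size s)%:R * x ^+ m.
Proof.
move=> pl; have [x0 x1] := andP ratio_lt1.
(* At level 0 the boxes consist of one cell, so averaging is evaluation at the cell of the
   location. *)
have -> : \sum_(q <- descendants m l) e (type_of q) 0 * phi (cell (loc (supp q))) =
    level_sum phi 0 (descendants m l).
  rewrite /level_sum; apply: eq_bigr => q _; congr (_ * _).
  have -> : side 0 = 1%N by rewrite /side expr0 -[1](mulr1n 1) natrK.
  by rewrite average1 /corner expr0 scale1r.
apply: (le_trans (level_sum_descendants m 0 pl)); apply: lerD; last first.
  apply: (le_trans (level_sum_top _ pl)); rewrite add0n -!mulrA.
  by rewrite [leLHS]mulrA [C0 * _ * _]mulrA ler_wpM2r ?mulr_ge0 ?exprn_ge0// le_max lexx orbT.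
rewrite -mulr_suml ler_wpM2r// -mulr_sumr (le_trans (y := B / (1 - x)))// ?le_max ?lexx//.
by rewrite ler_wpM2l//; apply: (geometric_sum_le m); rewrite x0 x1.
Qed.

End TestFunction.

End Discrepancy.

Lemma le_geometric_limit (R : realType) (a b c x : R) : 0 <= x < 1 ->
  (forall m, a <= b + c * x ^+ m) -> a <= b.
Proof.
move=> /andP[x0 x1] h.
have cv : (fun m => b + c * x ^+ m) @ \oo --> b + c * 0.
  apply: cvgD; first exact: cvg_cst.
  by apply: cvgMr; apply: cvg_expr; rewrite ger0_norm.
rewrite mulr0 addr0 in cv; rewrite -(cvg_lim _ cv)//.
by apply: limr_ge; [apply/cvg_ex; exists b | apply: nearW].
Qed.

Section TileDiscrepancy.
Variables (R : realType) (d : nat) (C : Type).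
Local Notation V := 'rV[R]_d.
Local Notation Z := 'rV[int]_d.
Variables (E : set (V -> V)) (k : nat) (P : 'I_k -> ctile R d C).
Variables (lambda : R) (S : 'I_k -> set (ctile R d C)).
Variables (n : nat) (ty : 'I_k -> 'I_n) (M : 'M[nat]_n).
Hypotheses (d2 : (2 <= d)%N) (hE : isometry_group E) (hP : forall i, is_tile (P i)).
Hypothesis (hS : substitution_rule E P lambda S).
Hypotheses (hty : type_numbering P lambda S ty) (hM : substitution_matrix E P S ty M).
Hypothesis (prim : primitive_mx M).
Variables (center : 'I_k -> V) (eps : R).
Hypotheses (eps0 : 0 < eps) (hcenter : forall i, cball (center i) eps `<=` (P i).1).
Variables (L : (nat -> R) -> R) (HL : banach_limit L).

Local Notation descendants := (@descendants R d C E k P lambda S n ty M hE hS hty hM).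
Local Notation type_of := (@type_of R d k n ty).
Local Notation supp := (@supp R d C k P).
Local Notation tile_of := (@tile_of R d C k P).
Local Notation good := (@good R d E k).
Local Notation pres := (@pres R d k).
Local Notation extent := (@extent R d lambda L).
Local Notation volume := (@volume R d C k P lambda S n ty hty L).
Let l1 : 1 < lambda := lambda_gt1 hS.
Let l0 : 0 < lambda := lambda_gt0 hS.

Lemma spectral_decomposition : (0 < n)%N -> r_mx R M < lambda -> exists theta C0 rho : R,
  [/\ 0 < theta, 0 <= C0, 0 < rho, rho < lambda &
   forall m a, `|(iter m (mulmx (real_mx R M)) (const_mx 1 - theta *: volume)) a 0| <= C0 * rho ^+ m].
Proof.
move=> n0 rl.
have v0 := volume_gt0 hE hP hS hty hM prim eps0 hcenter HL.
have ve := volume_eigenvector hE hP hS hty hM prim eps0 hcenter HL.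
have ll : lambda <= lambda ^+ d by rewrite -[leLHS]expr1 ler_eXn2l// ltnW.
move: volume v0 ve; clear -n0 rl prim ll l0; move: M prim rl; case: n n0 => // n' _ M' prim' rl v v0 ve.
have [theta [C0 [rho [h1 h2 h3 h4 h5]]]] := spectral_gap v0 ve (lt_le_trans l0 ll) prim' rl l0 ll.
exists theta, C0, rho; split => // m a.
by rewrite iter_mulmx.
Qed.

(** The weights 1 - theta vol turn the weighted sum over the tiles selected by F into their number
    minus theta times their volume. The constant K is fixed before the tiling and the region. *)
Lemma tile_discrepancy : (0 < n)%N -> r_mx R M < lambda -> exists theta K : R, [/\ 0 < theta, 0 <= K &
  forall (T : set (ctile R d C)) (F : pred Z) (Gamma s : seq Z) (lt : seq (ctile R d C)),
    Omega_S E P lambda S T ->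
    (forall z i, F (z + delta_mx 0 i) != F z -> z \in Gamma) -> (forall z, F z -> z \in s) ->
    uniq lt -> (forall t, t \in lt <-> T t /\ F (cell (barycenter t.1))) ->
    `|(size lt)%:R - theta * \sum_(t <- lt) extent t.1| <= K * (size Gamma)%:R].
Proof.
move=> n0 rl; have [theta [C0 [rho [th0 C00 rho0 rhol he]]]] := spectral_decomposition n0 rl.
have [D0 D00 hD0] := diameter_bound hE hP center.
have [D1 D10 hD1] := barycenter_near hE hP eps0 hcenter.
set e := const_mx 1 - theta *: volume in he.
pose K := discrepancy_constant hE hS hty hM eps D0 D1 C0 rho.
exists theta, (Num.max 0 K); split => //; first by rewrite le_max lexx.
move=> T F Gamma s lt hT hG hs ult ltP.
pose phi z : R := (F z)%:R.
have phi01 z : 0 <= phi z <= 1 by rewrite /phi; case: (F z); rewrite ?lexx ?ler01.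
have phiG z i : phi (z + delta_mx 0 i) != phi z -> z \in Gamma.
  by move=> h; apply: (hG z i); apply: contraNneq h => /esym h; rewrite /phi h.
have phis z : phi z != 0 -> z \in s.
  by move=> h; apply: hs; apply: contraNT h => /negbTE h; rewrite /phi h.
apply: (@le_trans _ _ (K * (size Gamma)%:R)); last by rewrite ler_wpM2r// le_max lexx orbT.
apply: (@le_geometric_limit R _ _ (K * (size s)%:R) (rho * lambda / lambda ^+ d)).
  exact: (ratio_lt1 d2 hS rho0 rhol).
(* T is the m-th inflation of some tiling Tm for every m; only the term with the size of s depends
   on m, and it vanishes in the limit. *)
move=> m; have [Tm OTm Tmm] := hT m I.
have ltm t : t \in lt -> iter m (inflate E P lambda S) Tm t by move=> /ltP[+ _]; rewrite Tmm.
have [l [pl lTm lcov]] := ancestors hE hS hty hM OTm ltm.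
have := discrepancy_bound d2 hE hS hty hM eps0 hcenter hD0 hD1 D00 D10 C00 rho0 rhol he phi01 phiG phis m pl.
rewrite -/K; apply: le_trans.
have pd := descendants_packing hE hS hty hM eps0 hcenter m pl.
have [ud gd dd] := pd.
have inj : {in descendants m l &, injective tile_of}.
  move=> p q pm qm pq; apply/eqP/negPn/negP => npq.
  by have := int_disjoint_neq hE eps0 hcenter (gd p pm) (dd p q pm qm npq); rewrite pq eqxx.
have dT q : q \in descendants m l -> T (tile_of q).
  move=> qm; rewrite -Tmm; apply: (descendant_iter_inflate _ qm) => p pl'.
  by split; [case: pl => _ + _; exact | exact: lTm].
rewrite le_eqVlt; apply/orP; left; apply/eqP; congr `|_|.
have perm : perm_eq lt (map tile_of [seq q <- descendants m l | F (cell (barycenter (supp q)))]).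
  apply: uniq_perm => //.
    rewrite map_inj_in_uniq ?filter_uniq// => p q; rewrite !mem_filter => /andP[_ pm] /andP[_ qm]; exact: inj.
  move=> t; apply/idP/mapP => [tl|[q]].
    have [_ Ft] := (ltP t).1 tl; have [q qm qt] := lcov t tl.
    by exists q => //; rewrite mem_filter qm andbT -[supp q]/((tile_of q).1) qt.
  by rewrite mem_filter => /andP[Fq qm] ->; apply/ltP; split; [exact: dT | exact: Fq].
rewrite (perm_big _ perm) /= (perm_size perm) size_map big_map.
rewrite -sum1_size natr_sum mulr_sumr -sumrB big_filter big_mkcond /=.
apply: eq_big_seq => q qm; rewrite /phi; case: ifP => Fq; last by rewrite mulr0.
have -> : extent (tile_of q).1 = volume (type_of q) 0 by exact: (extent_volume hE hP hS hty L (gd q qm)).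
by rewrite mulr1 /e; move: volume => v; rewrite !mxE.
Qed.

End TileDiscrepancy.

(** * Absorption of the boundary *)

Section CoarseCells.
Variable d : nat.
Local Notation Z := 'rV[int]_d.
Implicit Types (L p w : nat) (z c o r : Z) (G B : seq Z).

Definition coarse L z : Z := \row_i (z 0%R i %/ L%:Z)%Z.

Lemma coarseP L z c : (0 < L)%N ->
  coarse L z = c <-> forall i, L%:Z * c 0 i <= z 0 i < L%:Z * c 0 i + L%:Z.
Proof.
move=> L0; split=> [<- i|h]; first by rewrite mxE; lia.
apply/rowP => i; have := h i; rewrite mxE; move: (z 0 i) (c 0 i) => a b /andP[ab ba].
apply/eqP; rewrite eq_le -ltzD1 ltz_divLR ?lez_divRL; nia.
Qed.

Lemma coarse_offset L z : (0 < L)%N -> exists2 r, z = L%:Z *: coarse L z + r & forall i, 0 <= r 0 i < L%:Z.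
Proof.
move=> L0; exists (z - L%:Z *: coarse L z); first by rewrite addrC subrK.
move=> i; have /(_ i) := (coarseP z (coarse L z) L0).1 erefl; move: (coarse L z) => c.
by rewrite !mxE; move: (z 0 i) (c 0 i) => a b; rewrite lerBrDl addr0 ltrBlDl.
Qed.

Lemma coarse_add L o r : (0 < L)%N -> (forall i, 0 <= r 0 i < L%:Z) -> coarse L (L%:Z *: o + r) = o.
Proof.
move=> L0 hr; apply/coarseP => // i; have := hr i; rewrite !mxE.
by move: (o 0 i) (r 0 i) => a b; nia.
Qed.

Lemma coarse_mul w p z : (0 < w)%N -> (0 < p)%N -> coarse (w * p) z = coarse p (coarse w z).
Proof.
move=> w0 p0; apply/coarseP; first by rewrite muln_gt0 w0.
move=> i; have /(_ i) := (coarseP _ _ p0).1 (erefl (coarse p (coarse w z))).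
have /(_ i) := (coarseP _ _ w0).1 (erefl (coarse w z)).
rewrite PoszM; move: (coarse p _ 0 i) (coarse w z 0 i) (z 0 i) => a b x h1 h2.
by nia.
Qed.

Definition blocks L B : seq Z := [seq L%:Z *: o + r | o <- B, r <- grid d L].

Lemma size_blocks L B : size (blocks L B) = (size B * L ^ d)%N.
Proof. by rewrite size_allpairs size_grid. Qed.

Lemma mem_blocks L B z : (0 < L)%N -> (z \in blocks L B) = (coarse L z \in B).
Proof.
move=> L0; apply/allpairsP/idP => [[[b r] /= [bB rg ->]]|zB].
  by rewrite coarse_add// => i; move: rg; rewrite mem_grid => /forallP.
have [r zr hr] := coarse_offset z L0; exists (coarse L z, r); split => //=.
by rewrite mem_grid; apply/forallP.
Qed.

Lemma blocks_uniq L B : (0 < L)%N -> uniq B -> uniq (blocks L B).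
Proof.
move=> L0 uB; apply: allpairs_uniq => //; first exact: grid_uniq.
move=> _ _ /allpairsP[[b r] /= [_ rg ->]] /allpairsP[[b' r'] /= [_ rg' ->]] e.
have h : b = b'.
  rewrite -(@coarse_add L b r) ?e// ?coarse_add// => i; move: rg rg'.
    by move=> _; rewrite mem_grid => /forallP.
  by rewrite mem_grid => /forallP.
by move: e; rewrite h /= => /addrI ->.
Qed.

Definition steps : seq Z :=
  [seq delta_mx 0 i | i <- enum 'I_d] ++ [seq - delta_mx 0 i | i <- enum 'I_d].

Definition neighbors G : seq Z := undup [seq c <- [seq c + u | c <- G, u <- steps] | c \notin G].

Lemma mem_neighbors G c u : c \in G -> u \in steps -> c + u \notin G -> c + u \in neighbors G.
Proof.
by move=> cG us h; rewrite mem_undup mem_filter h /=; apply/allpairsP; exists (c, u).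
Qed.

Lemma neighbors_near G c : c \in neighbors G -> c \notin G /\ exists2 b, b \in G & forall i, `|c 0 i - b 0 i| <= 1.
Proof.
rewrite mem_undup mem_filter => /andP[cG /allpairsP[[b u] /= [bG us e]]]; split => //.
exists b => // i; rewrite e /= mxE [X in X - _]addrC addrK.
by move: us; rewrite mem_cat => /orP[|] /mapP[j _ ->]; rewrite !mxE; case: (_ && _).
Qed.

Definition shell L (i : 'I_d) : seq Z :=
  [seq \row_j Posz (f j) | f : {ffun 'I_d -> 'I_L} in family (fun j => [pred x : 'I_L | (j == i) ==> (x.+1 == L)%N])].

Lemma size_shell L i : (0 < L)%N -> size (shell L i) = (L ^ d.-1)%N.
Proof.
case: L => // L _; rewrite size_image card_family foldrE big_map big_enum /=.
rewrite (bigD1 i)//= (@fintype.eq_card1 _ (@ord_max L)) ?mul1n; last first.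
  by move=> x; rewrite !inE -?(inj_eq val_inj) ?eqxx.
rewrite (eq_bigr (fun=> L.+1)).
  rewrite big_const_seq iter_muln_1; congr (_ ^ _)%N.
  by rewrite -sum1_count sum1_card cardC1 card_ord.
by move=> j /negbTE ji; rewrite -[RHS]card_ord; apply: fintype.eq_card => x; rewrite !inE ji.
Qed.

Lemma mem_shell L i r : (forall j, 0 <= r 0 j < L%:Z) -> r 0 i = L%:Z - 1 -> r \in shell L i.
Proof.
move=> hr ri; have h j : (`|r 0%R j|%N < L)%N by have := hr j; lia.
apply/mapP; exists [ffun j => Ordinal (h j)]; last by apply/rowP => j; rewrite !mxE ffunE /= gez0_abs//; case/andP: (hr j).
rewrite mem_enum; apply/familyP => j; rewrite inE ffunE; apply/implyP => /eqP -> /=.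
by rewrite ri; apply/eqP; move: (h i); rewrite ri; case: (L) => //= l _; rewrite subn1.
Qed.

(** Jumps of the indicator of G occur across faces between G and a neighbouring coarse cell, and are
    charged to the latter: either to its last layer in direction i, or to the layer just before it.
    The size thus depends on the neighbours of G and not on G. *)
Definition collar L B : seq Z :=
  [seq L%:Z *: o + r | o <- B,
     r <- flatten [seq shell L i ++ [seq r - L%:Z *: delta_mx 0 i | r <- shell L i] | i <- enum 'I_d]].

Lemma size_collar L B : (0 < L)%N -> size (collar L B) = (size B * (d * (2 * L ^ d.-1)))%N.
Proof.
move=> L0; rewrite size_allpairs size_flatten /shape -map_comp sumnE big_map.
rewrite (eq_bigr (fun=> 2 * L ^ d.-1)%N); last by move=> i _; rewrite /= size_cat size_map size_shell// mul2n addnn.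
by rewrite big_enum sum_nat_const card_ord.
Qed.

Lemma collarP L G z i : (0 < L)%N ->
  (coarse L (z + delta_mx 0 i) \in G) != (coarse L z \in G) -> z \in collar L (neighbors G).
Proof.
move=> L0 hG; have [r zr hr] := coarse_offset z L0; set c := coarse L z in zr hG *.
have ri : r 0 i = L%:Z - 1.
  apply/eqP; apply: contraNT hG => ri; apply/eqP; congr (_ \in G); apply/coarseP => // j.
  have := hr j; rewrite zr !mxE; have [->|_] := eqVneq j i; move: ri; rewrite ?andbT /=; lia.
have cz : coarse L (z + delta_mx 0 i) = c + delta_mx 0 i.
  apply/coarseP => // j; have := hr j; rewrite zr !mxE.
  by have [->|_] := eqVneq j i; rewrite ?ri /=; lia.
have rs := mem_shell hr ri; rewrite cz in hG.
have [cG|cG] := boolP (c \in G).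
  have dG : c + delta_mx 0 i \notin G by move: hG; rewrite cG; case: (_ \in G).
  apply/allpairsP; exists (c + delta_mx 0 i, r - L%:Z *: delta_mx 0 i); split => /=.
  - by apply: mem_neighbors => //; rewrite mem_cat map_f// mem_enum.
  - apply/flattenP; exists (shell L i ++ [seq r - L%:Z *: delta_mx 0 i | r <- shell L i]).
      by apply: map_f; rewrite mem_enum.
    by rewrite mem_cat orbC (map_f (fun r => r - L%:Z *: delta_mx 0 i)).
  - by rewrite zr scalerDr addrACA subrr addr0.
have dG : c + delta_mx 0 i \in G by move: hG; rewrite (negbTE cG); case: (_ \in G).
apply/allpairsP; exists (c, r); split => //=.
  rewrite -[c](addrK (delta_mx 0 i)); apply: mem_neighbors; rewrite ?addrK//.
  by rewrite mem_cat orbC (map_f (fun i => - delta_mx 0 i)) ?mem_enum.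
apply/flattenP; exists (shell L i ++ [seq r - L%:Z *: delta_mx 0 i | r <- shell L i]).
  by apply: map_f; rewrite mem_enum.
by rewrite mem_cat rs.
Qed.

End CoarseCells.

(** * Finite patches of tiles over coarse cells *)

Section Patches.
Variables (R : realType) (d : nat) (C : Type).
Local Notation V := 'rV[R]_d.
Local Notation Z := 'rV[int]_d.
Variables (E : set (V -> V)) (k : nat) (P : 'I_k -> ctile R d C).
Variables (lambda : R) (S : 'I_k -> set (ctile R d C)).
Variables (n : nat) (ty : 'I_k -> 'I_n) (M : 'M[nat]_n).
Hypotheses (d2 : (2 <= d)%N) (hE : isometry_group E) (hP : forall i, is_tile (P i)).
Hypothesis (hS : substitution_rule E P lambda S).
Hypotheses (hty : type_numbering P lambda S ty) (hM : substitution_matrix E P S ty M).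
Hypothesis (prim : primitive_mx M).
Variables (center : 'I_k -> V) (eps : R).
Hypotheses (eps0 : 0 < eps) (hcenter : forall i, cball (center i) eps `<=` (P i).1).
Variables (L : (nat -> R) -> R) (HL : banach_limit L).

Local Notation type_of := (@type_of R d k n ty).
Local Notation supp := (@supp R d C k P).
Local Notation tile_of := (@tile_of R d C k P).
Local Notation good := (@good R d E k).
Local Notation pres := (@pres R d k).
Local Notation extent := (@extent R d lambda L).
Local Notation volume := (@volume R d C k P lambda S n ty hty L).
Let l1 : 1 < lambda := lambda_gt1 hS.
Let l0 : 0 < lambda := lambda_gt0 hS.

Definition tile_cell (t : ctile R d C) : Z := cell (barycenter t.1).

Lemma tile_presentation T t : Omega_EP E P T -> T t -> exists2 p, good p & tile_of p = t.
Proof. by move=> [_ hgen] /hgen[j [f Ef ->]]; exists (j, f). Qed.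

Lemma presentations T (lt : seq (ctile R d C)) : Omega_EP E P T -> uniq lt ->
  (forall t, t \in lt -> T t) -> exists2 l, packing E P l & perm_eq lt (map tile_of l).
Proof.
move=> OT ult ltT; have [l [pl lT lcov]] := ancestors hE hS hty hM (m := 0) OT ltT.
have [ul gl dl] := pl; exists [seq p <- l | tile_of p \in lt].
  split; first exact: filter_uniq.
    by move=> p; rewrite mem_filter => /andP[_]; exact: gl.
  by move=> p q; rewrite !mem_filter => /andP[_ pm] /andP[_ qm]; exact: dl.
apply: uniq_perm => //.
  rewrite map_inj_in_uniq ?filter_uniq// => p q; rewrite !mem_filter => /andP[_ pm] /andP[_ qm] pq.
  apply/eqP/negPn/negP => npq.
  by have := int_disjoint_neq hE eps0 hcenter (gl p pm) (dl p q pm qm npq); rewrite pq eqxx.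
move=> t; apply/idP/mapP => [tl|[q]]; last by rewrite mem_filter => /andP[+ _] ->.
by have [q qm qt] := lcov t tl; exists q => //; rewrite mem_filter qm qt tl.
Qed.

(** An infinite patch would contain more tiles than [packing_count] allows for centres in a bounded
    box. *)
Lemma finite_patch T (F : pred Z) (s : seq Z) : Omega_EP E P T -> (forall z, F z -> z \in s) ->
  exists l, uniq l /\ forall t, t \in l <-> T t /\ F (tile_cell t).
Proof.
move=> OT Fs; set A := [set t | T t /\ F (tile_cell t)].
have [D1 D10 hD1] := barycenter_near hE hP eps0 hcenter.
pose h : R := D1 + 1 + \sum_(z <- s) \sum_i `|(z 0 i)%:~R|.
have sum0 (r : seq Z) : 0 <= \sum_(z <- r) \sum_i `|(z 0 i)%:~R : R|.
  by apply: sumr_ge0 => z _; apply: sumr_ge0.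
have h0 : 0 <= h by rewrite addr_ge0// addr_ge0// ltW.
have zh z i : z \in s -> `|(z 0 i)%:~R : R| <= \sum_(z <- s) \sum_i `|(z 0 i)%:~R|.
  move=> zs; rewrite (big_rem z)//= (bigD1 i)//= -addrA lerDl addr_ge0//.
  exact: sumr_ge0.
have fA : finite_set A.
  apply: contrapT => /(infinite_set_fset (cover_bound d eps h).+1)[X XA].
  have XA' t : t \in enum_fset X -> A t by move=> tX; apply: XA.
  have [l pl pX] := presentations OT (fset_uniq X) (fun t tX => (XA' t tX).1).
  rewrite leqNgt ltnS -[#|` X|]/(size (enum_fset X)) (perm_size pX) size_map => /negP; apply.
  have [_ gl _] := pl; apply: (packing_count hE eps0 hcenter (x0 := 0) pl h0) => p pl' i.
  have /XA'[_ /Fs zs] : tile_of p \in enum_fset X by rewrite (perm_mem pX) map_f.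
  have := le_trans (coord_le_enorm _ i) (hD1 p (gl p pl')); have := zh _ i zs.
  have := cell_bound (barycenter (tile_of p).1) i; rewrite -/(tile_cell (tile_of p)) /h.
  move: (barycenter _) (tile_cell _) => b z hz; move: (\sum_(z <- s) _) => B.
  move: hz; rewrite !mxE subr0 !ler_norml; move: (_%:~R) => y /andP[y1 y2] /andP[y3 y4] /andP[y5 y6].
  by apply/andP; split; lra.
exists (enum_fset (fset_set A)); split; first exact: fset_uniq.
move=> t; split => [tA|tA]; have := in_fset_set fA t; first by rewrite tA => /esym/set_mem.
by move=> e; rewrite -[_ \in _]/(t \in fset_set A) e; apply/mem_set.
Qed.

Variables (D : R).
Hypotheses (D0 : 0 < D) (hD : forall p x, good p -> supp p x -> enorm (x - barycenter (supp p)) <= D).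

(** The tile containing the midpoint of a coarse cell of side 2 w has its barycenter within D < w of
    that midpoint. *)
Lemma tile_at T (w : nat) (f : Z) : Omega_EP E P T -> D < w%:R -> exists2 t, T t & coarse (2 * w) (tile_cell t) = f.
Proof.
move=> OT Dw; have w0 : (0 < w)%N by rewrite -(ltr_nat R); apply: lt_trans Dw.
pose x : V := \row_i ((2 * w)%:R * (f 0 i)%:~R + w%:R).
have [[_ _ cov _] _] := OT; have [t Tt tx] := cov x I.
exists t => //; apply/coarseP; first by rewrite muln_gt0.
move=> i; have [p gp pt] := tile_presentation OT Tt.
have := hD gp; rewrite -[supp p]/((tile_of p).1) pt => /(_ x tx) /(le_trans (coord_le_enorm _ i)).
have /andP[c1 c2] := cell_bound (barycenter t.1) i.
rewrite -/(tile_cell t) in c1 c2; move: (tile_cell t) c1 c2 => c; move: (barycenter t.1) => b c1 c2.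
rewrite !mxE ler_norml => /andP[b1 b2].
rewrite -ltzD1 -!(ltr_int R) !rmorphD !rmorphM /= -!pmulrn.
move: b1 b2; rewrite natrM; move: (_ * _%:~R) => y b1 b2.
by apply/andP; split; lra.
Qed.

Lemma volume_bound : exists2 v : R, 0 < v & forall a, v <= volume a 0.
Proof.
have v0 := volume_gt0 hE hP hS hty hM prim eps0 hcenter HL.
exists (\big[Order.min/1]_a volume a 0); last by move=> a; apply: bigmin_le_cond.
by apply: lt_bigmin => // a _; exact: v0.
Qed.

Lemma tile_extent T t : Omega_EP E P T -> T t -> exists a, extent t.1 = volume a 0.
Proof.
move=> OT /(tile_presentation OT)[p gp <-]; exists (type_of p).
exact: (extent_volume hE hP hS hty L gp).
Qed.

(* The discrepancy is proportional to the surface of the coarse cells G, hence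
   to N^(d-1) times the number of neighbouring cells, while each of these
   contains about N^d tiles; so it is absorbed when N is large. *)
Lemma boundary_absorption : (0 < n)%N -> r_mx R M < lambda ->
  exists theta N, [/\ 0 < theta, (0 < N)%N & forall T (G : seq Z), Omega_S E P lambda S T ->
  exists l l' : seq (ctile R d C), [/\ uniq l', 
    forall t, t \in l <-> T t /\ coarse N (tile_cell t) \in G,
    forall t, t \in l' -> T t /\ exists2 c, c \in G & forall i, `|coarse N (tile_cell t) 0 i - c 0 i| <= 1,
    (size l)%:R <= theta * \sum_(t <- l') extent t.1 &
    theta * \sum_(t <- l) extent t.1 <= (size l')%:R]].
Proof.
move=> n0 rl.
have [theta [K [th0 K0 hK]]] := tile_discrepancy d2 hE hP hS hty hM prim eps0 hcenter HL n0 rl.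
have [v v0 hv] := volume_bound.
(* Every cell of side w contains the barycenter of a tile, so a cell of side w p contains at least
   p^d of them. *)
pose w0 := (Num.truncn D).+1; pose w := (2 * w0)%N.
have Dw : D < w0%:R by exact: truncnS_gt.
have wgt : (0 < w)%N by [].
(* Every tile contributes at least c, both to the number of tiles and to theta times their
   volume. *)
pose c : R := Num.min 1 (theta * v).
have c0 : 0 < c by rewrite lt_min ltr01 mulr_gt0.
pose A : R := K * (d * (2 * w ^ d.-1))%:R / c.
pose p := (Num.truncn A).+1.
(* For one neighbouring cell, the discrepancy due to its collar, of order p^(d-1), is at most c
   times the number p^d of tiles that it must contain. *)
have hp : K * (d * (2 * (w * p) ^ d.-1))%:R <= c * (p ^ d)%:R.
  have Ap : A <= p%:R by apply/ltW; exact: truncnS_gt.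
  move: Ap; rewrite /A ler_pdivrMr// => Ap.
  have -> : (d * (2 * (w * p) ^ d.-1))%N = (d * (2 * w ^ d.-1) * p ^ d.-1)%N by rewrite expnMn !mulnA.
  have -> : (p ^ d)%N = (p * p ^ d.-1)%N by rewrite -expnS prednK// (leq_trans _ d2).
  by rewrite (natrM _ _ (p ^ _)) (natrM _ p) (mulrC c) mulrA [leRHS]mulrAC ler_wpM2r.
exists theta, (w * p)%N; split => // T G hT.
have Np : (0 < w * p)%N by rewrite muln_gt0.
have OT : Omega_EP E P T by have [T' OT' <-] := hT 0%N I.
pose B := neighbors G.
have patch (H : seq Z) := @finite_patch T (fun z => coarse (w * p) z \in H) (blocks (w * p) H) OT
  (fun z zH => etrans (mem_blocks H z Np) zH).
have [l [ul hl]] := patch G; have [lB [ulB hlB]] := patch B.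
have GB z : z \in B -> z \notin G by case/neighbors_near.
have count_B : ((size B * p ^ d) <= size lB)%N.
  have hex (f : Z) : exists t, T t /\ coarse w (tile_cell t) = f.
    by have [t Tt ct] := tile_at f OT Dw; exists t.
  have [tau htau] := choice hex.
  rewrite -size_blocks -(size_map tau); apply: uniq_leq_size.
    rewrite map_inj_uniq ?blocks_uniq ?undup_uniq// => f g fg.
    by rewrite -(htau f).2 -(htau g).2 fg.
  move=> _ /mapP[f fB ->]; apply/hlB; split; first exact: (htau f).1.
  by rewrite coarse_mul// (htau f).2 -mem_blocks.
have ext t : T t -> v <= extent t.1 by move=> /(tile_extent OT)[a ->].
have disc : `|(size l)%:R - theta * \sum_(t <- l) extent t.1| <= c * (size lB)%:R.
  apply: le_trans (hK T (fun z => coarse (w * p) z \in G) (collar (w * p) B) (blocks (w * p) G) l hT _ _ ul hl) _.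
  - by move=> z i; exact: collarP.
  - by move=> z; rewrite mem_blocks.
  rewrite size_collar// natrM mulrCA (le_trans (ler_wpM2l _ hp))// mulrCA ler_wpM2l ?(ltW c0)//.
  by rewrite -natrM ler_nat.
have cl : c * (size lB)%:R <= (size lB)%:R by rewrite ler_piMl// ge_min lexx.
have cv : c * (size lB)%:R <= theta * \sum_(t <- lB) extent t.1.
  apply: (@le_trans _ _ (theta * v * (size lB)%:R)); first by rewrite ler_wpM2r// ge_min lexx orbT.
  rewrite -mulrA ler_wpM2l ?(ltW th0)// -sum1_size natr_sum mulr_sumr big_seq [leRHS]big_seq.
  by apply: ler_sum => t /hlB[Tt _]; rewrite mulr1 ext.
(* The enlarged list adds the tiles over the neighbouring cells; they outweigh the discrepancy of l
   in both comparisons. *)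
exists l, (l ++ lB); split => //.
- rewrite cat_uniq ul ulB andbT /=; apply/hasPn => t /hlB[_ tB]; apply/negP => /hl[_ tG].
  by have := GB _ tB; rewrite tG.
- move=> t; rewrite mem_cat => /orP[/hl[Tt tG]|/hlB[Tt tB]]; split => //.
    by exists (coarse (w * p) (tile_cell t)) => // i; rewrite subrr normr0.
  by case/neighbors_near: tB.
- by rewrite big_cat /= mulrDr; move: disc cv; rewrite ler_norml => /andP[_]; lra.
- by rewrite size_cat natrD; move: disc cl; rewrite ler_norml => /andP[+ _]; lra.
Qed.

End Patches.

(** * Matching tiles with lattice points *)

Section PointSets.
Variables (R : realType) (d : nat).
Local Notation V := 'rV[R]_d.
Local Notation Z := 'rV[int]_d.
Implicit Types (X Y : set V) (x y : V) (r : R) (z : Z).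

Definition locally_finite X := forall x r, finite_set (X `&` cball x r).

Definition separated X := exists2 r, 0 < r & forall x, is_subset1 (X `&` cball x r).

Definition candidates X r x : {fset V} := fset_set (X `&` cball x r).

Lemma mem_candidates X r x y : locally_finite X -> (y \in candidates X r x) <-> X y /\ enorm (y - x) <= r.
Proof.
move=> lf; have e := in_fset_set (lf x r) y; rewrite /candidates e; split; first by move/set_mem.
by move=> h; apply/mem_set.
Qed.

Lemma separated_continuous X (f : V -> V) : separated X -> {within X, continuous f}.
Proof.
move=> [r r0 sep]; apply/subspace_continuousP => x Xx; apply: cvg_near_cst.
apply/(interior_cballP _ x); exists r => // y yx Xy; congr f.
by apply: (sep x); split => //; rewrite /cball/= subrr enorm0 ltW.
Qed.

(** In either alternative of [bernstein], y and phi y are joined by an edge of one of the two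
    graphs, which have the same radius r. *)
Lemma hall_bounded_displacement Y X r : countable Y -> countable X ->
  locally_finite Y -> locally_finite X -> separated Y -> separated X ->
  hall Y (candidates X r) -> hall X (candidates Y r) -> bounded_displacement Y X.
Proof.
move=> cY cX lY lX sY sX /(hall_injection cY)[f [fX finj]] /(hall_injection cX)[g [gY ginj]].
have fP y : Y y -> X (f y) /\ enorm (f y - y) <= r by move=> /fX /(mem_candidates _ _ _ lX).
have gP x : X x -> Y (g x) /\ enorm (g x - x) <= r by move=> /gY /(mem_candidates _ _ _ lY).
have [phi [psi [h1 h2 h3 h4 h5]]] := bernstein (fun y Yy => (fP y Yy).1) (fun x Xx => (gP x Xx).1) finj ginj.
exists phi, psi; split.
  split => //; first by move=> _ [y /h1 Xy <-].
    by move=> _ [x /h2 Yx <-].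
  by split; apply: separated_continuous.
exists r => y Yy; have [->|e] := h5 y Yy; first exact: (fP y Yy).2.
by rewrite -[X in _ - X]e enorm_distC; exact: (gP _ (h1 y Yy)).2.
Qed.

Lemma int_box_seq (h : nat) : exists s : seq Z, forall z, (forall i, `|z 0 i| <= h%:Z) -> z \in s.
Proof.
exists [seq u - const_mx h%:Z | u <- grid d (2 * h).+1] => z hz.
apply/mapP; exists (z + const_mx h%:Z); last by rewrite addrK.
by rewrite mem_grid; apply/forallP => i; have := hz i; rewrite !mxE; move: (z 0 i) => a; lia.
Qed.

Lemma lattice_point_inj beta : 0 < beta -> injective (@lattice_point R d beta).
Proof.
move=> b0 z w /rowP e; apply/rowP => i; have := e i; rewrite !mxE.
by move=> /(mulfI (lt0r_neq0 b0))/intr_inj.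
Qed.

Lemma lattice_locally_finite beta : 0 < beta -> locally_finite (@scaled_lattice R d beta).
Proof.
move=> b0 x r; pose h := (Num.truncn ((r + enorm x) / beta)).+1.
have [s hs] := int_box_seq h.
apply: (@sub_finite_set _ _ [set` map (lattice_point beta) s]) => [y [[z _ <-] zx]|]; last exact: finite_seq.
apply/mapP; exists z => //; apply: hs => i.
rewrite -(ler_int R) intr_norm; apply: le_trans (ltW (truncnS_gt _)).
rewrite ler_pdivlMr// mulrC -[X in X * _](ger0_norm (ltW b0)) -normrM.
have := coord_le_enorm (beta *: map_mx intr z) i; rewrite !mxE => h1; apply: le_trans h1 _.
rewrite -[_ *: _](subrK x); apply: le_trans (enormD _ _) _; rewrite lerD2r.
exact: zx.
Qed.

Lemma lattice_separated beta : 0 < beta -> separated (@scaled_lattice R d beta).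
Proof.
move=> b0; exists (beta / 3); first by rewrite divr_gt0.
move=> x _ _ [[z _ <-] zx] [[w _ <-] wx]; congr (_ *: map_mx _ _); apply/rowP => i.
have := le_trans (coord_le_enorm _ i) zx; have := le_trans (coord_le_enorm _ i) wx.
rewrite !mxE !ler_norml => /andP[h1 h2] /andP[h3 h4].
have : `|beta * ((z 0 i)%:~R - (w 0 i)%:~R)| < beta.
  rewrite mulrBr ltr_norml; move: (beta * (z 0 i)%:~R) (beta * (w 0 i)%:~R) h1 h2 h3 h4.
  by move=> a b h1 h2 h3 h4; apply/andP; split; lra.
rewrite normrM gtr0_norm// -[X in _ < X]mulr1 ltr_pM2l// -rmorphB -intr_norm.
by rewrite -[1]/(1%:~R) ltr_int; move: (z 0 i) (w 0 i) => a b; lia.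
Qed.

Lemma lattice_countable beta : countable (@scaled_lattice R d beta).
Proof. by apply: card_le_trans (card_image_le _ _) _; exact: countableP. Qed.

Lemma cell_near (n : nat) x y : (0 < n)%N ->
  (forall i, `|coarse n (cell x) 0 i - coarse n (cell y) 0 i| <= 1) ->
  enorm (x - y) <= d%:R * (2 * n%:R + 1).
Proof.
move=> n0 h; apply: enorm_le_sup => [|i]; first by rewrite addr_ge0// mulr_ge0.
have := h i; have /(_ i) := (coarseP (cell x) _ n0).1 erefl; have /(_ i) := (coarseP (cell y) _ n0).1 erefl.
have /andP[] := cell_bound x i; have /andP[] := cell_bound y i; rewrite [(x - y) 0 i]mxE [(- y) 0 i]mxE.
move: (cell x) (cell y) (coarse n (cell x)) (coarse n (cell y)) => cv cu ca cb.
move: (ca 0 i) (cb 0 i) (cv 0 i) (cu 0 i) => a b v u y1 y2 x1 x2 hu hv hab.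
have : `|v%:~R - u%:~R : R| <= 2 * n%:R.
  rewrite -rmorphB -intr_norm -[2 * n%:R]natrM pmulrn ler_int.
  have : `|n%:Z * (a - b)| <= n%:Z by rewrite normrM ger0_norm// ler_piMr.
  by rewrite mulrBr; move: (n%:Z * a) (n%:Z * b) hu hv => p q; lia.
by rewrite !ler_norml => /andP[h1 h2]; apply/andP; split; lra.
Qed.

Lemma cube_point beta z x : 0 < beta -> cube beta z x -> enorm (x - lattice_point beta z) <= d%:R * beta.
Proof.
move=> b0 zx; apply: enorm_le_sup (ltW b0) _ => i; have /andP[h1 h2] := zx i.
by rewrite !mxE ger0_norm.
Qed.

Lemma in_cube beta x : 0 < beta -> exists z : Z, cube beta z x.
Proof.
move=> b0; exists (cell (beta^-1 *: x)) => i; have := cell_bound (beta^-1 *: x) i.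
rewrite [X in _ <= X < _]mxE; move: (cell _) => z; rewrite mulrC ler_pdivlMr// ltr_pdivrMr// mulrDl mul1r mulrC.
by move=> /andP[h1 h2]; apply/andP; split; lra.
Qed.

End PointSets.

Section Matching.
Variables (R : realType) (d : nat) (C : Type).
Local Notation V := 'rV[R]_d.
Local Notation Z := 'rV[int]_d.
Variables (E : set (V -> V)) (k : nat) (P : 'I_k -> ctile R d C).
Variables (lambda : R) (S : 'I_k -> set (ctile R d C)).
Variables (n : nat) (ty : 'I_k -> 'I_n) (M : 'M[nat]_n).
Hypotheses (hE : isometry_group E) (hP : forall i, is_tile (P i)).
Hypothesis (hS : substitution_rule E P lambda S).
Hypotheses (hty : type_numbering P lambda S ty) (hM : substitution_matrix E P S ty M).
Hypothesis (prim : primitive_mx M).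
Variables (center : 'I_k -> V) (eps : R).
Hypotheses (eps0 : 0 < eps) (hcenter : forall i, cball (center i) eps `<=` (P i).1).
Variables (L : (nat -> R) -> R) (HL : banach_limit L).
Variables (D : R).
Hypotheses (D0 : 0 < D) (hD : forall p x, @good R d E k p -> supp P p x -> enorm (x - barycenter (supp P p)) <= D).

Local Notation supp := (@supp R d C k P).
Local Notation tile_of := (@tile_of R d C k P).
Local Notation extent := (@extent R d lambda L).
Local Notation iextent := (@iextent R d lambda L).
Local Notation body := (fun t : ctile R d C => t.1).
Let l1 : 1 < lambda := lambda_gt1 hS.

Variables (T : set (ctile R d C)) (beta theta : R) (N : nat).
Hypotheses (OT : Omega_EP E P T) (inj : set_inj T (fun t => barycenter t.1)).
Hypotheses (b0 : 0 < beta) (th0 : 0 < theta) (N0 : (0 < N)%N) (htheta : theta * extent (box beta) = 1).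
Hypothesis absorb : forall G : seq Z, exists l l' : seq (ctile R d C), [/\ uniq l',
  forall t, t \in l <-> T t /\ coarse N (tile_cell t) \in G,
  forall t, t \in l' -> T t /\ exists2 c, c \in G & forall i, `|coarse N (tile_cell t) 0 i - c 0 i| <= 1,
  (size l)%:R <= theta * \sum_(t <- l') extent t.1 &
  theta * \sum_(t <- l) extent t.1 <= (size l')%:R].

Local Notation X := (barycenters T).
Local Notation Y := (@scaled_lattice R d beta).
(** Three hops: between barycenters in equal or adjacent coarse cells, from a barycenter to a point
    of its tile, and from that point to the corner of the lattice cube containing it. *)
Let r : R := d%:R * (2 * N%:R + 1) + D + d%:R * beta.

Lemma tile_near t x : T t -> t.1 x -> enorm (x - barycenter t.1) <= D.
Proof. by move=> /(tile_presentation OT)[p gp <-] tx; exact: hD gp tx. Qed.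

Lemma tile_ebounded t : T t -> ebounded t.1.
Proof. by move=> /(tile_presentation OT)[p gp <-]; exact: (supp_bounded hE hP gp). Qed.

Lemma bounded_patch (h : R) : exists l, uniq l /\
  (forall t, t \in l -> T t) /\ forall t, T t -> enorm (barycenter t.1) <= h -> t \in l.
Proof.
have [s hs] := int_box_seq d (Num.truncn h).+2.
have [l [ul hl]] :=
  finite_patch hE hP hS hty hM eps0 hcenter (F := mem s) OT (fun z zs => zs).
exists l; split => //; split=> [t /hl[]//|t Tt th]; apply/hl; split => //; apply: hs => i.
have := le_trans (coord_le_enorm _ i) th; have /andP[] := cell_bound (barycenter t.1) i.
have := truncnS_gt h; rewrite -/(tile_cell t).
move: (barycenter t.1) (tile_cell t) => b z; move: (z 0 i) (b 0 i) => a y h0 h1 h2 h3.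
rewrite -(ler_int R) intr_norm -pmulrn -[(Num.truncn h).+2]addn1 natrD.
by move: h3; rewrite !ler_norml => /andP[h3 h4]; apply/andP; split; lra.
Qed.

Lemma barycenters_locally_finite : locally_finite X.
Proof.
move=> x h; have [l [_ [_ hl]]] := bounded_patch (h + enorm x).
apply: (@sub_finite_set _ _ [set` map (fun t => barycenter t.1) l]) => [y [[t Tt <-] tx]|]; last exact: finite_seq.
apply: (map_f (fun t : ctile R d C => barycenter t.1)); apply: hl => //.
rewrite -[barycenter _](subrK x); apply: le_trans (enormD _ _) _; rewrite lerD2r.
exact: tx.
Qed.

(** The extent is subadditive in general; on tiles it equals the inner extent, which is
    superadditive. *)
Lemma sum_extent_tiles (l : seq (ctile R d C)) A : uniq l -> (forall t, t \in l -> T t) ->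
  ebounded A -> (forall t, t \in l -> t.1 `<=` A) -> \sum_(t <- l) extent t.1 <= extent A.
Proof.
move=> ul lT bA lA; have [lp [up gp dp] pl] := presentations hE hS hty hM eps0 hcenter OT ul lT.
have in_l p : p \in lp -> tile_of p \in l by move=> h; rewrite (perm_mem pl) map_f.
rewrite (perm_big _ pl) big_map; apply: le_trans (iextent_le l1 HL bA).
rewrite (eq_big_seq (fun p => iextent (supp p))); last first.
  move=> p plp; rewrite (iextent_volume hE hP hS hty hM prim eps0 hcenter HL (gp p plp)).
  exact: (extent_volume hE hP hS hty L (gp p plp)).
apply: iextent_ge_sum => // p plp; exact: (lA _ (in_l p plp)).
Qed.

Lemma near_chain (t t' : ctile R d C) z x : T t -> t.1 x -> cube beta z x ->
  (forall i, `|coarse N (tile_cell t') 0 i - coarse N (tile_cell t) 0 i| <= 1) ->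
  enorm (barycenter t'.1 - lattice_point beta z) <= r.
Proof.
move=> Tt tx zx tt; apply: le_trans (enorm_triangle (barycenter t.1) _ _) _.
rewrite /r -addrA lerD ?(cell_near N0)//.
apply: le_trans (enorm_triangle x _ _) _; rewrite lerD ?(cube_point b0)//.
by rewrite enorm_distC tile_near.
Qed.

(** The points of I are at most as many as the tiles of l, hence at most theta times the volume of
    l'. The cubes meeting l' cover that volume and weigh exactly 1 each by the normalization of
    beta; their corners are near I. *)
Lemma hall_tiles_lattice : hall X (candidates Y r).
Proof.
move=> I IX; have [l [l' [ul' hl hl' h1 _]]] := absorb [seq coarse N (cell x) | x <- enum_fset I].
have sI : (#|` I| <= size l)%N.
  rewrite -(size_map (fun t : ctile R d C => barycenter t.1)); apply: uniq_leq_size; first exact: fset_uniq.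
  move=> x xI; have [t Tt e] := IX x xI; apply/mapP; exists t => //; apply/hl; split => //.
  by rewrite /tile_cell e; apply: (map_f (fun x => coarse N (cell x))).
have [H hH] : ebounded (seqU l' body) by apply: seqU_bounded => t /hl'[Tt _]; exact: tile_ebounded.
have [s hs] := int_box_seq d (Num.truncn (H / beta)).+2.
pose W := [seq z <- undup s | `[< exists2 x, cube beta z x & seqU l' body x >]].
have cov : seqU l' body `<=` seqU W (cube beta).
  move=> x xl; have [z zx] := in_cube x b0; exists z => //.
  rewrite mem_filter; apply/andP; split; first by apply/asboolP; exists x.
  rewrite mem_undup; apply: hs => i; have := zx i.
  have := le_trans (coord_le_enorm _ i) (hH x xl); have := truncnS_gt (H / beta).
  rewrite ltr_pdivrMr// => h2.
  rewrite -(ler_int R) intr_norm -pmulrn -[(Num.truncn _).+2]addn1 natrD.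
  rewrite -(ler_pM2l b0) -[X in X * `|_|](gtr0_norm b0) -normrM.
  move: h2; rewrite mulrDr mulr1 [_ * beta]mulrC; move: (beta * _) (beta * _) => u v.
  by rewrite !ler_norml => h2 /andP[h3 h4] /andP[h5 h6]; apply/andP; split; lra.
have sW : (size W <= #|` nbhd (candidates Y r) I|)%N.
  rewrite -(size_map (lattice_point beta)); apply: uniq_leq_size.
    by rewrite map_inj_uniq ?filter_uniq ?undup_uniq//; exact: lattice_point_inj.
  move=> _ /mapP[z zW ->]; apply/in_nbhd.
  move: zW; rewrite mem_filter => /andP[/asboolP[x zx [t tl' tx]] _].
  have [Tt [_ /mapP[y yI ->] near]] := hl' t tl'; exists y => //.
  apply/(mem_candidates _ _ _ (lattice_locally_finite b0)); split; first by exists z.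
  have [t' Tt' e] := IX y yI; rewrite enorm_distC -e; apply: (near_chain Tt tx zx) => i.
  by rewrite /tile_cell e distrC; exact: near.
apply: leq_trans sI (leq_trans _ sW); rewrite -(ler_nat R); apply: le_trans h1 _.
have bW : ebounded (seqU W (cube beta)) by apply: seqU_bounded => z _; exact: cube_bounded.
apply: (@le_trans _ _ (theta * extent (seqU W (cube beta)))).
  rewrite ler_wpM2l ?(ltW th0)// sum_extent_tiles// => [t /hl'[]//|t tl' x tx].
  by apply: cov; exists t.
apply: (@le_trans _ _ (theta * \sum_(z <- W) extent (cube beta z))).
  rewrite ler_wpM2l ?(ltW th0)//; apply: extent_le_sum => // z _; exact: cube_bounded.
rewrite (eq_bigr (fun=> extent (box beta))); last by move=> z _; exact: cube_extent.
by rewrite big_const_seq count_predT iter_addr_0 mulrnAr htheta.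
Qed.

(** The cubes attached to I have total weight |I|; the tiles meeting them cover them, so theta times
    the volume of l is at least |I|, and l' is at least as numerous. Its barycenters are distinct
    and near I. *)
Lemma hall_lattice_tiles : hall Y (candidates X r).
Proof.
move=> I IY; have hz (y : V) : exists z, y \in I -> lattice_point beta z = y.
  have [/IY[z _ <-]|] := boolP (y \in I); first by exists z.
  by move=> _; exists 0.
have [zof zofP] := choice hz.
pose W := map zof (enum_fset I).
have uW : uniq W.
  rewrite map_inj_in_uniq ?fset_uniq// => x y xI yI e.
  by rewrite -(zofP x xI) -(zofP y yI) e.
have sW : size W = #|` I| by rewrite size_map.
have bW : ebounded (seqU W (cube beta)) by apply: seqU_bounded => z _; exact: cube_bounded.
have [H hH] := bW; have [lb [_ [lbT hlb]]] := bounded_patch (D + H).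
pose lm := [seq t <- lb | `[< exists2 x, t.1 x & seqU W (cube beta) x >]].
have [l [l' [ul' hl hl' _ h2]]] := absorb [seq coarse N (tile_cell t) | t : ctile R d C <- lm].
have lT t : t \in l -> T t by case/hl.
have cov : seqU W (cube beta) `<=` seqU l body.
  move=> x xW; have [[_ _ covT _] _] := OT; have [t Tt tx] := covT x Logic.I.
  exists t => //; apply/hl; split => //; apply/mapP; exists t => //.
  rewrite mem_filter; apply/andP; split; first by apply/asboolP; exists x.
  apply: hlb => //; rewrite -[barycenter _](subrK x); apply: le_trans (enormD _ _) _.
  by rewrite lerD ?hH// enorm_distC tile_near.
have sl' : (size l' <= #|` nbhd (candidates X r) I|)%N.
  rewrite -(size_map (fun t : ctile R d C => barycenter t.1)); apply: uniq_leq_size.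
    rewrite map_inj_in_uniq// => t u /hl'[Tt _] /hl'[Tu _]; apply: inj; exact/mem_set.
  move=> _ /mapP[t tl' ->]; apply/in_nbhd; have [Tt [_ /mapP[t0 t0l ->] near]] := hl' t tl'.
  move: t0l; rewrite mem_filter => /andP[/asboolP[x tx [_ /mapP[y yI ->] zx]] t0l].
  exists y => //; apply/(mem_candidates _ _ _ barycenters_locally_finite); split; first by exists t.
  by rewrite -(zofP y yI); apply: (near_chain (lbT _ t0l) tx zx).
apply: leq_trans sl'; rewrite -(ler_nat R); apply: le_trans h2.
rewrite -sW; apply: (@le_trans _ _ (theta * iextent (seqU W (cube beta)))).
  have -> : (size W)%:R = theta * \sum_(z <- W) iextent (cube beta z).
    rewrite (eq_bigr (fun=> extent (box beta))).
      by rewrite big_const_seq count_predT iter_addr_0 mulrnAr htheta.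
    by move=> z _; rewrite cube_iextent// iextent_box// ltW.
  rewrite ler_wpM2l ?(ltW th0)//; apply: iextent_ge_sum => // [z zW x zx|z w _ _ zw]; first by exists z.
  exact: cube_disjoint.
rewrite ler_wpM2l ?(ltW th0)//; apply: le_trans (iextent_le l1 HL bW) _.
by apply: extent_le_sum => // t tl; exact: tile_ebounded (lT t tl).
Qed.

Lemma matching : delone X -> bounded_displacement Y X.
Proof.
move=> [r0 [_ [r00 _ _ sep]]].
apply: (hall_bounded_displacement (r := r)).
- exact: lattice_countable.
- have [[cT _ _ _] _] := OT; exact: card_le_trans (card_image_le _ _) cT.
- exact: lattice_locally_finite.
- exact: barycenters_locally_finite.
- exact: lattice_separated.
- by exists r0.
- exact: hall_lattice_tiles.
- exact: hall_tiles_lattice.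
Qed.

End Matching.

(** * Choice of the lattice constant and conclusion *)

Theorem theorem2p2 (R : realType) (d : nat) (C : Type)
    (E : set ('rV[R]_d -> 'rV[R]_d))
    (k : nat) (P : 'I_k -> ctile R d C)
    (lambda : R) (S : 'I_k -> set (ctile R d C))
    (n : nat) (ty : 'I_k -> 'I_n) (M : 'M[nat]_n) :
  (2 <= d)%N ->
  isometry_group E ->
  (forall i, is_tile (P i)) ->
  substitution_rule E P lambda S ->
  type_numbering P lambda S ty ->
  substitution_matrix E P S ty M ->
  primitive_mx M ->
  r_mx R M < lambda ->
  exists2 beta : R, 0 < beta &
    forall T : set (ctile R d C), Omega_S E P lambda S T ->
      set_inj T (fun t => barycenter t.1) ->
      delone (barycenters T) ->
      bounded_displacement (scaled_lattice beta) (barycenters T).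
Proof.
move=> d2 hE hP hS hty hM prim rl.
(* An admissible tiling T0 provides interior points of the prototiles; if there is none, any beta
   will do. *)
have [[T0 hT0]|noT] := pselect (exists T, Omega_S E P lambda S T); last first.
  by exists 1 => // T hT; case: noT; exists T.
have OS T : Omega_S E P lambda S T -> Omega_EP E P T by move=> hT; have [T' OT' <-] := hT 0%N I.
have OT0 := OS T0 hT0.
have [center [eps [eps0 hcenter]]] := centers_exist hE hS hty hM prim OT0.
have [L HL] := banach_limit_exists R.
have l1 := lambda_gt1 hS.
have n0 : (0 < n)%N.
  have [[_ _ cov _] hgen] := OT0; have [t Tt _] := cov 0 Logic.I; have [i _] := hgen t Tt.
  exact: leq_ltn_trans (leq0n _) (ltn_ord (ty i)).
have [Da Da0 hDa] := diameter_bound hE hP center.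
have [Db Db0 hDb] := barycenter_near hE hP eps0 hcenter.
have D0 : 0 < Da + Db by rewrite addr_gt0.
have hD p x : good E p -> supp P p x -> enorm (x - barycenter (supp P p)) <= Da + Db.
  move=> gp px; apply: le_trans (enorm_triangle (pcenter center p) _ _) _.
  by rewrite lerD ?hDa// enorm_distC; exact: hDb.
have [theta [N [th0 N0 absorb]]] := boundary_absorption d2 hE hP hS hty hM prim eps0 hcenter HL D0 hD n0 rl.
have q0 : 0 < @extent R d lambda L (box 1) by exact: extent_box_gt0.
pose c := (theta * @extent R d lambda L (box 1))^-1.
have c0 : 0 < c by rewrite invr_gt0 mulr_gt0.
(* beta is the d-th root of c, so that theta beta^d times the extent of the unit box is 1; it is
   chosen before T. *)
exists (expR (ln c / d%:R)); first exact: expR_gt0.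
move=> T hT inj.
have absT G := absorb T G hT.
refine (matching hE hP hS hty hM prim eps0 hcenter HL hD (OS T hT) inj (expR_gt0 _) th0 N0 _ absT).
have dn0 : d%:R != 0 :> R by rewrite pnatr_eq0 -lt0n (leq_trans _ d2).
rewrite extent_box ?expR_gt0// -expRM_natl (mulrC d%:R) divfK// lnK// mulrCA /c mulVf//.
by rewrite gt_eqF// mulr_gt0.
Qed.
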